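(* (i) Let $p=p(n)\in[0,1]$ be such that $np(n)\to\infty$ as $n\to\infty$, and let $G$ be an Erdős–Rényi random graph $G(n,p)$. Then the divisorial gonality of $G$ is $\Theta(n)$ asymptotically almost surely. More generally, the divisorial gonality of any metric graph $\Gamma$ having the random graph $G(n,p)$ as a model is $\Theta(n)$: there exist constants $c_1,c_2>0$ such that, with probability tending to $1$ as $n\to\infty$, every metric graph $\Gamma$ having $G$ as a model (i.e. for every choice of positive edge lengths) satisfies $c_1 n\le\gamma_{\mathrm{div}}(\Gamma)\le c_2 n$. (ii) Let $d\geq 3$ be a fixed integer. The divisorial gonality of a random $d$-regular graph on $n$ vertices is $\Theta(n)$ asymptotically almost surely, i.e. there exist constants $c_1,c_2>0$ such that it lies between $c_1n$ and $c_2n$ with probability tending to $1$ as $n\to\infty$ (over $n$ with $nd$ even).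
   Context: Random graphs. $G(n,p)$ is the random simple graph on $n$ vertices in which each pair of vertices is joined by an edge independently with probability $p$. A random $d$-regular graph on $n$ vertices is a uniformly random simple $d$-regular graph on $n$ labelled vertices. ''Asymptotically almost surely'' means with probability tending to $1$ as $n\to\infty$. $f=\Theta(g)$ means there are constants $c_1,c_2>0$ with $c_1g\le f\le c_2g$. Metric graphs. A metric graph $\Gamma$ with model a finite simple graph $G=(V,E)$ is the metric space obtained by assigning a length $\ell(e)>0$ to each edge and realizing each edge $e$ as a segment of length $\ell(e)$, glued at the vertices according to $G$, with the path metric. The divisorial gonality of a finite graph $G$ is that of the metric graph with model $G$ and all edge lengths equal to $1$. If $G$ is not connected, the definitions below are applied verbatim to the resulting finite disjoint union of connected metric graphs. Divisorial gonality. $\mathrm{Div}(\Gamma)$ is the free abelian group on the points of $\Gamma$; the degree of $D=\sum_v a_v (v)$ is $\sum_v a_v$, and $D$ is effective ($D\ge 0$) if all $a_v\ge 0$. A rational function on $\Gamma$ is a continuous piecewise linear function $f:\Gamma\to\mathbb{R}$ with integer slopes; $\mathrm{ord}_p(f)$ is the sum of the outgoing slopes of $f$ at $p$ (over all directions emanating from $p$), and $\mathrm{div}(f)=\sum_p\mathrm{ord}_p(f)(p)$. Divisors $D,D'$ are linearly equivalent, $D\sim D'$, if $D-D'=\mathrm{div}(f)$ for some rational function $f$. Set $|D|=\{E\ge 0: E\sim D\}$. The rank of $D$ is $r(D)=\min\{\deg(E): E\geq 0,\ |D-E|=\emptyset\}-1$. The divisorial gonality $\gamma_{\mathrm{div}}(\Gamma)$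 is the smallest integer $d$ for which there is a divisor $D$ on $\Gamma$ with $\deg(D)=d$ and $r(D)=1$. *)

(* Defs.v *)
From HB Require Import structures.
From mathcomp Require Import all_boot all_order all_algebra.
From mathcomp Require Import all_classical all_reals all_analysis.
From mathcomp.multinomials Require Export freeg.

Set Implicit Arguments.
Unset Strict Implicit.
Unset Printing Implicit Defensive.

Import Order.TTheory GRing.Theory Num.Theory.
Import numFieldNormedType.Exports.

Local Open Scope classical_set_scope.
Local Open Scope ring_scope.

(* An unordered pair {i, j} of distinct vertices is stored as (i, j) with
   i < j, so every subset of [vpair n] is the edge set of exactly one simple
   graph on the vertices 'I_n. *)
Definition vpair (n : nat) : Type :=
  {e : 'I_n * 'I_n | (e.1 < e.2)%N}.
HB.instance Definition _ n := SubFinite.on (vpair n).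

Definition src n (e : vpair n) : 'I_n := (val e).1.
Definition tgt n (e : vpair n) : 'I_n := (val e).2.

Definition graph (n : nat) : Type := {set vpair n}.
HB.instance Definition _ n := Finite.on (graph n).

Definition vdegree n (G : graph n) (v : 'I_n) : nat :=
  #|[pred e : vpair n | (e \in G) && ((src e == v) || (tgt e == v))]|.

Definition regular_graph n (d : nat) (G : graph n) : bool :=
  [forall v : 'I_n, vdegree G v == d].

Definition prob_Gnp (R : realType) n (p : R) (A : set (graph n)) : R :=
  \sum_(G : graph n | G \in A)
    \prod_(e : vpair n) (if e \in G then p else 1 - p).

(* The value is 0 when there is no d-regular graph on n vertices. *)
Definition prob_regular (R : realType) n (d : nat) (A : set (graph n)) : R :=
  #|[pred G : graph n | regular_graph d G && (G \in A)]|%:R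
    / #|[pred G : graph n | regular_graph d G]|%:R.

Record metric_graph (R : realType) (n : nat) := MetricGraph {
  model : graph n;
  len : vpair n -> R;
  len_gt0 : forall e, e \in model -> 0 < len e
}.

Definition unit_metric_graph (R : realType) n (G : graph n) :
  metric_graph R n :=
  @MetricGraph R n G (fun _ => 1) (fun _ _ => ltr01).

Section Points.
Context (R : realType) (n : nat) (Gam : metric_graph R n).

(* A point is a vertex, [inl v], or the interior point [inr (e, t)] of an edge
   e at distance t from [src e] along e. *)
Definition is_point (x : 'I_n + vpair n * R) : bool :=
  match x with
  | inl _ => true
  | inr (e, t) => (e \in model Gam) && (0 < t < len Gam e)
  end.

Definition mpoint : Type := {x : 'I_n + vpair n * R | is_point x}.
HB.instance Definition _ := SubChoice.on mpoint.

Definition vertex (v : 'I_n) : mpoint := exist is_point (inl v) isT.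

(* For e in the model, the parametrization of the segment e by [0, len e]:
   0 is sent to [src e] and [len e] to [tgt e]. *)
Definition chart (e : vpair n) (t : R) : mpoint :=
  if len Gam e <= t then vertex (tgt e)
  else insubd (vertex (src e)) (inr (e, t)).

(* [path_of r x y]: y can be reached from x by finitely many moves, each
   inside one closed edge, of total length r. *)
Inductive path_of : R -> mpoint -> mpoint -> Prop :=
| path_nil x : path_of 0 x x
| path_step e a b r y :
    e \in model Gam -> 0 <= a <= len Gam e -> 0 <= b <= len Gam e ->
    path_of r (chart e b) y -> path_of (`|a - b| + r) (chart e a) y.

(* +oo between different components *)
Definition path_dist (x y : mpoint) : \bar R :=
  ereal_inf [set r%:E | r in [set r | path_of r x y]].

Definition point_ball (x : mpoint) (eps : R) (y : mpoint) : Prop :=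
  (path_dist x y < eps%:E)%E.

Lemma point_ballP x eps y :
  point_ball x eps y <-> exists2 r, path_of r x y & r < eps.
Proof.
split=> [/ereal_inf_lt[_ [r xy <-]]|[r xy re]].
  by rewrite lte_fin; exists r.
apply: (@le_lt_trans _ _ r%:E); last by rewrite lte_fin.
by apply: ereal_inf_lbound; exists r.
Qed.

Lemma path_cat r s x y z :
  path_of r x y -> path_of s y z -> path_of (r + s) x z.
Proof.
move=> h; elim: h => {r x y} [x|e a b r y ein ha hb _ IH] hyz.
  by rewrite add0r.
by rewrite -addrA; apply: path_step => //; exact: IH.
Qed.

Lemma path_sym r x y : path_of r x y -> path_of r y x.
Proof.
elim=> {r x y} [x|e a b r y ein ha hb _ IH]; first exact: path_nil.
rewrite addrC distrC; apply: (path_cat IH).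
rewrite -[`|b - a|]addr0; apply: path_step => //; exact: path_nil.
Qed.

Lemma point_ball_center x (eps : R) : 0 < eps -> point_ball x eps x.
Proof. by move=> e0; apply/point_ballP; exists 0 => //; exact: path_nil. Qed.

Lemma point_ball_sym x y (eps : R) : point_ball x eps y -> point_ball y eps x.
Proof.
by move=> /point_ballP[r /path_sym h re]; apply/point_ballP; exists r.
Qed.

Lemma point_ball_triangle x y z (e1 e2 : R) :
  point_ball x e1 y -> point_ball y e2 z -> point_ball x (e1 + e2) z.
Proof.
move=> /point_ballP[r hr re] /point_ballP[s hs se]; apply/point_ballP.
by exists (r + s); [exact: path_cat hr hs|exact: ltrD].
Qed.

Definition point_entourage : set_system (mpoint * mpoint) :=
  entourage_ point_ball.

HB.instance Definition _ := hasNbhs.Build mpoint (nbhs_ point_entourage).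
HB.instance Definition _ := @Nbhs_isPseudoMetric.Build R mpoint
  point_entourage erefl point_ball point_ball_center point_ball_sym
  point_ball_triangle erefl.

End Points.

Section Divisors.
Context (R : realType) (n : nat) (Gam : metric_graph R n).

Definition mdivisor : Type := {freeg (mpoint Gam) / int}.

Definition effective (D : mdivisor) : bool := fgle 0 D.

Definition integral_PL_on (l : R) (g : R -> R) : Prop :=
  exists (k : nat) (t : nat -> R),
    [/\ t 0%N = 0, t k = l &
        forall i, (i < k)%N -> t i < t i.+1 /\
          exists m : int, forall x, t i <= x <= t i.+1 ->
            g x = g (t i) + m%:~R * (x - t i)].

Definition rational_function (f : mpoint Gam -> R) : Prop :=
  continuous f /\
  forall e, e \in model Gam -> integral_PL_on (len Gam e) (f \o chart Gam e).

(* Outgoing slopes of g at t in the two directions: both are computed with the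
   parameter moving away from t at unit speed. *)
Definition slope_fwd (g : R -> R) (t : R) : R :=
  lim ((g (t + h) - g t) / h @[h --> 0^'+]).
Definition slope_bwd (g : R -> R) (t : R) : R :=
  lim ((g (t - h) - g t) / h @[h --> 0^'+]).

Definition ord_at (f : mpoint Gam -> R) (x : mpoint Gam) : R :=
  match val x with
  | inl v =>
      \sum_(e in model Gam | src e == v) slope_fwd (f \o chart Gam e) 0
      + \sum_(e in model Gam | tgt e == v)
          slope_bwd (f \o chart Gam e) (len Gam e)
  | inr (e, t) =>
      slope_fwd (f \o chart Gam e) t + slope_bwd (f \o chart Gam e) t
  end.

(* [is_div f D]: D = div(f) *)
Definition is_div (f : mpoint Gam -> R) (D : mdivisor) : Prop :=
  forall x, (coeff x D)%:~R = ord_at f x.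

Definition lin_equiv (D D' : mdivisor) : Prop :=
  exists2 f, rational_function f & is_div f (D - D').

Definition linear_system (D : mdivisor) : set mdivisor :=
  [set E | effective E /\ lin_equiv E D].

End Divisors.

Definition is_min (A : set int) (m : int) : Prop := A m /\ lbound A m.

Definition has_rank (R : realType) n (Gam : metric_graph R n)
    (D : mdivisor Gam) (r : int) : Prop :=
  is_min [set deg E | E in
           [set E : mdivisor Gam | effective E /\ linear_system (D - E) = set0]]
         (r + 1).

Definition is_div_gonality (R : realType) n (Gam : metric_graph R n)
    (d : int) : Prop :=
  is_min [set deg D | D in [set D : mdivisor Gam | has_rank D 1]] d.

Definition div_gonality_between (R : realType) n (a b : R)
    (Gam : metric_graph R n) : Prop :=
  exists2 d : int, is_div_gonality Gam d & a <= d%:~R <= b.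

(* Main.v *)
Require Import Defs.
From mathcomp Require Import all_boot all_order all_algebra.
From mathcomp Require Import all_classical all_reals all_analysis.
From mathcomp Require Import ring lra zify.

(** The gonality is at most n for every metric graph on n vertices: one chip on
    every vertex has positive rank, since an interior point of an edge can be
    reached by moving the chips at its two ends towards each other
    (all_vertices_positive_rank).

    The lower bound is a deterministic statement about well-linked graphs, in
    which any two disjoint sets of at least n / 8 vertices that cover all but 2 k
    vertices are joined by more than k edges. There a divisor of positive rank
    has degree more than k, for all edge lengths (positive_rank_deg). Let D be an
    effective divisor of degree at most k, and let f be a function with D + div f
    effective. At most k edges cross from a superlevel set of f to its complement
    (cut_bound), so f is constant on more than three quarters of the vertices
    (majority); normalise this value to 0. Such functions are stable under
    maxima and bounded on the large components, so D can be replaced by an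
    equivalent D0 from which no such function raises a vertex by the length of an
    edge (nearly_reduced). This is an approximate form of the divisor that is
    reduced with respect to the bulk of the graph. The chips of D0 touch at most
    2 k vertices, and by well-linkedness a large component survives their
    deletion. A subharmonicity argument on this component shows that no move from
    D0 puts a chip on any of its vertices, so D does not have positive rank.

    When n p tends to infinity, G(n, p) is well-linked for k = n / 8 with
    probability tending to 1, by a union bound over 4 ^ n pairs of sets
    (weight_not_linked).

    With probability tending to 1, a random d-regular graph with d >= 3 has
    linearly many edges across every cut whose sides have at least n / 8 vertices,
    and is therefore well-linked for k a small multiple of n. For a fixed cut, switching two edges on either side into
    two edges across the cut compares the number of regular graphs with j and with
    j + 2 edges across it (switching). Up to a factor close to 1 the ratio is that
    of perfect matchings of the d n half-edges, where the numbers are explicit.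
    Chaining these comparisons up to the most likely value of j bounds the
    probability of few edges across the cut (regular_cut_chain), and
    Vandermonde's inequality shows that it is exponentially smaller than the
    inverse of the number of cuts of that size (split_count_gain). *)

Set Implicit Arguments.
Unset Strict Implicit.
Unset Printing Implicit Defensive.

Import Order.TTheory GRing.Theory Num.Theory.
Import numFieldNormedType.Exports.

Local Open Scope classical_set_scope.
Local Open Scope ring_scope.

(** * Piecewise linear functions with integer slopes *)

Section Germs.
Context (R : realType).
Implicit Types (phi psi : R -> R) (c d m a : R).

Definition germ phi c m := \forall h \near 0^'+, phi h = c + m * h.

Lemma germ_lim phi c m : germ phi c m -> lim ((phi h - c) / h @[h --> 0^'+]) = m.
Proof.
move=> g; apply/cvg_lim => //; apply: (@cvg_trans _ ((fun=> m : R) @ (0:R)^'+)).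
  apply: near_eq_cvg; near=> h.
  have -> : phi h = c + m * h by near: h; exact: g.
  by rewrite addrAC subrr add0r mulfK // gt_eqF //; near: h; exact: nbhs_right_gt.
exact: cvg_cst.
Unshelve. all: by end_near. Qed.

Lemma germ_le phi psi c m n :
  (\forall h \near 0^'+, phi h <= psi h) ->
  germ phi c m -> germ psi c n -> m <= n.
Proof.
move=> le gp gq.
have : \forall h \near (0:R)^'+, m <= n.
  near=> h.
  have h0 : 0 < h by near: h; exact: nbhs_right_gt.
  have : phi h <= psi h by near: h.
  have -> : phi h = c + m * h by near: h; exact: gp.
  have -> : psi h = c + n * h by near: h; exact: gq.
  by rewrite lerD2l ler_pM2r.
by move=> /filter_ex[].
Unshelve. all: by end_near. Qed.

Lemma germ_add phi psi c d m n :
  germ phi c m -> germ psi d n -> germ (fun h => phi h + psi h) (c + d) (m + n).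
Proof. by apply: filterS2 => h -> ->; ring. Qed.

Lemma germ_opp phi c m : germ phi c m -> germ (fun h => - phi h) (- c) (- m).
Proof. by apply: filterS => h ->; ring. Qed.

Lemma germ_affine phi c m : (forall h, phi h = c + m * h) -> germ phi c m.
Proof. by move=> e; apply: nearW. Qed.

Lemma germ_lt phi psi c d m n : c < d -> germ phi c m -> germ psi d n ->
  \forall h \near 0^'+, phi h < psi h.
Proof.
move=> cd gp gq; near=> h.
have -> : phi h = c + m * h by near: h; exact: gp.
have -> : psi h = d + n * h by near: h; exact: gq.
have h0 : 0 < h by near: h; exact: nbhs_right_gt.
have : h < (d - c) / (`|m - n| + 1).
  near: h; apply: nbhs_right_lt; apply: divr_gt0; first by rewrite subr_gt0.
  by rewrite ltr_wpDl.
rewrite ltr_pdivlMr; last by rewrite ltr_wpDl.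
have := ler_norm (m - n); set N := `|_|; move=> mN hN.
have : (m - n) * h <= N * h by rewrite ler_pM2r.
by nra.
Unshelve. all: by end_near. Qed.

Lemma germ_max phi psi c d m n : germ phi c m -> germ psi d n ->
  exists k, (k = m \/ k = n) /\
    germ (fun h => Num.max (phi h) (psi h)) (Num.max c d) k.
Proof.
move=> gp gq; have [cd|dc|cd] := ltgtP c d.
- exists n; split; first by right.
  have lt := germ_lt cd gp gq.
  by rewrite /germ; apply: filterS2 gq lt => h <- /ltW /max_idPr.
- exists m; split; first by left.
  have lt := germ_lt dc gq gp.
  by rewrite /germ; apply: filterS2 gp lt => h <- /ltW /max_idPl.
- subst d; have [mn|nm] := leP m n.
  + exists n; split; first by right.
    rewrite /germ; near=> h.
    have h0 : 0 <= h by near: h; exact: nbhs_right_ge.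
    have -> : phi h = c + m * h by near: h; exact: gp.
    have -> : psi h = c + n * h by near: h; exact: gq.
    by apply/max_idPr; rewrite lerD2l ler_wpM2r.
  + exists m; split; first by left.
    rewrite /germ; near=> h.
    have h0 : 0 <= h by near: h; exact: nbhs_right_ge.
    have -> : phi h = c + m * h by near: h; exact: gp.
    have -> : psi h = c + n * h by near: h; exact: gq.
    by apply/max_idPl; rewrite lerD2l ler_wpM2r // ltW.
Unshelve. all: by end_near. Qed.

(** Both one-sided slopes are germs at 0 on the right: the parameter moves away
    from t at unit speed in either direction, so an outgoing slope to the left
    is the opposite of the left derivative. *)
Definition rslope (g : R -> R) t m := germ (fun h => g (t + h)) (g t) m.
Definition lslope (g : R -> R) t m := germ (fun h => g (t - h)) (g t) m.

Lemma rslope_fwd g t m : rslope g t m -> slope_fwd g t = m.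
Proof. exact: germ_lim. Qed.

Lemma lslope_bwd g t m : lslope g t m -> slope_bwd g t = m.
Proof. exact: germ_lim. Qed.

Lemma rslope_on g t s m : t < s ->
  (forall x, t <= x <= s -> g x = g t + m * (x - t)) -> rslope g t m.
Proof.
move=> ts e; rewrite /rslope /germ; near=> h.
rewrite e; first by rewrite [t + h]addrC addrK.
have h0 : 0 < h by near: h; exact: nbhs_right_gt.
have : h < s - t by near: h; apply: nbhs_right_lt; rewrite subr_gt0.
by move=> ?; apply/andP; split; lra.
Unshelve. all: by end_near. Qed.

Lemma lslope_on g t s m : s < t ->
  (forall x, s <= x <= t -> g x = g t + m * (t - x)) -> lslope g t m.
Proof.
move=> ts e; rewrite /lslope /germ; near=> h.
rewrite e; first by congr (_ + _ * _); lra.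
have h0 : 0 < h by near: h; exact: nbhs_right_gt.
have : h < t - s by near: h; apply: nbhs_right_lt; rewrite subr_gt0.
by move=> ?; apply/andP; split; lra.
Unshelve. all: by end_near. Qed.

Lemma germP phi c m : germ phi c m ->
  exists2 e, 0 < e & forall h, 0 < h <= e -> phi h = c + m * h.
Proof.
move=> /nbhs_ballP[e /= e0 H]; exists (e / 2); first by rewrite divr_gt0.
move=> h /andP[h0 he]; apply: H => //=.
rewrite /ball /= sub0r normrN gtr0_norm //; lra.
Qed.

Lemma rslopeP g t m : rslope g t m -> exists2 e, 0 < e &
  forall x, t <= x <= t + e -> g x = g t + m * (x - t).
Proof.
move=> /germP[e e0 H]; exists e => // x /andP[tx xe].
have [->|tnx] := eqVneq x t; first by rewrite subrr mulr0 addr0.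
rewrite -[in LHS](subrK t x) [_ + t]addrC H // subr_gt0 lt_neqAle eq_sym tnx tx /=.
by rewrite lerBlDl.
Qed.

Lemma lslopeP g t m : lslope g t m -> exists2 e, 0 < e &
  forall x, t - e <= x <= t -> g x = g t + m * (t - x).
Proof.
move=> /germP[e e0 H]; exists e => // x /andP[tx xe].
have [->|tnx] := eqVneq x t; first by rewrite subrr mulr0 addr0.
rewrite -[in LHS](subKr t x) H // subr_gt0 lt_neqAle tnx xe /=; lra.
Qed.

(** A subdivision of the interval is awkward to refine, while slopes on both
    sides of every point visibly pass to sums and maxima. *)
Definition locally_PL (l : R) (g : R -> R) :=
  (forall t, 0 <= t < l -> exists m : int, rslope g t m%:~R) /\
  (forall t, 0 < t <= l -> exists m : int, lslope g t m%:~R).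

Lemma PL_breaks (l : R) g : 0 < l -> integral_PL_on l g ->
  exists k (t : nat -> R) (m : nat -> int),
  [/\ t 0%N = 0, t k.+1 = l & forall i, (i <= k)%N -> t i < t i.+1 /\
    forall x, t i <= x <= t i.+1 -> g x = g (t i) + (m i)%:~R * (x - t i)].
Proof.
move=> l0 [[|k] [t [t0 tl H]]]; first by move: l0; rewrite -tl t0 ltxx.
have /choice[m Hm] : forall i, exists m : int, (i <= k)%N -> t i < t i.+1 /\
    forall x, t i <= x <= t i.+1 -> g x = g (t i) + m%:~R * (x - t i).
  move=> i; have [ik|_] := leqP i k; last by exists 0.
  by have [? [m ?]] := H i ik; exists m.
by exists k, t, m.
Qed.

Lemma breaks_nondecreasing (k : nat) (t : nat -> R) :
  (forall i, (i < k)%N -> t i < t i.+1) ->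
  forall i j, (i <= j <= k)%N -> t i <= t j.
Proof.
move=> H i j /andP[]; elim: j => [|j IH]; first by rewrite leqn0 => /eqP ->.
rewrite leq_eqVlt => /orP[/eqP -> //|ij jk].
by apply: (le_trans (IH ij (ltnW jk))); apply/ltW/H.
Qed.

Lemma breaks_piece (k : nat) (t : nat -> R) x : t 0%N <= x < t k ->
  exists i, (i < k)%N /\ t i <= x < t i.+1.
Proof.
elim: k => [/andP[a b]|k IH /andP[a b]].
  by have := le_lt_trans a b; rewrite ltxx.
have [xk|kx] := ltP x (t k).
  have [|i [ik ?]] := IH; first by rewrite a.
  by exists i; split => //; rewrite ltnS ltnW.
by exists k; rewrite ltnSn kx.
Qed.

Lemma breaks_piece_left (k : nat) (t : nat -> R) x : t 0%N < x <= t k ->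
  exists i, (i < k)%N /\ t i < x <= t i.+1.
Proof.
elim: k => [/andP[a b]|k IH /andP[a b]].
  by have := lt_le_trans a b; rewrite ltxx.
have [xk|kx] := leP x (t k).
  have [|i [ik ?]] := IH; first by rewrite a.
  by exists i; split => //; rewrite ltnS ltnW.
by exists k; rewrite ltnSn kx.
Qed.

Lemma rslope_inside g s u m x :
  (forall y, s <= y <= u -> g y = g s + m * (y - s)) ->
  s <= x < u -> rslope g x m.
Proof.
move=> H /andP[sx xu]; apply: (rslope_on xu) => y /andP[xy yu].
by rewrite H ?(le_trans sx xy) // (H x) ?sx ?ltW //; ring.
Qed.

Lemma lslope_inside g s u m x :
  (forall y, s <= y <= u -> g y = g s + m * (y - s)) ->
  s < x <= u -> lslope g x (- m).
Proof.
move=> H /andP[sx xu]; apply: (lslope_on sx) => y /andP[sy yx].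
by rewrite H ?(le_trans yx xu) ?sy // (H x) ?xu ?ltW //; ring.
Qed.

Lemma PL_locally (l : R) g : integral_PL_on l g -> locally_PL l g.
Proof.
move=> [k [t [t0 tl H]]]; split=> x xl.
- have [|i [ik ix]] := @breaks_piece k t x; first by rewrite t0 tl.
  have [_ [m Hm]] := H _ ik; exists m; exact: rslope_inside Hm ix.
- have [|i [ik ix]] := @breaks_piece_left k t x; first by rewrite t0 tl.
  have [_ [m Hm]] := H _ ik; exists (- m).
  by rewrite rmorphN; exact: lslope_inside Hm ix.
Qed.

Lemma PL_extend (s u : R) g (m : int) : integral_PL_on s g -> s < u ->
  (forall x, s <= x <= u -> g x = g s + m%:~R * (x - s)) -> integral_PL_on u g.
Proof.
move=> [k [t [t0 ts H]]] su e.
exists k.+1, (fun i => if (i <= k)%N then t i else u); split => //.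
  by rewrite ltnn.
move=> i; rewrite ltnS leq_eqVlt => /orP[/eqP ->|ik] /=.
  by rewrite eqxx ltnn ts; split => //; exists m.
by rewrite ik orbT; exact: H.
Qed.

(** The supremum u of the s such that g is piecewise linear on the interval
    from 0 to s is itself such an s, because g is affine just before u; and u
    cannot be smaller than l, because g is also affine just after u. *)
Lemma locally_PL_PL l g : 0 <= l -> locally_PL l g -> integral_PL_on l g.
Proof.
move=> l0 [Hr Hl].
pose S := [set s : R | 0 <= s <= l /\ integral_PL_on s g].
have S0 : S 0.
  by split; [rewrite lexx|exists 0%N, (fun=> 0); split].
have ubS : ubound S l by move=> s [/andP[_ ->]].
have hS : has_sup S by split; [exists 0|exists l].
set u := sup S.
have u0 : 0 <= u by apply: ub_le_sup => //; exists l.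
have ul : u <= l by apply: ge_sup => //; exists 0.
have Su : S u.
  split; first by rewrite u0.
  have [ueq|unz] := eqVneq u 0; first by rewrite ueq; case: S0.
  have upos : 0 < u by rewrite lt_neqAle eq_sym unz u0.
  have [|m /lslopeP[e e0 He]] := Hl u; first by rewrite upos.
  have [s [sl sPL] us] := sup_adherent e0 hS.
  rewrite -/u in us.
  have su : s <= u by apply: ub_le_sup => //; exists l.
  have [<- //|snu] := eqVneq s u.
  have slt : s < u by rewrite lt_neqAle snu.
  apply: (PL_extend (m := - m) sPL slt) => x /andP[sx xu].
  rewrite He ?xu ?andbT; last by apply: le_trans sx; exact: ltW.
  by rewrite (He s) ?su ?andbT 1?ltW // rmorphN; ring.
have [ueq|unl] := eqVneq u l; first by rewrite -ueq; case: Su.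
have ult : u < l by rewrite lt_neqAle unl.
have [|m /rslopeP[e e0 He]] := Hr u; first by rewrite u0.
have uv : u < Num.min l (u + e) by rewrite lt_min ult ltrDl.
have Sv : S (Num.min l (u + e)).
  split; first by rewrite (le_trans u0 (ltW uv)) ge_min lexx.
  apply: (PL_extend (m := m) (proj2 Su) uv) => x /andP[ux].
  by rewrite le_min => /andP[_ xe]; apply: He; rewrite ux.
have := ub_le_sup _ Sv; rewrite -/u leNgt uv => H.
by have : false by apply: H; exists l.
Qed.

Lemma locally_PL_add l f g :
  locally_PL l f -> locally_PL l g -> locally_PL l (fun x => f x + g x).
Proof.
move=> [fr fl] [gr gl]; split => t tl.
- have [m Hm] := fr _ tl; have [n Hn] := gr _ tl; exists (m + n).
  by rewrite rmorphD; exact: germ_add.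
- have [m Hm] := fl _ tl; have [n Hn] := gl _ tl; exists (m + n).
  by rewrite rmorphD; exact: germ_add.
Qed.

Lemma locally_PL_opp l f : locally_PL l f -> locally_PL l (fun x => - f x).
Proof.
move=> [fr fl]; split => t tl.
- by have [m Hm] := fr _ tl; exists (- m); rewrite rmorphN; exact: germ_opp.
- by have [m Hm] := fl _ tl; exists (- m); rewrite rmorphN; exact: germ_opp.
Qed.

Lemma locally_PL_max l f g :
  locally_PL l f -> locally_PL l g ->
  locally_PL l (fun x => Num.max (f x) (g x)).
Proof.
move=> [fr fl] [gr gl]; split => t tl.
- have [m Hm] := fr _ tl; have [n Hn] := gr _ tl.
  by have [k [[->|->] Hk]] := germ_max Hm Hn; [exists m|exists n].
- have [m Hm] := fl _ tl; have [n Hn] := gl _ tl.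
  by have [k [[->|->] Hk]] := germ_max Hm Hn; [exists m|exists n].
Qed.

Lemma locally_PL_affine l f c (m : int) :
  (forall x, f x = c + m%:~R * x) -> locally_PL l f.
Proof.
move=> e; split=> t _; [exists m|exists (- m)]; apply: germ_affine => h;
  by rewrite !e ?rmorphN; ring.
Qed.

Lemma PL_Lipschitz (l : R) g : integral_PL_on l g ->
  exists2 L, 0 <= L & forall a b, 0 <= a <= l -> 0 <= b <= l ->
    `|g a - g b| <= L * `|a - b|.
Proof.
move=> [k [t [t0 tl H]]].
suff [L L0 HL] : exists2 L, 0 <= L & forall a b, t 0%N <= a <= t k ->
    t 0%N <= b <= t k -> `|g a - g b| <= L * `|a - b|.
  by exists L => // a b; rewrite -tl -[X in X <= a]t0 -[X in X <= b]t0; exact: HL.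
elim: k {tl} H => [|k IH] H.
  exists 0 => // a b; rewrite -!eq_le => /eqP <- /eqP <-.
  by rewrite !subrr normr0 mulr0.
have [|L L0 HL] := IH; first by move=> i ik; apply: H; rewrite ltnW.
have [tk [m Hm]] := H k (ltnSn k).
exists (L + `|m%:~R|); first exact: addr_ge0.
have t0k : t 0%N <= t k.
  apply: (@breaks_nondecreasing k); last by rewrite leqnn leq0n.
  by move=> i ik; apply: (proj1 (H i _)); rewrite ltnW.
have main a b : t 0%N <= a -> a <= b -> b <= t k.+1 ->
    `|g a - g b| <= (L + `|m%:~R|) * `|a - b|.
  move=> a0 ab bk; rewrite mulrDl.
  have [ak|ka] := leP a (t k); last first.
    rewrite (Hm a) ?(Hm b) ?(ltW ka) ?(le_trans ab bk) ?bk ?(le_trans (ltW ka) ab) //.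
    have -> : g (t k) + m%:~R * (a - t k) - (g (t k) + m%:~R * (b - t k)) =
      m%:~R * (a - b) by ring.
    by rewrite normrM lerDr mulr_ge0.
  have [bk'|kb] := leP b (t k).
    apply: le_trans (HL _ _ _ _) _; rewrite ?a0 ?ak ?bk' ?(le_trans a0 ab) //.
    by rewrite lerDl mulr_ge0.
  have h1 := HL a (t k); rewrite a0 ak t0k lexx in h1.
  have h2 : g b = g (t k) + m%:~R * (b - t k) by apply: Hm; rewrite bk ltW.
  have -> : g a - g b = (g a - g (t k)) + (- m%:~R * (b - t k)) by rewrite h2; ring.
  apply: (le_trans (ler_normD _ _)); rewrite normrM normrN.
  have e1 : `|a - t k| <= `|a - b|.
    by rewrite distrC (distrC a b) !ger0_norm; lra.
  have e2 : `|b - t k| <= `|a - b|.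
    by rewrite (distrC a b) !ger0_norm; lra.
  by apply: lerD; [apply: le_trans (h1 _ _) _|]; rewrite ?ler_wpM2l.
move=> a b /andP[a0 ak] /andP[b0 bk]; have [ab|/ltW ba] := leP a b.
  exact: main.
by rewrite distrC (distrC a b); exact: main.
Qed.

End Germs.

(** * Orders of rational functions *)

Section Charts.
Context (R : realType) (n : nat) (Gam : metric_graph R n).
Implicit Types (e : vpair n) (t : R) (x y : mpoint Gam) (f g : mpoint Gam -> R).
Local Notation len := (len Gam).
Local Notation chart := (@chart R n Gam).
Local Notation vertex := (@vertex R n Gam).

Lemma chart_len e : chart e (len e) = vertex (tgt e).
Proof. by rewrite /chart lexx. Qed.

Lemma val_chart e t : e \in model Gam -> 0 < t < len e ->
  val (chart e t) = inr (e, t).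
Proof.
move=> em /andP[t0 tl]; rewrite /Defs.chart ifF; last by rewrite leNgt tl.
by rewrite val_insubd /= em t0 tl.
Qed.

Lemma chart0 e : e \in model Gam -> chart e 0 = vertex (src e).
Proof.
move=> em; rewrite /Defs.chart ifF; last by rewrite leNgt (len_gt0 em).
by apply/val_inj; rewrite val_insubd /= ltxx andbF.
Qed.

Lemma point_cases x : (exists v, x = vertex v) \/
  (exists e t, [/\ e \in model Gam, 0 < t < len e & x = chart e t]).
Proof.
case: x => [[v|[e t]]] /= p; first by left; exists v; apply/val_inj.
right; exists e, t; have /andP[em te] := p; split => //.
by apply/val_inj; rewrite val_chart.
Qed.

Lemma ord_chart f e t : e \in model Gam -> 0 < t < len e ->
  ord_at f (chart e t) =
  slope_fwd (f \o chart e) t + slope_bwd (f \o chart e) t.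
Proof. by move=> em te; rewrite /ord_at val_chart. Qed.

(** The topology is that of the path metric, so a bound on the slopes along
    edges adds up along paths to a Lipschitz bound. *)
Lemma Lipschitz_continuous f (L : R) : 0 <= L ->
  (forall e a b, e \in model Gam -> 0 <= a <= len e -> 0 <= b <= len e ->
     `|f (chart e a) - f (chart e b)| <= L * `|a - b|) -> continuous f.
Proof.
move=> L0 H x.
have lip r y z : path_of r y z -> `|f y - f z| <= L * r.
  elim=> {r y z} [y|e a b r y em ha hb _ IH].
    by rewrite subrr normr0 mulr0.
  rewrite -(subrKA (f (chart e b))) mulrDr.
  by apply: (le_trans (ler_normD _ _)); apply: lerD => //; exact: H.
have FF : Filter (nbhs x) by exact: nbhs_filter.
apply/(@cvgrPdist_lt _ _ _ _ FF) => eps eps0; apply/nbhs_ballP.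
exists (eps / (L + 1)) => /=; first by rewrite divr_gt0 // ltr_wpDl.
move=> y /point_ballP[r xy]; rewrite ltr_pdivlMr ?ltr_wpDl // => re.
apply: le_lt_trans (lip _ _ _ xy) _; apply: le_lt_trans re.
have r0 : 0 <= r.
  by elim: xy => *; rewrite ?addr_ge0.
by rewrite mulrDr mulr1 mulrC lerDl.
Qed.

(** Continuity is automatic: finitely many piecewise linear functions have a
    common bound on their slopes. *)
Lemma rational_functionP f : rational_function f <->
  forall e, e \in model Gam -> locally_PL (len e) (f \o chart e).
Proof.
split=> [[_ H] e em|H]; first exact/PL_locally/H.
have PL e : e \in model Gam -> integral_PL_on (len e) (f \o chart e).
  by move=> em; apply: locally_PL_PL; [apply/ltW/len_gt0|exact: H].
split=> //.
have /choice[L HL] : forall e, exists L, 0 <= L /\ (e \in model Gam ->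
    forall a b, 0 <= a <= len e -> 0 <= b <= len e ->
     `|f (chart e a) - f (chart e b)| <= L * `|a - b|).
  move=> e; have [em|_] := boolP (e \in model Gam); last by exists 0.
  by have [L L0 HL] := PL_Lipschitz (PL e em); exists L.
apply: (@Lipschitz_continuous f (\sum_e L e)).
  by apply: sumr_ge0 => e _; exact: (proj1 (HL e)).
move=> e a b em ha hb; apply: (le_trans ((proj2 (HL e)) em a b ha hb)).
rewrite ler_wpM2r // (bigD1 e) //= lerDl.
by apply: sumr_ge0 => e' _; exact: (proj1 (HL e')).
Qed.

Lemma rational_add f g : rational_function f -> rational_function g ->
  rational_function (fun x => f x + g x).
Proof.
move=> /rational_functionP Hf /rational_functionP Hg; apply/rational_functionP => e em.
by apply: locally_PL_add; [exact: Hf|exact: Hg].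
Qed.

Lemma rational_opp f : rational_function f -> rational_function (fun x => - f x).
Proof.
move=> /rational_functionP Hf; apply/rational_functionP => e em.
by apply: locally_PL_opp; exact: Hf.
Qed.

Lemma rational_max f g : rational_function f -> rational_function g ->
  rational_function (fun x => Num.max (f x) (g x)).
Proof.
move=> /rational_functionP Hf /rational_functionP Hg; apply/rational_functionP => e em.
by apply: locally_PL_max; [exact: Hf|exact: Hg].
Qed.

Lemma rational_cst (c : R) : rational_function (fun _ : mpoint Gam => c).
Proof.
apply/rational_functionP => e em; apply: (@locally_PL_affine _ _ _ c 0) => x.
by rewrite /= mul0r addr0.
Qed.

Lemma rational_src f e : rational_function f -> e \in model Gam ->
  exists m : int, rslope (f \o chart e) 0 m%:~R.
Proof.
by move=> /rational_functionP Hf em; apply: (proj1 (Hf e em)); rewrite lexx (len_gt0 em).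
Qed.

Lemma rational_tgt f e : rational_function f -> e \in model Gam ->
  exists m : int, lslope (f \o chart e) (len e) m%:~R.
Proof.
by move=> /rational_functionP Hf em; apply: (proj2 (Hf e em)); rewrite lexx (len_gt0 em).
Qed.

Lemma ord_at_add f g x : rational_function f -> rational_function g ->
  ord_at (fun x => f x + g x) x = ord_at f x + ord_at g x.
Proof.
move=> Hf Hg.
have [[v ->]|[e [t [em te ->]]]] := point_cases x; last first.
  rewrite !ord_chart //; have /rational_functionP/(_ e em)[fr fl] := Hf.
  have /rational_functionP/(_ e em)[gr gl] := Hg.
  have /andP[t0 tl] := te.
  have [|m Hm] := fr t; first by rewrite ltW.
  have [|m' Hm'] := fl t; first by rewrite t0 ltW.
  have [|n1 Hn] := gr t; first by rewrite ltW.
  have [|n' Hn'] := gl t; first by rewrite t0 ltW.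
  rewrite (rslope_fwd Hm) (lslope_bwd Hm') (rslope_fwd Hn) (lslope_bwd Hn').
  rewrite (rslope_fwd (germ_add Hm Hn)) (lslope_bwd (germ_add Hm' Hn')); ring.
rewrite /ord_at /= addrACA -!big_split /=; congr (_ + _); apply: eq_bigr => e /andP[em _].
- have [m Hm] := rational_src Hf em; have [m' Hm'] := rational_src Hg em.
  by rewrite (rslope_fwd Hm) (rslope_fwd Hm') (rslope_fwd (germ_add Hm Hm')).
- have [m Hm] := rational_tgt Hf em; have [m' Hm'] := rational_tgt Hg em.
  by rewrite (lslope_bwd Hm) (lslope_bwd Hm') (lslope_bwd (germ_add Hm Hm')).
Qed.

Lemma ord_at_cst (c : R) x : ord_at (fun _ => c) x = 0.
Proof.
have rs e t : rslope ((fun=> c) \o chart e) t 0.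
  by apply: germ_affine => h; rewrite /= mul0r addr0.
have ls e t : lslope ((fun=> c) \o chart e) t 0.
  by apply: germ_affine => h; rewrite /= mul0r addr0.
have [[v ->]|[e [t [em te ->]]]] := point_cases x; last first.
  by rewrite ord_chart // (rslope_fwd (rs _ _)) (lslope_bwd (ls _ _)) addr0.
rewrite /ord_at /= !big1 ?addr0 // => e _; first exact: lslope_bwd.
exact: rslope_fwd.
Qed.

Lemma ord_at_opp f x : rational_function f ->
  ord_at (fun x => - f x) x = - ord_at f x.
Proof.
move=> Hf; apply/eqP; rewrite -subr_eq0 opprK; apply/eqP.
rewrite -(ord_at_add x (rational_opp Hf) Hf).
rewrite [X in ord_at X](_ : _ = (fun=> 0)) ?ord_at_cst //.
by apply/funext => y; rewrite addNr.
Qed.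

(** Where f touches a function g from below, all outgoing slopes of f are at
    most those of g. *)
Lemma ord_at_le f g x : rational_function f -> rational_function g ->
  (forall y, f y <= g y) -> f x = g x -> ord_at f x <= ord_at g x.
Proof.
move=> Hf Hg fg.
have le e t u v m n1 : f (chart e t) = g (chart e t) ->
    germ (fun h => f (chart e (u h))) (f (chart e v)) m ->
    germ (fun h => g (chart e (u h))) (f (chart e v)) n1 -> m <= n1.
  by move=> _; apply: germ_le; apply: nearW.
have [[v ->]|[e [t [em te ->]]]] := point_cases x => fgx; last first.
  rewrite !ord_chart //; have /rational_functionP/(_ e em)[fr fl] := Hf.
  have /rational_functionP/(_ e em)[gr gl] := Hg.
  have /andP[t0 tl] := te.
  have [|m Hm] := fr t; first by rewrite ltW.
  have [|m' Hm'] := fl t; first by rewrite t0 ltW.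
  have [|n1 Hn] := gr t; first by rewrite ltW.
  have [|n' Hn'] := gl t; first by rewrite t0 ltW.
  rewrite (rslope_fwd Hm) (lslope_bwd Hm') (rslope_fwd Hn) (lslope_bwd Hn').
  rewrite /rslope /lslope /= -fgx in Hn Hn'.
  by apply: lerD; [exact: (le _ _ _ _ _ _ fgx Hm Hn)|exact: (le _ _ _ _ _ _ fgx Hm' Hn')].
rewrite /ord_at /=; apply: lerD; apply: ler_sum => e /andP[em /eqP ev].
- have [m Hm] := rational_src Hf em; have [m' Hm'] := rational_src Hg em.
  rewrite (rslope_fwd Hm) (rslope_fwd Hm').
  have E : f (chart e 0) = g (chart e 0) by rewrite chart0 // ev.
  by move: Hm'; rewrite /rslope /= -E; exact: le E Hm.
- have [m Hm] := rational_tgt Hf em; have [m' Hm'] := rational_tgt Hg em.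
  rewrite (lslope_bwd Hm) (lslope_bwd Hm').
  have E : f (chart e (len e)) = g (chart e (len e)) by rewrite chart_len ev.
  by move: Hm'; rewrite /lslope /= -E; exact: le E Hm.
Qed.

(** Hence the functions f with D + div f effective are stable under maxima. *)
Lemma ord_at_max f g x : rational_function f -> rational_function g ->
  Num.min (ord_at f x) (ord_at g x) <=
  ord_at (fun y => Num.max (f y) (g y)) x.
Proof.
move=> Hf Hg; have Hm := rational_max Hf Hg.
have [gf|/ltW fg] := leP (g x) (f x).
- apply: le_trans (ord_at_le (x := x) Hf Hm _ _); first by rewrite ge_min lexx.
  + by move=> y; rewrite le_max lexx.
  + by apply/esym/max_idPl.
- apply: le_trans (ord_at_le (x := x) Hg Hm _ _); first by rewrite ge_min lexx orbT.
  + by move=> y; rewrite le_max lexx orbT.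
  + by apply/esym/max_idPr.
Qed.

End Charts.

(** * Divisors and slopes along edges *)

Section Divisors.
Context (R : realType) (n : nat) (Gam : metric_graph R n).
Implicit Types (e : vpair n) (t : R) (x y : mpoint Gam) (f g : mpoint Gam -> R).
Implicit Types (D E : mdivisor Gam) (v w : 'I_n).
Local Notation len := (len Gam).
Local Notation chart := (@chart R n Gam).
Local Notation vertex := (@vertex R n Gam).

Definition inside e x : bool := if val x is inr (e', _) then e' == e else false.

Definition edge_deg D e : int := \sum_(x <- dom D | inside e x) coeff x D.

Lemma sum_coeff_dom D (P : pred (mpoint Gam)) (s : seq (mpoint Gam)) :
  uniq s -> (forall x, x \in s -> P x) ->
  (forall x, P x -> coeff x D != 0 -> x \in s) ->
  \sum_(x <- dom D | P x) coeff x D = \sum_(x <- s) coeff x D.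
Proof.
move=> us sP Ps.
rewrite [RHS](bigID (mem (dom D))) /= [X in _ + X]big1 ?addr0; last first.
  by move=> x /coeff_outdom.
rewrite -big_filter -[RHS]big_filter; apply: perm_big; apply: uniq_perm.
- by rewrite filter_uniq // uniq_dom.
- exact: filter_uniq.
move=> x; rewrite !mem_filter mem_dom andbC.
have [xz|xnz] /= := eqVneq (coeff x D) 0; first by [].
by apply/idP/idP => [/Ps|/sP //]; apply.
Qed.

Lemma sum_coeff_le_edge_deg D e (s : seq (mpoint Gam)) : effective D ->
  uniq s -> (forall x, x \in s -> inside e x) ->
  \sum_(x <- s) coeff x D <= edge_deg D e.
Proof.
move=> /fgposP D0 us se.
rewrite /edge_deg (@sum_coeff_dom D _ (undup (s ++ [seq x <- dom D | inside e x]))).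
- rewrite [leRHS](bigID (mem s)) /= -[X in _ <= X + _]big_filter.
  rewrite [X in _ <= X + _](perm_big s) ?lerDl ?sumr_ge0 //=.
  apply: uniq_perm; rewrite ?filter_uniq ?undup_uniq // => x.
  by rewrite mem_filter mem_undup mem_cat; case: (x \in s).
- exact: undup_uniq.
- by move=> x; rewrite mem_undup mem_cat mem_filter => /orP[/se|/andP[]].
- by move=> x xe xD; rewrite mem_undup mem_cat mem_filter xe mem_dom xD orbT.
Qed.

Lemma degE D : deg D = \sum_(x <- dom D) coeff x D.
Proof.
by rewrite -{1}(freeg_sumE D) raddf_sum /=; apply: eq_bigr => x _; rewrite degU.
Qed.

Lemma vertex_inj : injective vertex.
Proof. by move=> v w /(congr1 val) [->]. Qed.

Lemma inside_chart e e' t : e \in model Gam -> 0 < t < len e ->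
  inside e' (chart e t) = (e == e').
Proof. by move=> em te; rewrite /inside val_chart. Qed.

Lemma deg_split D :
  deg D = \sum_v coeff (vertex v) D + \sum_(e in model Gam) edge_deg D e.
Proof.
rewrite degE (bigID (fun x => if val x is inl _ then true else false)) /=.
congr (_ + _).
  rewrite (@sum_coeff_dom D _ [seq vertex v | v <- enum 'I_n]).
  - by rewrite big_map big_enum.
  - by rewrite map_inj_uniq ?enum_uniq //; exact: vertex_inj.
  - by move=> x /mapP[v _ ->].
  - move=> x; have [[v ->] _ _|[e [t [em te ->]]]] := point_cases x.
      by rewrite map_f // mem_enum.
    by rewrite [proj1_sig _](val_chart em te).
rewrite /edge_deg (exchange_big_dep predT) //= big_mkcond /=.
apply: eq_bigr => x _; have [[v ->]|[e [t [em te ->]]]] := point_cases x.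
  by rewrite big_pred0 // => e; rewrite andbF.
rewrite [proj1_sig _](val_chart em te) /=.
rewrite (big_pred1 e) // => e'; rewrite inside_chart // eq_sym.
by rewrite /=; case: eqVneq => [->|]; rewrite ?em ?andbF.
Qed.

(** Along an edge the order of f is the jump of its slope, hence is carried by
    the breakpoints. *)
Lemma edge_data f e : rational_function f -> e \in model Gam ->
  exists k (t : nat -> R) (m : nat -> int),
  [/\ [/\ t 0%N = 0, t k.+1 = len e, slope_fwd (f \o chart e) 0 = (m 0%N)%:~R &
     slope_bwd (f \o chart e) (len e) = - (m k)%:~R],
     forall i, (i <= k)%N -> [/\ t i < t i.+1, 0 <= t i &
       f (chart e (t i.+1)) = f (chart e (t i)) + (m i)%:~R * (t i.+1 - t i)],
     forall i, (i < k)%N -> 0 < t i.+1 < len e /\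
       ord_at f (chart e (t i.+1)) = (m i.+1)%:~R - (m i)%:~R &
     forall x : R, 0 < x < len e -> (forall i, (i < k)%N -> x != t i.+1) ->
       ord_at f (chart e x) = 0 ].
Proof.
move=> [_ Hf] em.
have [k [t [m [t0 tl H]]]] := PL_breaks (len_gt0 em) (Hf e em).
have mono i j : (i <= j <= k.+1)%N -> t i <= t j.
  by apply: breaks_nondecreasing => {}i ik; exact: (proj1 (H i ik)).
exists k, t, m; split.
- split => //.
  + apply/rslope_fwd; have [tt' H0] := H 0%N isT.
    by apply: rslope_inside H0 _; rewrite t0 lexx -t0.
  + apply/lslope_bwd; have [tt' Hk] := H k (leqnn k).
    by apply: lslope_inside Hk _; rewrite -tl lexx tt'.
- move=> i ik; have [tt' Hi] := H i ik; split => //.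
    by rewrite -t0; apply: mono; rewrite leq0n ltnW.
  by apply: Hi; rewrite lexx ltW.
- move=> i ik.
  have [tt1 H1] := H i (ltnW ik); have [tt2 H2] := H i.+1 ik.
  have ti : 0 < t i.+1 < len e.
    rewrite (le_lt_trans _ tt1) /=; last first.
      by rewrite -t0; apply: mono; rewrite leq0n ltnW // ltnW.
    by rewrite (lt_le_trans tt2) // -tl; apply: mono; rewrite leqnn andbT.
  split => //; rewrite ord_chart //; congr (_ + _).
  + by apply/rslope_fwd; apply: rslope_inside H2 _; rewrite lexx.
  + by apply/lslope_bwd; apply: lslope_inside H1 _; rewrite lexx tt1.
- move=> x xe Hx; have [|i [ik /andP[ix xi]]] := @breaks_piece _ k.+1 t x.
    by rewrite t0 tl; case/andP: xe => /ltW ->.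
  have ixlt : t i < x.
    rewrite lt_neqAle ix andbT eq_sym; case: i ik {ix xi} => [|i] ik.
      by rewrite t0 gt_eqF //; case/andP: xe.
    exact: Hx.
  have [_ Hi] := H i ik; rewrite ord_chart //.
  rewrite (@rslope_fwd _ _ _ (m i)%:~R); last first.
    by apply: rslope_inside Hi _; rewrite ix xi.
  rewrite (@lslope_bwd _ _ _ (- (m i)%:~R)) ?subrr //.
  by apply: lslope_inside Hi _; rewrite ixlt ltW.
Qed.

Lemma breaks_inj (k : nat) (t : nat -> R) :
  (forall i, (i <= k)%N -> t i < t i.+1) ->
  forall i j, (i <= k)%N -> (j <= k)%N -> t i = t j -> i = j.
Proof.
move=> H.
have lt i j : (i < j <= k)%N -> t i < t j.
  move=> /andP[ij jk]; apply: (lt_le_trans (H i _)); first by lia.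
  by apply: (@breaks_nondecreasing _ k) => [l /ltnW /H//|]; rewrite ij.
move=> i j ik jk tij; case: (ltngtP i j) => // hij.
  by have := lt i j; rewrite hij jk tij ltxx => /(_ isT).
by have := lt j i; rewrite hij ik tij ltxx => /(_ isT).
Qed.

Lemma uniq_breaks (k i0 j0 : nat) (t : nat -> R) e : e \in model Gam ->
  (forall i, (i <= k)%N -> t i < t i.+1) ->
  (forall i, (i < k)%N -> 0 < t i.+1 < len e) ->
  (j0 <= k)%N -> uniq [seq chart e (t i.+1) | i <- index_iota i0 j0].
Proof.
move=> em tt tin jk0; rewrite map_inj_in_uniq ?iota_uniq // => i j.
rewrite !mem_index_iota => /andP[_ ij0] /andP[_ jj0] /(congr1 val).
have ik := leq_trans ij0 jk0; have jk := leq_trans jj0 jk0.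
rewrite !val_chart ?tin // => -[tij].
by apply/eqP; rewrite -eqSS; apply/eqP; apply: (breaks_inj tt).
Qed.

(** The vertices and the breakpoints of f form a finite set outside which f
    has order 0. *)
Lemma rational_has_div f : rational_function f -> exists E, is_div f E.
Proof.
move=> Hf.
have ordZ x : exists z : int, ord_at f x = z%:~R.
  have [[v ->]|[e [t [em te ->]]]] := point_cases x.
    suff : ord_at f (vertex v) \is a Num.int by case/intrP => z ->; exists z.
    rewrite /ord_at /=; apply: rpredD; apply: rpred_sum => e /andP[em _].
      by have [m Hm] := rational_src Hf em; rewrite (rslope_fwd Hm) intr_int.
    by have [m Hm] := rational_tgt Hf em; rewrite (lslope_bwd Hm) intr_int.
  have /rational_functionP/(_ e em)[fr fl] := Hf; have /andP[t0 tl] := te.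
  have [|m Hm] := fr t; first by rewrite ltW.
  have [|m' Hm'] := fl t; first by rewrite t0 ltW.
  exists (m + m').
  by rewrite ord_chart // (rslope_fwd Hm) (lslope_bwd Hm') rmorphD.
have /choice[z Hz] := ordZ.
have /choice[B HB] : forall e, exists s : seq (mpoint Gam), e \in model Gam ->
    forall x : R, 0 < x < len e -> ord_at f (chart e x) != 0 -> chart e x \in s.
  move=> e; have [em|_] := boolP (e \in model Gam); last by exists [::].
  have [k [t [m [_ _ _ H]]]] := edge_data Hf em.
  exists [seq chart e (t i.+1) | i <- iota 0 k] => _ x xe.
  apply: contraR => xs; apply/eqP; apply: H => // i ik.
  by apply: contraNneq xs => ->; apply/mapP; exists i; rewrite ?mem_iota.
pose X := undup ([seq vertex v | v <- enum 'I_n] ++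
                 flatten [seq B e | e <- enum (model Gam)]).
have HX x : ord_at f x != 0 -> x \in X.
  rewrite mem_undup mem_cat; have [[v ->] _|[e [t [em te ->]]] o] := point_cases x.
    by rewrite map_f // mem_enum.
  apply/orP; right; apply/flattenP; exists (B e); last exact: HB.
  by rewrite map_f // mem_enum.
exists (\sum_(x <- X) << z x *g x >>) => x.
rewrite raddf_sum /= Hz; congr (_%:~R).
have [xX|xX] := boolP (x \in X).
  rewrite (bigD1_seq x) ?undup_uniq //= coeffU eqxx mulr1 big1 ?addr0 //.
  by move=> y yx; rewrite coeffU (negbTE yx) mulr0.
rewrite big_seq big1 => [|y yX]; last first.
  by rewrite coeffU (_ : y == x = false) ?mulr0 //; apply: contraNF xX => /eqP <-.
have : ord_at f x = 0 by apply/eqP; apply: contraNT xX; exact: HX.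
by rewrite Hz => /eqP; rewrite intr_eq0 => /eqP.
Qed.

Definition src_slope f e : R := slope_fwd (f \o chart e) 0.
Definition tgt_slope f e : R := slope_bwd (f \o chart e) (len e).

Lemma ord_vertex f v : ord_at f (vertex v) =
  \sum_(e in model Gam | src e == v) src_slope f e
  + \sum_(e in model Gam | tgt e == v) tgt_slope f e.
Proof. by []. Qed.

Lemma sum_ord_vertices f (A : pred 'I_n) :
  \sum_(v | A v) ord_at f (vertex v) =
  \sum_(e in model Gam) ((if A (src e) then src_slope f e else 0)
                         + (if A (tgt e) then tgt_slope f e else 0)).
Proof.
under eq_bigr do rewrite ord_vertex.
rewrite big_split [RHS]big_split /=; congr (_ + _).
- rewrite (exchange_big_dep (mem (model Gam))) /=; last by move=> v e _ /andP[].
  apply: eq_bigr => e em; case: ifP => [Av|Av].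
    by rewrite (big_pred1 (src e)) // => v; rewrite /= [src e == v]eq_sym; case: eqP => [->|]; rewrite ?andbF // Av em.
  by rewrite big_pred0 // => v; case: eqP => [<-|]; rewrite ?andbF // Av.
- rewrite (exchange_big_dep (mem (model Gam))) /=; last by move=> v e _ /andP[].
  apply: eq_bigr => e em; case: ifP => [Av|Av].
    by rewrite (big_pred1 (tgt e)) // => v; rewrite /= [tgt e == v]eq_sym; case: eqP => [->|]; rewrite ?andbF // Av em.
  by rewrite big_pred0 // => v; case: eqP => [<-|]; rewrite ?andbF // Av.
Qed.

Lemma is_div_edge_deg f E e : rational_function f -> is_div f E ->
  e \in model Gam -> (edge_deg E e)%:~R = - (src_slope f e + tgt_slope f e).
Proof.
move=> Hf fE em.
have [k [t [m [[t0 tl s0 s1] tt tin out]]]] := edge_data Hf em.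
have tinc i : (i <= k)%N -> t i < t i.+1 by move=> /tt[].
rewrite /edge_deg (@sum_coeff_dom E _ [seq chart e (t i.+1) | i <- index_iota 0 k]).
- rewrite big_map rmorph_sum /= /src_slope /tgt_slope s0 s1.
  transitivity (\sum_(0 <= i < k) ((m i.+1)%:~R - (m i)%:~R : R)).
    rewrite big_seq [RHS]big_seq; apply: eq_bigr => i.
    by rewrite mem_index_iota => /= ik; rewrite fE; case: (tin i ik).
  rewrite telescope_sumr // opprD opprK addrC //.
- by apply: uniq_breaks (leqnn k) => // i /tin[].
- move=> x /mapP[i]; rewrite mem_index_iota => /= ik ->.
  by rewrite inside_chart ?eqxx //; case: (tin i ik).
- move=> x; have [[v ->] //|[e' [x' [e'm xe ->]]]] := point_cases x.
  rewrite inside_chart // => /eqP ee; subst e' => c.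
  apply: contraR c => xs; rewrite -(@intr_eq0 R) fE; apply/eqP/out => // i ik.
  by apply: contraNneq xs => ->; apply/mapP; exists i; rewrite ?mem_index_iota.
Qed.

(** The jumps of slope along an edge telescope to the two outgoing slopes at
    its ends, which the orders at the vertices count with the opposite sign. *)
Lemma deg_is_div f E : rational_function f -> is_div f E -> deg E = 0.
Proof.
move=> Hf fE; apply/eqP; rewrite -(@intr_eq0 R) deg_split rmorphD !rmorph_sum /=.
under eq_bigr do rewrite fE.
rewrite (sum_ord_vertices f predT) /=.
under [X in _ + X]eq_bigr => e em do rewrite (is_div_edge_deg Hf fE em).
by rewrite -big_split /= big1 // => e _; rewrite subrr.
Qed.

Lemma effectiveP D : reflect (forall x, 0 <= coeff x D) (effective D).
Proof. exact: fgposP. Qed.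

Lemma edge_deg_ge0 D e : effective D -> 0 <= edge_deg D e.
Proof. by move=> /effectiveP H; apply: sumr_ge0. Qed.

(** D + div f is effective; stated on orders, so that no divisor of f has to be
    chosen. *)
Definition dominates D f := forall x, - (coeff x D)%:~R <= ord_at f x.

(** Travelling along e, the slope of f can drop only where D has chips, and by
    at most their number. If f falls by more than N times the length of e then
    some slope is at most - N - 1, and the initial slope exceeds it by at most
    the number of chips of D inside e. *)
Lemma edge_slopes D f e : effective D -> rational_function f -> dominates D f ->
  e \in model Gam -> exists s0 s1 : int,
  [/\ src_slope f e = s0%:~R, tgt_slope f e = s1%:~R, s0 + s1 <= edge_deg D e,
   (forall N : int, N%:~R * len e < f (vertex (src e)) - f (vertex (tgt e)) ->
      s0 + N + 1 <= edge_deg D e) &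
   (forall N : int, N%:~R * len e < f (vertex (tgt e)) - f (vertex (src e)) ->
      s1 + N + 1 <= edge_deg D e)].
Proof.
move=> De Hf Df em.
have [k [t [m [[t0 tl s0 s1] tt tin out]]]] := edge_data Hf em.
have tinc i : (i <= k)%N -> t i < t i.+1 by move=> /tt[].
have drop i j : (i <= j <= k)%N -> m i - m j <= edge_deg D e.
  move=> /andP[ij jk].
  have -> : m i - m j = \sum_(i <= s < j) (m s - m s.+1).
    rewrite -(opprB (m j)) -telescope_sumr // -sumrN.
    by apply: eq_bigr => s _; rewrite opprB.
  apply: (@le_trans _ _ (\sum_(i <= s < j) coeff (chart e (t s.+1)) D)).
    rewrite big_seq [leRHS]big_seq; apply: ler_sum => s.
    rewrite mem_index_iota => /andP[_ sj].
    have [_ o] := tin s (leq_trans sj jk).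
    have := Df (chart e (t s.+1)); rewrite o -!rmorphB -rmorphN ler_int; lia.
  rewrite -(big_map (fun s => chart e (t s.+1)) predT (fun x => coeff x D)).
  apply: sum_coeff_le_edge_deg => //.
    by apply: (@uniq_breaks k) => // s /tin[].
  move=> x /mapP[s]; rewrite mem_index_iota => /andP[_ sj] ->.
  by have [xs _] := tin s (leq_trans sj jk); rewrite inside_chart ?eqxx.
have some (N : int) : N%:~R * len e < f (vertex (src e)) - f (vertex (tgt e)) ->
    exists2 i, (i <= k)%N & m i <= - N - 1.
  move=> big; apply: contrapT => no.
  have H i : (i <= k)%N -> - N <= m i.
    by move=> ik; rewrite leNgt; apply/negP => mi; apply: no; exists i => //; lia.
  suff : forall i, (i <= k.+1)%N ->
      f (chart e (t 0%N)) - N%:~R * (t i - t 0%N) <= f (chart e (t i)).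
    move/(_ _ (leqnn _)); rewrite t0 tl chart0 // chart_len subr0; lra.
  elim=> [|i IH] ik; first by rewrite subrr mulr0 subr0.
  have [tti _ ->] := tt i ik; have := IH (ltnW ik).
  have : (- N)%:~R * (t i.+1 - t i) <= (m i)%:~R * (t i.+1 - t i).
    by rewrite ler_pM2r ?subr_gt0 // ler_int H.
  rewrite rmorphN /=; lra.
have some' (N : int) : N%:~R * len e < f (vertex (tgt e)) - f (vertex (src e)) ->
    exists2 i, (i <= k)%N & N + 1 <= m i.
  move=> big; apply: contrapT => no.
  have H i : (i <= k)%N -> m i <= N.
    by move=> ik; rewrite leNgt; apply/negP => mi; apply: no; exists i => //; lia.
  suff : forall i, (i <= k.+1)%N ->
      f (chart e (t i)) <= f (chart e (t 0%N)) + N%:~R * (t i - t 0%N).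
    move/(_ _ (leqnn _)); rewrite t0 tl chart0 // chart_len subr0; lra.
  elim=> [|i IH] ik; first by rewrite subrr mulr0 addr0.
  have [tti _ ->] := tt i ik; have := IH (ltnW ik).
  have : (m i)%:~R * (t i.+1 - t i) <= N%:~R * (t i.+1 - t i).
    by rewrite ler_pM2r ?subr_gt0 // ler_int H.
  lra.
exists (m 0%N), (- m k); split.
- exact: s0.
- by rewrite /tgt_slope s1 rmorphN.
- by apply: drop; rewrite leq0n leqnn.
- move=> N /some[i ik mi]; have := drop 0%N i; rewrite leq0n ik => /(_ isT); lia.
- move=> N /some'[i ik mi]; have := drop i k; rewrite leqnn ik => /(_ isT); lia.
Qed.

(** Moving from D to D + div f sends chips from the superlevel set A of f to its
    complement: at least q + 1 of them leave along an edge of the cut on which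
    f is steeper than q, and all of them are chips of D. *)
Lemma cut_bound D f (A : pred 'I_n) (q : vpair n -> nat) :
  effective D -> rational_function f -> dominates D f ->
  (forall v w, A v -> ~~ A w -> f (vertex w) < f (vertex v)) ->
  (forall e, e \in model Gam -> A (src e) != A (tgt e) ->
     (q e)%:R * len e < `|f (vertex (src e)) - f (vertex (tgt e))|) ->
  \sum_(e in model Gam | A (src e) != A (tgt e)) (q e).+1%:Z <= deg D.
Proof.
move=> De Hf Df HA Hq.
have D0 := effectiveP _ De.
rewrite -(@ler_int R) deg_split rmorphD !rmorph_sum /=.
have : \sum_(v | A v) - (coeff (vertex v) D)%:~R <= \sum_(v | A v) ord_at f (vertex v).
  by apply: ler_sum => v _; exact: Df.
rewrite sum_ord_vertices sumrN.
have : \sum_(v | A v) (coeff (vertex v) D)%:~R <= \sum_v (coeff (vertex v) D)%:~R :> R.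
  rewrite [leRHS](bigID A) /= lerDl; apply: sumr_ge0 => v _.
  by rewrite ler0z.
suff : \sum_(e in model Gam)
    ((if A (src e) then src_slope f e else 0) +
     (if A (tgt e) then tgt_slope f e else 0)) <=
    \sum_(e in model Gam) (edge_deg D e)%:~R -
    \sum_(e in model Gam | A (src e) != A (tgt e)) (q e).+1%:~R by lra.
rewrite [X in _ - X]big_mkcondr /= -sumrB; apply: ler_sum => e em.
have [s0 [s1 [-> -> h1 h2 h3]]] := edge_slopes De Hf Df em.
have := Hq e em.
case As: (A (src e)); case At: (A (tgt e)) => /= Hqe.
- by rewrite subr0 -rmorphD ler_int.
- have := HA (src e) (tgt e); rewrite As At => /(_ isT isT) lt.
  have := Hqe isT; rewrite gtr0_norm ?subr_gt0 // => /(h2 (q e)%:Z).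
  by rewrite addr0 -rmorphB ler_int; lia.
- have := HA (tgt e) (src e); rewrite As At => /(_ isT isT) lt.
  have := Hqe isT; rewrite distrC gtr0_norm ?subr_gt0 // => /(h3 (q e)%:Z).
  by rewrite add0r -rmorphB ler_int; lia.
- by rewrite addr0 subr0 ler0z edge_deg_ge0.
Qed.

End Divisors.

(** * Rank, gonality and the upper bound *)

Section Rank.
Context (R : realType) (n : nat) (Gam : metric_graph R n).
Implicit Types (e : vpair n) (x y : mpoint Gam) (f g : mpoint Gam -> R).
Implicit Types (D E : mdivisor Gam) (v w : 'I_n).
Local Notation len := (len Gam).
Local Notation chart := (@chart R n Gam).
Local Notation vertex := (@vertex R n Gam).

Lemma lin_equiv_deg D E : lin_equiv D E -> deg D = deg E.
Proof.
by move=> [f Hf fD]; apply/eqP; rewrite -subr_eq0 -degB (deg_is_div Hf fD).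
Qed.

Lemma is_div_add f g D E : rational_function f -> rational_function g ->
  is_div f D -> is_div g E -> is_div (fun x => f x + g x) (D + E).
Proof. by move=> Hf Hg fD gE x; rewrite coeffD intrD fD gE ord_at_add. Qed.

Lemma is_div_opp f D : rational_function f ->
  is_div f D -> is_div (fun x => - f x) (- D).
Proof. by move=> Hf fD x; rewrite coeffN rmorphN /= fD ord_at_opp. Qed.

Lemma lin_equiv_sym D E : lin_equiv D E -> lin_equiv E D.
Proof.
move=> [f Hf fD]; exists (fun x => - f x); first exact: rational_opp.
by rewrite -opprB; exact: is_div_opp.
Qed.

Lemma lin_equiv_trans D E F : lin_equiv D E -> lin_equiv E F -> lin_equiv D F.
Proof.
move=> [f Hf fD] [g Hg gD]; exists (fun x => f x + g x); first exact: rational_add.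
by rewrite -(subrKA E); exact: is_div_add.
Qed.

Lemma effective0 : effective (0 : mdivisor Gam).
Proof. by apply/effectiveP => x; rewrite coeff0. Qed.

Lemma effectiveD D E : effective D -> effective E -> effective (D + E).
Proof.
move=> /effectiveP HD /effectiveP HE; apply/effectiveP => x.
by rewrite coeffD addr_ge0.
Qed.

Lemma effectiveU x : effective (<< x >> : mdivisor Gam).
Proof. by apply/effectiveP => y; rewrite coeffU mul1r ler0n. Qed.

Lemma deg_effective D : effective D -> 0 <= deg D.
Proof. by move=> /effectiveP H; rewrite degE; apply: sumr_ge0. Qed.

Definition positive_rank D :=
  forall E, effective E -> deg E <= 1 -> linear_system (D - E) !=set0.

Lemma positive_rank_deg_ge0 D : positive_rank D -> 0 <= deg D.
Proof.
move=> /(_ 0 effective0); rewrite deg0 => /(_ isT)[E [E0 /lin_equiv_deg EE]].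
by rewrite -[D]subr0 -EE deg_effective.
Qed.

Lemma has_rank1_positive D : has_rank D 1 -> positive_rank D.
Proof.
move=> [_ lb] E E0 E1; apply/set0P/eqP => H.
suff : (1 + 1 <= deg E)%R by lia.
by apply: lb; exists E.
Qed.

Lemma positive_rank_move D v : positive_rank D ->
  exists E, [/\ effective E, 1 <= coeff (vertex v) E & lin_equiv E D].
Proof.
move=> /(_ _ (effectiveU (vertex v))); rewrite degU => /(_ isT)[E [E0 EE]].
exists (E + << vertex v >>); split.
- exact: effectiveD (effectiveU _).
- by rewrite coeffD coeffU eqxx mulr1 lerDr; apply/effectiveP.
- by case: EE => f Hf; rewrite opprB addrA => fE; exists f.
Qed.

(** The gonality asks for rank exactly 1. Removing a chip lowers the rank by at
    most 1, so a divisor of least degree among those of positive rank has rank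
    1. *)
Lemma gonality_betweenP (a b : R) : (0 < n)%N ->
  (forall D, positive_rank D -> a <= (deg D)%:~R) ->
  (exists2 D, positive_rank D & (deg D)%:~R <= b) ->
  div_gonality_between a b Gam.
Proof.
move=> n0 lo [D1 rD1 D1b].
pose P (k : nat) := `[< exists2 D, positive_rank D & deg D = k%:Z >].
have exP : exists k, P k.
  exists `|deg D1|%N; apply/asboolP; exists D1 => //.
  by rewrite gez0_abs // positive_rank_deg_ge0.
case: (ex_minnP exP) => d /asboolP[D rD Dd] dmin.
have minD E : positive_rank E -> d%:Z <= deg E.
  move=> rE; have E0 := positive_rank_deg_ge0 rE.
  rewrite -(gez0_abs E0) lez_nat; apply: dmin; apply/asboolP.
  by exists E; rewrite // gez0_abs.
exists d%:Z; last first.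
  apply/andP; split; first by rewrite -Dd; exact: lo.
  by apply: le_trans D1b; rewrite ler_int; exact: minD.
split; last by move=> _ [E /has_rank1_positive rE <-]; exact: minD.
exists D => //; split; last first.
  move=> _ [E [E0 H] <-]; rewrite leNgt; apply/negP => E1.
  have E1' : deg E <= 1 by lia.
  by have /set0P := rD E E0 E1'; rewrite H eqxx.
apply: contrapT => no.
have two E : effective E -> deg E = 2 -> linear_system (D - E) !=set0.
  by move=> E0 E2; apply/set0P/eqP => H; apply: no; exists E.
pose x := vertex (Ordinal n0).
suff /minD : positive_rank (D - << x >>) by rewrite degB degU Dd; lia.
move=> E E0 E1; rewrite -addrA -opprD.
have xE := effectiveD (effectiveU x) E0.
have [d1|d2] := leP (deg (<< x >> + E)) 1; first exact: rD.
by apply: two => //; move: d2; rewrite degD degU; lia.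
Qed.

Definition all_vertices : mdivisor Gam := \sum_v << vertex v >>.

Lemma deg_all_vertices : deg all_vertices = n.
Proof.
rewrite /all_vertices raddf_sum /=.
by under eq_bigr do rewrite degU; rewrite sumr_const card_ord natz.
Qed.

Lemma coeff_all_vertices v : coeff (vertex v) all_vertices = 1.
Proof.
rewrite raddf_sum /= (bigD1 v) //= coeffU eqxx mulr1 big1 ?addr0 // => w wv.
by rewrite coeffU (inj_eq (@vertex_inj _ _ Gam)) (negbTE wv) mulr0.
Qed.

Lemma effective_all_vertices : effective all_vertices.
Proof.
apply/effectiveP => x; rewrite raddf_sum /= sumr_ge0 // => v _.
by rewrite coeffU mul1r ler0n.
Qed.

(** Adding the divisor of pinch e s moves the chips at the two ends of e
    inwards by s. As a maximum of affine functions, the valley has slopes that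
    are bounded below by those of any of them that it touches. *)
Definition valley (l s t : R) : R := Num.max (Num.max (- t) (t - l)) (- s).

Definition pinch e (s : R) x : R :=
  if val x is inr (e', t) then
    if e' == e then valley (len e) s t else 0
  else 0.

Lemma pinch_chart e s t : e \in model Gam -> 0 <= s -> 0 <= t <= len e ->
  valley (len e) s t = pinch e s (chart e t).
Proof.
move=> em s0 /andP[t0 tl]; rewrite /pinch /valley; apply/esym.
have [t00|tn0] := eqVneq t 0.
  rewrite t00 chart0 //= oppr0 sub0r.
  have l0 := ltW (len_gt0 em).
  by rewrite (max_idPl _) // ?oppr_le0 // (max_idPl _) // oppr_le0.
have [tll|tnl] := eqVneq t (len e).
  rewrite tll chart_len /= subrr.
  have l0 := ltW (len_gt0 em).
  by rewrite [Num.max (- _) 0](max_idPr _) ?oppr_le0 // (max_idPl _) // oppr_le0.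
by rewrite val_chart ?eqxx // !lt_neqAle t0 tl eq_sym tn0 tnl.
Qed.

Lemma pinch_other e e' s t : e' \in model Gam -> e' != e -> pinch e s (chart e' t) = 0.
Proof.
move=> em ee; rewrite /pinch /Defs.chart; case: ifP => // _.
by rewrite val_insubd; case: ifP => //= _; rewrite (negbTE ee).
Qed.

Lemma rslope_eq (l t m : R) (u g : R -> R) :
  (forall t, 0 <= t <= l -> u t = g t) -> 0 <= t < l ->
  rslope u t m -> rslope g t m.
Proof.
move=> ug /andP[t0 tl]; rewrite /rslope ug ?t0 ?ltW // => H; rewrite /germ; near=> h.
rewrite -ug; first by near: h; exact: H.
have h0 : 0 < h by near: h; exact: nbhs_right_gt.
have : h < l - t by near: h; apply: nbhs_right_lt; rewrite subr_gt0.
by move=> ?; apply/andP; split; lra.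
Unshelve. all: by end_near. Qed.

Lemma lslope_eq (l t m : R) (u g : R -> R) :
  (forall t, 0 <= t <= l -> u t = g t) -> 0 < t <= l ->
  lslope u t m -> lslope g t m.
Proof.
move=> ug /andP[t0 tl]; rewrite /lslope ug ?tl ?ltW // => H; rewrite /germ; near=> h.
rewrite -ug; first by near: h; exact: H.
have h0 : 0 < h by near: h; exact: nbhs_right_gt.
have : h < t by near: h; apply: nbhs_right_lt.
by move=> ?; apply/andP; split; lra.
Unshelve. all: by end_near. Qed.

Lemma locally_PL_eq (l : R) (u g : R -> R) :
  (forall t, 0 <= t <= l -> u t = g t) -> locally_PL l u -> locally_PL l g.
Proof.
move=> ug [ur ul]; split=> t tl.
  by have [m Hm] := ur t tl; exists m; exact: rslope_eq ug tl Hm.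
by have [m Hm] := ul t tl; exists m; exact: lslope_eq ug tl Hm.
Qed.

Lemma touch_slopes (g : R -> R) (c k t m m' : R) :
  (forall x : R, c + k * x <= g x) -> c + k * t = g t ->
  (rslope g t m -> k <= m) /\ (lslope g t m' -> - k <= m').
Proof.
move=> ug ugt; split.
- apply: (@germ_le _ (fun h => c + k * (t + h))); first exact: nearW.
  by apply: germ_affine => h; rewrite -ugt; ring.
- apply: (@germ_le _ (fun h => c + k * (t - h))); first exact: nearW.
  by apply: germ_affine => h; rewrite -ugt; ring.
Qed.

Lemma valley_PL l s (l0 : R) : locally_PL l0 (valley l s).
Proof.
apply: locally_PL_max; last first.
  by apply: (@locally_PL_affine _ _ _ (- s) 0) => x; rewrite mul0r addr0.
apply: locally_PL_max.
  by apply: (@locally_PL_affine _ _ _ 0 (- 1)) => x; rewrite add0r rmorphN1 mulN1r.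
by apply: (@locally_PL_affine _ _ _ (- l) 1) => x; rewrite mul1r addrC.
Qed.

Lemma valley_slopes l s t m m' :
  rslope (valley l s) t m -> lslope (valley l s) t m' ->
  [/\ valley l s t = - t -> -1 <= m /\ 1 <= m',
      valley l s t = t - l -> 1 <= m /\ -1 <= m' &
      valley l s t = - s -> 0 <= m /\ 0 <= m'].
Proof.
move=> Hm Hm'; split => E.
- have [h1 h2] := @touch_slopes (valley l s) 0 (-1) t m m'
    (fun x : R => ltac:(by rewrite /valley !le_max add0r mulN1r lexx))
    (ltac:(by rewrite E add0r mulN1r)).
  by have := h1 Hm; have := h2 Hm'; rewrite opprK.
- have [h1 h2] := @touch_slopes (valley l s) (- l) 1 t m m'
    (fun x : R => ltac:(by rewrite /valley !le_max mul1r [- l + x]addrC lexx orbT))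
    (ltac:(by rewrite E mul1r addrC)).
  by have := h1 Hm; have := h2 Hm'.
- have [h1 h2] := @touch_slopes (valley l s) (- s) 0 t m m'
    (fun x : R => ltac:(by rewrite /valley !le_max mul0r addr0 lexx orbT))
    (ltac:(by rewrite E mul0r addr0)).
  by have := h1 Hm; have := h2 Hm'; rewrite oppr0.
Qed.

Lemma valley_cases l s t :
  [\/ valley l s t = - t, valley l s t = t - l | valley l s t = - s].
Proof.
rewrite /valley; case: (leP (Num.max (- t) (t - l)) (- s)) => _; first exact: Or33.
by case: leP => _; [exact: Or32|exact: Or31].
Qed.

Lemma pinch_rational e s : e \in model Gam -> 0 <= s -> rational_function (pinch e s).
Proof.
move=> em s0; apply/rational_functionP => e' em'.
have [->|ee] := eqVneq e' e.
  by apply: locally_PL_eq (valley_PL (len e) s (len e)) => t te; exact: pinch_chart.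
apply: (@locally_PL_affine _ _ _ 0 0) => t.
by rewrite /= pinch_other // mul0r addr0.
Qed.

Lemma pinch_slopes e s : e \in model Gam -> 0 <= s ->
  (forall e', e' \in model Gam -> e' != e ->
     forall t, slope_fwd (pinch e s \o chart e') t = 0 /\
               slope_bwd (pinch e s \o chart e') t = 0) /\
  [/\ -1 <= src_slope (pinch e s) e, -1 <= tgt_slope (pinch e s) e &
   forall t, 0 < t < len e -> exists m m',
     [/\ rslope (valley (len e) s) t m, lslope (valley (len e) s) t m' &
      ord_at (pinch e s) (chart e t) = m + m']].
Proof.
move=> em s0; split.
  move=> e' em' ee t; split; [apply: rslope_fwd|apply: lslope_bwd];
    by apply: germ_affine => h; rewrite /= !pinch_other // mul0r addr0.
have l0 := len_gt0 em.
have pc t : 0 <= t <= len e -> valley (len e) s t = (pinch e s \o chart e) t.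
  by move=> te; exact: pinch_chart.
have [vr vl] := valley_PL (len e) s (len e).
split.
- have t0 : (0 : R) <= 0 < len e by rewrite lexx l0.
  have [m Hm] := vr 0 t0.
  rewrite /src_slope (rslope_fwd (rslope_eq pc t0 Hm)).
  have [h1 _] := @touch_slopes (valley (len e) s) 0 (-1) 0 m%:~R 0
    (fun x : R => ltac:(by rewrite /valley !le_max add0r mulN1r lexx))
    (ltac:(by rewrite /valley oppr0 sub0r (max_idPl _) ?mulr0 ?addr0 (max_idPl _) ?oppr_le0 // ltW)).
  exact: h1.
- have t0 : 0 < len e <= len e by rewrite l0 lexx.
  have [m Hm] := vl (len e) t0.
  rewrite /tgt_slope (lslope_bwd (lslope_eq pc t0 Hm)).
  have [_ h1] := @touch_slopes (valley (len e) s) (- len e) 1 (len e) 0 m%:~R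
    (fun x : R => ltac:(by rewrite /valley !le_max mul1r [- len e + x]addrC lexx orbT))
    (ltac:(by rewrite /valley mul1r addNr subrr [Num.max (- _) 0](max_idPr _) ?oppr_le0 ?(ltW l0) // (max_idPl _) // oppr_le0)).
  exact: h1.
- move=> t /andP[t0 tl].
  have ta : 0 <= t < len e by rewrite ltW.
  have tb : 0 < t <= len e by rewrite t0 ltW.
  have [m Hm] := vr t ta; have [m' Hm'] := vl t tb.
  exists m%:~R, m'%:~R; split => //; rewrite ord_chart ?t0 //.
  by rewrite (rslope_fwd (rslope_eq pc ta Hm)) (lslope_bwd (lslope_eq pc tb Hm')).
Qed.

Lemma src_neq_tgt e : src e != tgt e.
Proof. by apply: contraTneq (valP e); rewrite /src /tgt => ->; rewrite ltnn. Qed.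

Lemma pinch_ord_vertex e s v : e \in model Gam -> 0 <= s ->
  -1 <= ord_at (pinch e s) (vertex v).
Proof.
move=> em s0; have [other [h1 h2 _]] := pinch_slopes em s0.
have bs : \sum_(e' in model Gam | src e' == v) src_slope (pinch e s) e' =
    if src e == v then src_slope (pinch e s) e else 0.
  case: ifP => sv.
    rewrite (bigD1 e) /= ?em ?sv // big1 ?addr0 // => e' /andP[/andP[em' _] ee].
    by have [] := other e' em' ee 0.
  rewrite big1 // => e' /andP[em' sv']; have ee : e' != e.
    by apply: contraTneq sv' => ->; rewrite sv.
  by have [] := other e' em' ee 0.
have bt : \sum_(e' in model Gam | tgt e' == v) tgt_slope (pinch e s) e' =
    if tgt e == v then tgt_slope (pinch e s) e else 0.
  case: ifP => sv.
    rewrite (bigD1 e) /= ?em ?sv // big1 ?addr0 // => e' /andP[/andP[em' _] ee].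
    by have [] := other e' em' ee (len e').
  rewrite big1 // => e' /andP[em' sv']; have ee : e' != e.
    by apply: contraTneq sv' => ->; rewrite sv.
  by have [] := other e' em' ee (len e').
rewrite ord_vertex bs bt; case: eqP => [sv|_]; case: eqP => [tv|_].
- by have := src_neq_tgt e; rewrite sv tv eqxx.
- by rewrite addr0.
- by rewrite add0r.
- by rewrite addr0 lerN10.
Qed.

Lemma pinch_ord_edge e s e' t : e \in model Gam -> 0 <= s ->
  e' \in model Gam -> 0 < t < len e' ->
  0 <= ord_at (pinch e s) (chart e' t).
Proof.
move=> em s0 em' te; have [other [_ _ h]] := pinch_slopes em s0.
have [ee|ee] := eqVneq e' e; last first.
  by rewrite ord_chart //; have [-> ->] := other e' em' ee t; rewrite addr0.
subst e'; have [m [m' [Hm Hm' ->]]] := h t te.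
have [h1 h2 h3] := valley_slopes Hm Hm'.
by case: (valley_cases (len e) s t) => [/h1|/h2|/h3] []; lra.
Qed.

Lemma pinch_ord_point e t : e \in model Gam -> 0 < t < len e ->
  1 <= ord_at (pinch e (Num.min t (len e - t))) (chart e t).
Proof.
move=> em te; have /andP[t0 tl] := te; set s := Num.min _ _.
have s0 : 0 <= s by rewrite le_min (ltW t0) subr_ge0 ltW.
have [_ [_ _ h]] := pinch_slopes em s0.
have [m [m' [Hm Hm' ->]]] := h t te.
have [h1 h2 h3] := valley_slopes Hm Hm'.
have E3 : valley (len e) s t = - s.
  rewrite /valley (max_idPr _) // ge_max lerNl opprK /s ge_min lexx /=.
  by rewrite lerNr opprB ge_min lexx orbT.
have [h3m h3m'] := h3 E3.
have : s = t \/ s = len e - t by rewrite /s; case: leP; [left|right].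
move=> [E|E].
  by have [] := h1 _; [rewrite E3 E|lra].
by have [] := h2 _; [rewrite E3 E opprB|lra].
Qed.

(** A point inside an edge is reached by moving the chips at the two ends of
    that edge towards each other. *)
Lemma all_vertices_positive_rank : positive_rank all_vertices.
Proof.
move=> E E0 E1.
have [-> |Enz] := eqVneq E 0.
  rewrite subr0; exists all_vertices; split; first exact: effective_all_vertices.
  by exists (fun=> 0); [exact: rational_cst|move=> x; rewrite subrr coeff0 ord_at_cst].
have [x xE] : exists x, x \in dom E.
  move: Enz; rewrite -dom_eq0; case: (dom E) => // x s _.
  by exists x; rewrite mem_head.
have Ex : effective (E - << x >>).
  apply/effectiveP => y; rewrite coeffB coeffU mul1r.
  have := effectiveP _ E0 y; case: eqVneq => [<-|_]; last by rewrite subr0.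
  by move: xE; rewrite mem_dom; lia.
have EE : E = << x >>.
  apply/eqP; rewrite -subr_eq0 -dom_eq0; apply/negPn/negP => nd.
  have [y yE] : exists y, y \in dom (E - << x >>).
    by move: nd; case: (dom _) => // y s _; exists y; rewrite mem_head.
  have : deg (E - << x >>) <= 0 by rewrite degB degU; lia.
  rewrite degE (bigD1_seq y) ?uniq_dom //=; apply/negP; rewrite -ltNge.
  apply: ltr_pwDl; last by apply: sumr_ge0 => z _; exact/effectiveP.
  by rewrite lt_neqAle eq_sym -mem_dom yE; exact/effectiveP.
rewrite EE {E E0 E1 Enz xE Ex EE}.
have [[v ->]|[e [t [em te ->]]]] := point_cases x.
  exists (all_vertices - << vertex v >>); split; last first.
    by exists (fun=> 0); [exact: rational_cst|move=> y; rewrite subrr coeff0 ord_at_cst].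
  apply/effectiveP => y; rewrite coeffB coeffU mul1r.
  case: eqVneq => [<-|_]; first by rewrite coeff_all_vertices.
  by rewrite subr0; exact/effectiveP/effective_all_vertices.
set s := Num.min t (len e - t).
have /andP[t0 tl] := te.
have s0 : 0 <= s by rewrite le_min (ltW t0) subr_ge0 ltW.
have Hf := pinch_rational em s0.
have [F fF] := rational_has_div Hf.
exists (all_vertices - << chart e t >> + F); split; last first.
  by exists (pinch e s) => //; rewrite [_ + F]addrC addrK.
apply/effectiveP => y; rewrite coeffD coeffB coeffU mul1r -(@ler_int R) intrD fF.
have av0 := effectiveP _ effective_all_vertices y.
have vi v : (chart e t == vertex v) = false.
  by apply/negP => /eqP /(congr1 val); rewrite val_chart.
have [[v E]|[e' [t' [em' te' E]]]] := point_cases y; subst y.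
  rewrite coeff_all_vertices vi subr0.
  by have := pinch_ord_vertex v em s0; lra.
case: eqVneq => [<-|_] /=.
  have := pinch_ord_point em te; rewrite -/s => o1.
  have : 0 <= (coeff (chart e t) all_vertices)%:~R :> R.
    by rewrite ler0z; exact/effectiveP/effective_all_vertices.
  by rewrite intrD rmorphN1; lra.
rewrite subr0; apply: addr_ge0; first by rewrite ler0z.
exact: pinch_ord_edge.
Qed.

End Rank.

Close Scope classical_set_scope.

(* Cardinals of equal sets may differ by a coercion that hides from lia that
   they are the same number. *)
Ltac card_lia := unfold reverse_coercion in *; lia.

(** * Well-linked graphs *)

Section Graphs.
Context (n : nat).
Implicit Types (G : graph n) (e : vpair n) (u v w : 'I_n) (A B S : {set 'I_n}).

Lemma card_setC_ord S : (#|S| + #|~: S| = n)%N.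
Proof. by rewrite cardsC card_ord. Qed.

Definition joins e u v := (src e == u) && (tgt e == v) || (src e == v) && (tgt e == u).

Definition adj G u v := [exists e in G, joins e u v].

Lemma joins_sym e u v : joins e u v = joins e v u.
Proof. by rewrite /joins orbC. Qed.

Lemma adj_sym G : symmetric (adj G).
Proof. by move=> u v; apply: eq_existsb => e; rewrite joins_sym. Qed.

Definition crossing A B e :=
  (src e \in A) && (tgt e \in B) || (src e \in B) && (tgt e \in A).

Definition cut_size G A B := #|[set e in G | crossing A B e]|.

(** The property of the random graphs that bounds the gonality from below. The
    last hypothesis lets only 2 k vertices be outside A and B: a sparse graph can
    have two linear sets of vertices with no edge between them. *)
Definition well_linked G (k : nat) := forall A B, A \subset ~: B ->
  (n <= 8 * #|A|)%N -> (n <= 8 * #|B|)%N -> (n <= #|A| + #|B| + 2 * k)%N ->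
  (k < cut_size G A B)%N.

Definition avoiding G S : rel 'I_n :=
  fun u v => [&& adj G u v, u \notin S & v \notin S].

Lemma avoiding_sym G S : connect_sym (avoiding G S).
Proof.
apply: sym_connect_sym => u v.
by rewrite /avoiding adj_sym; congr (_ && _); rewrite andbC.
Qed.

(** Otherwise the components left after deleting S could be grouped into two
    large parts with no edge between them. *)
Lemma well_linked_component G k S : well_linked G k -> (0 < n)%N ->
  (4 * k <= n)%N -> (#|S| <= 2 * k)%N ->
  exists2 v, v \notin S & (n < 4 * #|connect (avoiding G S) v|)%N.
Proof.
move=> wl n0 kn Sk; apply: contrapT => no.
have small v : v \notin S -> (4 * #|connect (avoiding G S) v| <= n)%N.
  by move=> vS; rewrite leqNgt; apply/negP => H; apply: no; exists v.
pose P A := [&& A \subset ~: S, [forall u, forall v, (u \in A) && avoiding G S u v ==> (v \in A)] & (n <= 8 * #|A|)%N].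
have PS : P (~: S).
  apply/and3P; split; first exact: subxx.
    apply/forallP => u; apply/forallP => v; apply/implyP => /andP[_ /and3P[_ _]].
    by rewrite inE.
  by have := card_setC_ord S; card_lia.
have [A [/and3P[AS /forallP clA nA] Amin]] : exists A : {set 'I_n},
    P A /\ forall B : {set 'I_n}, P B -> (#|A| <= #|B|)%N.
  by case: (arg_minnP (fun A => #|A|) PS) => A PA Amin; exists A.
have [v vA] : exists v, v \in A.
  by apply/set0Pn; rewrite -cards_eq0; card_lia.
have vS : v \notin S by have := fintype.subsetP AS v vA; rewrite inE.
pose K := [set u | connect (avoiding G S) v u].
have clA' u w : u \in A -> avoiding G S u w -> w \in A.
  by move=> uA uw; have /forallP/(_ w)/implyP := clA u; apply; rewrite uA.
have KA : K \subset A.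
  apply/fintype.subsetP => u; rewrite inE => /connectP[p].
  elim: p v vA {vS K} => [|x p IH] v vA /=; first by move=> _ ->.
  by move=> /andP[vx /IH]; apply; exact: clA' vx.
have AK : (8 * #|A :\: K| < n)%N.
  rewrite ltnNge; apply/negP => H.
  suff /Amin : P (A :\: K).
    rewrite finset.cardsD (finset.setIidPr KA) => le.
    have : (0 < #|K|)%N by apply/card_gt0P; exists v; rewrite inE connect0.
    by have := subset_leq_card KA; card_lia.
  apply/and3P; split => //; first exact: fintype.subset_trans (finset.subsetDl _ _) AS.
  apply/forallP => u; apply/forallP => w; apply/implyP => /andP[].
  rewrite !inE => /andP[uK uA] uw; rewrite (clA' _ _ uA uw) andbT.
  apply: contra uK => vw; apply: connect_trans vw _.
  by rewrite avoiding_sym; exact: connect1.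
have Ksmall : (4 * #|K| <= n)%N by rewrite cardsE; exact: small.
have Acard : (8 * #|A| < 3 * n)%N.
  by move: AK; rewrite finset.cardsD (finset.setIidPr KA); have := subset_leq_card KA; card_lia.
pose B := ~: (S :|: A).
have cardB : (#|B| + #|A| + #|S| = n)%N.
  have := card_setC_ord (S :|: A); rewrite -/B finset.cardsU (_ : S :&: A = finset.set0) ?cards0; first card_lia.
  by apply/setP => x; rewrite !inE; apply/negP => /andP[xS /(fintype.subsetP AS)]; rewrite inE xS.
have := wl A B _ nA _ _; rewrite /cut_size.
have -> : [set e in G | crossing A B e] = finset.set0.
  apply/setP => e; rewrite !inE; apply/negP => /andP[eG].
  have adj1 : adj G (src e) (tgt e).
    by apply/existsP; exists e; rewrite eG /joins !eqxx.
  have nS x : x \in A -> x \notin S by move=> /(fintype.subsetP AS); rewrite inE.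
  rewrite /crossing !inE !negb_or => /orP[/andP[sA /andP[tS tA]]|/andP[/andP[tS tA] sA]].
    by move: tA; rewrite (clA' _ _ sA) // /avoiding adj1 nS.
  by move: tA; rewrite (clA' _ _ sA) // /avoiding adj_sym adj1 nS.
rewrite cards0 ltn0 => H.
have : false; last by [].
apply: H; [|card_lia|card_lia].
by rewrite finset.setCK finset.subsetUr.
Qed.

End Graphs.

(** * The lower bound for well-linked graphs *)

Section LowerBound.
Context (R : realType) (n : nat) (Gam : metric_graph R n).
Implicit Types (e : vpair n) (f g : mpoint Gam -> R).
Implicit Types (D E : mdivisor Gam) (u v w : 'I_n).
Local Notation len := (len Gam).
Local Notation G := (model Gam).
Local Notation vertex := (@vertex R n Gam).

Lemma cut_size_bound D f (A : {set 'I_n}) :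
  effective D -> rational_function f -> dominates D f ->
  (forall v w, v \in A -> w \notin A -> f (vertex w) < f (vertex v)) ->
  (cut_size G A (~: A))%:Z <= deg D.
Proof.
move=> De Hf Df HA.
have := @cut_bound R n Gam D f (fun v => v \in A) (fun=> 0%N) De Hf Df HA.
have H e : e \in G -> (src e \in A) != (tgt e \in A) ->
    0%:R * len e < `|f (vertex (src e)) - f (vertex (tgt e))|.
  move=> em sA; rewrite mul0r normr_gt0 subr_eq0.
  case sA1: (src e \in A) sA; case tA: (tgt e \in A) => // _.
    by rewrite gt_eqF // HA ?tA.
  by rewrite lt_eqF // HA ?sA1.
move=> /(_ H) /=; rewrite sumr_const; congr (_ <= _).
rewrite /cut_size natz; congr (Posz _).
by apply: eq_card => e; rewrite !inE /crossing !inE [LHS]/in_mem /=; case: (e \in G) => //=; case: (src e \in A); case: (tgt e \in A).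
Qed.

Section Fixed.
Context (k : nat) (wl : well_linked G k) (n0 : (0 < n)%N) (kn : (4 * k <= n)%N).

(** If f were not constant on most vertices, some level of f would separate two
    sets of n / 8 vertices, and the cut between them would have at most k
    edges. *)
Lemma majority D f : effective D -> deg D <= k%:Z ->
  rational_function f -> dominates D f ->
  exists c, (3 * n < 4 * #|[set v | f (vertex v) == c]|)%N.
Proof.
move=> De Dk Hf Df; pose phi v := f (vertex v).
pose P w := (n <= 8 * #|[set u | (phi u <= phi w)%R]|)%N.
have [w1 Pw1] : exists w, P w.
  case: (@arg_maxP _ _ 'I_n (Ordinal n0) predT phi isT) => w _ wmax; exists w.
  rewrite /P (_ : [set u | _] = [set: 'I_n]) ?cardsT ?card_ord ?leq_pmull //.
  by apply/setP => u; rewrite !inE; exact: wmax.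
case: (@arg_minP _ _ 'I_n w1 P phi Pw1) => w0 Pw0 w0min.
exists (phi w0).
have low : (8 * #|[set u | (phi u < phi w0)%R]| < n)%N.
  rewrite ltnNge; apply/negP => H.
  have [u0 u0L] : exists u, u \in [set u | phi u < phi w0].
    by apply/set0Pn; rewrite -cards_eq0; card_lia.
  rewrite inE in u0L.
  case: (@arg_maxP _ _ 'I_n u0 (fun u => phi u < phi w0) phi u0L) => u1 u1L u1max.
  suff /w0min : P u1 by rewrite /= leNgt u1L.
  apply: leq_trans H _; rewrite leq_mul2l /=; apply: subset_leq_card.
  by apply/fintype.subsetP => u; rewrite !inE => /u1max.
have high : (8 * #|[set u | (phi w0 < phi u)%R]| < n)%N.
  rewrite ltnNge; apply/negP => H.
  set A := [set u | _] in H.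
  have AC : ~: A = [set u | phi u <= phi w0] by apply/setP => u; rewrite !inE leNgt.
  have := @wl A (~: A); rewrite finset.setCK subxx AC -/(P w0) => /(_ isT H Pw0).
  have := card_setC_ord A; rewrite AC => cA.
  have -> : (n <= #|A| + #|[set u | (phi u <= phi w0)%R]| + 2 * k)%N by rewrite cA leq_addr.
  move=> /(_ isT); rewrite ltnNge => /negP; apply; rewrite -AC.
  rewrite -lez_nat; apply: le_trans Dk; apply: (cut_size_bound De Hf Df) => v w.
  by rewrite !inE -leNgt => h1 h2; exact: le_lt_trans h2 h1.
have : (n <= #|[set v | f (vertex v) == phi w0]| + #|[set u | (phi u < phi w0)%R]| + #|[set u | (phi w0 < phi u)%R]|)%N.
  rewrite -{1}(card_ord n) -cardsT.
  apply: leq_trans (leq_trans (leq_card_setU _ _) (leq_add (leq_card_setU _ _) (leqnn _))).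
  by apply: subset_leq_card; apply/fintype.subsetP => u _; rewrite !inE /phi; case: ltgtP.
by card_lia.
Qed.

(** Across the cut between the levels of the two ends of e, the edge e alone
    would carry more than k chips. *)
Lemma edge_Lipschitz D f e : effective D -> deg D <= k%:Z ->
  rational_function f -> dominates D f -> e \in G ->
  `|f (vertex (src e)) - f (vertex (tgt e))| <= k%:R * len e.
Proof.
move=> De Dk Hf Df em; rewrite leNgt; apply/negP => H.
pose c := Num.min (f (vertex (src e))) (f (vertex (tgt e))).
pose A := [pred u | c < f (vertex u)].
have ne : f (vertex (src e)) != f (vertex (tgt e)).
  apply: contraTneq H => ->; rewrite subrr normr0 -leNgt mulr_ge0 //.
  exact/ltW/len_gt0.
have eA : A (src e) != A (tgt e).
  by rewrite /A /c /=; case: (ltgtP (f (vertex (src e))) (f (vertex (tgt e)))) ne => h; rewrite ?ltxx ?h ?eqxx ?ltxx.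
have := @cut_bound R n Gam D f A (fun e' => if e' == e then k else 0%N) De Hf Df.
have h1 v w : A v -> ~~ A w -> f (vertex w) < f (vertex v).
  by rewrite /A /= -leNgt => a b; exact: le_lt_trans b a.
have h2 e' : e' \in G -> A (src e') != A (tgt e') ->
    (if e' == e then k else 0%N)%:R * len e' <
    `|f (vertex (src e')) - f (vertex (tgt e'))|.
  move=> em' eA'; case: eqVneq => [->//|_].
  rewrite mul0r normr_gt0 subr_eq0; apply: contraNneq eA' => E.
  by rewrite /A /= E.
move=> /(_ h1 h2).
rewrite (bigD1 e) /= ?em ?eA // eqxx.
set s := \sum_(i | _) _; have : 0 <= s by exact: sumr_ge0.
by move: Dk; card_lia.
Qed.


(** Functions along which D can be moved inside its effective linear system,
    normalised to vanish on most of the vertices. *)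
Definition normal_move D f := [/\ rational_function f, dominates D f &
  (3 * n < 4 * #|[set v | (f (vertex v) == 0)%R]|)%N].

(** These components meet the zero set of every normal move, which bounds the
    moves there. On small components they may be unbounded. *)
Definition in_large_component v := (n < 4 * #|connect (adj G) v|)%N.

Lemma move_bounded D : effective D -> deg D <= k%:Z ->
  exists b : R, forall f v, normal_move D f -> in_large_component v ->
    f (vertex v) <= b.
Proof.
move=> De Dk; pose M := \sum_e k%:R * `|len e|.
have M0 : 0 <= M by apply: sumr_ge0 => e _; exact: mulr_ge0.
exists (n%:R * M) => f v [Hf Df Zf] vW.
have [z vz fz] : exists2 z, connect (adj G) v z & f (vertex z) = 0.
  pose Z := [set z | (f (vertex z) == 0)%R]; pose K := [set z | connect (adj G) v z].
  have [z] : exists z, z \in K :&: Z.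
    apply/set0Pn; rewrite -card_gt0.
    have := finset.cardsUI K Z; have : (#|K :|: Z| <= n)%N.
      by have := max_card [in K :|: Z]; rewrite card_ord.
    have : (n < 4 * #|K|)%N by rewrite cardsE.
    by move: Zf; rewrite -/Z; card_lia.
  by rewrite !inE => /andP[vz /eqP fz]; exists z.
have step u w : adj G u w -> `|f (vertex u) - f (vertex w)| <= M.
  move=> /existsP[e /andP[em uw]].
  have : `|f (vertex (src e)) - f (vertex (tgt e))| <= M.
    apply: le_trans (edge_Lipschitz De Dk Hf Df em) _.
    rewrite /M (bigD1 e) //= (@gtr0_norm _ (len e)) ?len_gt0 // lerDl.
    by apply: sumr_ge0 => e' _; exact: mulr_ge0.
  by case/orP: uw => /andP[/eqP <- /eqP <-] //; rewrite distrC.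
have := vz => /connectP[p0 vp0 zp0]; move: vp0 zp0 => /shortenP[p vp up _] zp.
have psz : (size p <= n)%N.
  by have := max_card [in v :: p]; rewrite (card_uniqP up) card_ord /=; exact: ltnW.
have H q u : path (adj G) u q -> f (vertex u) - f (vertex (last u q)) <= (size q)%:R * M.
  elim: q u => [|x q IH] u /=; first by rewrite subrr mul0r.
  move=> /andP[/step ux /IH]; rewrite -natr1 mulrDl mul1r.
  by have := ler_norm (f (vertex u) - f (vertex x)); lra.
have := H _ _ vp; rewrite -zp fz subr0 => /le_trans; apply.
by rewrite ler_wpM2r // ler_nat.
Qed.

Lemma normal_moveD D D0 f g : effective D -> deg D <= k%:Z ->
  normal_move D f -> rational_function g -> dominates D0 g ->
  (3 * n < 4 * #|[set v | (g (vertex v) == 0)%R]|)%N ->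
  is_div f (D0 - D) ->
  normal_move D (fun x => Num.max (f x + g x) (f x)).
Proof.
move=> De Dk [Hf Df Zf] Hg Dg Zg fD.
have Hfg := rational_add Hf Hg.
have Hm := rational_max Hfg Hf.
have Dm : dominates D (fun x => Num.max (f x + g x) (f x)).
  move=> x; apply: (le_trans _ (ord_at_max x Hfg Hf)); rewrite le_min Df andbT.
  rewrite ord_at_add //; have := Dg x; have := fD x.
  by rewrite coeffB rmorphB /=; lra.
split => //.
have [c Zc] := majority De Dk Hm Dm.
pose A := [set v | (f (vertex v) == 0)%R]; pose B := [set v | (g (vertex v) == 0)%R].
set C := [set v | _] in Zc.
have [v] : exists v, v \in (A :&: B) :&: C.
  apply/set0Pn; rewrite -card_gt0.
  have := finset.cardsUI A B; have := finset.cardsUI (A :&: B) C.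
  have mc (S : {set 'I_n}) : (#|S| <= n)%N by have := card_setC_ord S; card_lia.
  by have := mc (A :|: B); have := mc ((A :&: B) :|: C); move: Zf Zg Zc; rewrite -/A -/B; card_lia.
rewrite !inE => /andP[/andP[/eqP fv /eqP gv] /eqP].
by rewrite fv gv addr0 maxxx => c0; move: Zc; rewrite /C -c0.
Qed.

(** D0 is nearly reduced with respect to the bulk of the graph. It is reached
    from D by a normal move f whose sum over the large components is almost
    maximal: if a move g from D0 raised some vertex by the length of an edge,
    the maximum of f + g and f would have a larger sum than possible. *)
Lemma nearly_reduced D : effective D -> deg D <= k%:Z ->
  exists D0, [/\ effective D0, lin_equiv D0 D &
    forall g, rational_function g -> dominates D0 g ->
      (3 * n < 4 * #|[set v | (g (vertex v) == 0)%R]|)%N ->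
      forall v e, in_large_component v -> e \in G -> g (vertex v) < len e].
Proof.
move=> De Dk.
pose delta : R := \big[Num.min/1]_(e in G) len e.
have delta0 : 0 < delta by apply: lt_bigmin => // e /len_gt0.
pose F f := \sum_(v | in_large_component v) f (vertex v).
pose S := [set F f | f in [set f | normal_move D f]]%classic.
have N0 : normal_move D (fun=> 0).
  split; first exact: rational_cst.
    by move=> x; rewrite ord_at_cst oppr_le0 ler0z; exact/effectiveP.
  rewrite (_ : [set v | _] = [set: 'I_n]) ?cardsT ?card_ord; first by lia.
  by apply/setP => v; rewrite !inE eqxx.
have [b Hb] := move_bounded De Dk.
have hS : has_sup S.
  split; first by exists (F (fun=> 0)); exists (fun=> 0).
  exists (\sum_(v | in_large_component v) b) => _ [f Nf <-].
  by apply: ler_sum => v vW; exact: Hb.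
have [_ [f Nf <-] fsup] := sup_adherent delta0 hS.
have [Hf Df Zf] := Nf; have [E fE] := rational_has_div Hf.
exists (D + E); split.
- apply/effectiveP => x; have := Df x; rewrite -fE -rmorphN ler_int coeffD; lia.
- by exists f => //; rewrite addrC addKr.
- move=> g Hg Dg Zg v e vW em.
  have fD : is_div f (D + E - D) by rewrite addrC addKr.
  have Nh := normal_moveD De Dk Nf Hg Dg Zg fD.
  have : F (fun x => Num.max (f x + g x) (f x)) <= sup S.
    by apply: ub_le_sup; [case: hS|exists (fun x => Num.max (f x + g x) (f x))].
  rewrite leNgt => /negP nlt; rewrite ltNge; apply/negP => le; apply: nlt.
  have dle : delta <= len e by apply: bigmin_le_cond.
  have : F f + g (vertex v) <= F (fun x => Num.max (f x + g x) (f x)).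
    rewrite /F (bigD1 v) //= [leRHS](bigD1 v) //= addrAC; apply: lerD.
      by rewrite le_max lexx.
    by apply: ler_sum => w _; rewrite le_max lexx orbT.
  by move: fsup dle le; lra.
Qed.

(** A chip of D0 hits its vertex, or both ends of the edge in which it lies. *)
Lemma num_hit D0 : effective D0 -> deg D0 <= k%:Z ->
  (#|[set v | (0 < coeff (vertex v) D0)%R] :|:
     ([set src e | e in [set e in G | (0 < edge_deg D0 e)%R]] :|:
      [set tgt e | e in [set e in G | (0 < edge_deg D0 e)%R]])| <= 2 * k)%N.
Proof.
move=> De Dk; rewrite deg_split in Dk.
have pos (T : finType) (P : pred T) (a : T -> int) : (forall x, 0 <= a x) ->
    (#|[set x in P | 0 < a x]|%:Z <= \sum_(x in P) a x)%R.
  move=> a0; rewrite -sum1_card (big_morph Posz PoszD (erefl _)) /=.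
  rewrite big_mkcond [leRHS]big_mkcond /=; apply: ler_sum => x _.
  by rewrite !inE; case: (x \in P) => //=; case: ifP => // ; have := a0 x; lia.
pose H := [set e in G | (0 < edge_deg D0 e)%R].
have h1 : #|[set v | (0 < coeff (vertex v) D0)%R]|%:Z <= \sum_v coeff (vertex v) D0.
  rewrite (_ : [set v | _] = [set v in predT | 0 < coeff (vertex v) D0]).
    by apply: pos => v; exact: effectiveP.
  by apply/setP => v; rewrite !inE.
have h2 : #|H|%:Z <= \sum_(e in G) edge_deg D0 e.
  by apply: pos => e; exact: edge_deg_ge0.
have h3 : (#|[set src e | e in H]| <= #|H|)%N by exact: leq_imset_card.
have h4 : (#|[set tgt e | e in H]| <= #|H|)%N by exact: leq_imset_card.
rewrite -/H; set X := [set v | _]; set Y := [set src e | e in H] in h3 *.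
set Z := [set tgt e | e in H] in h4 *.
have [h5 _] := leq_card_setU X (Y :|: Z); have [h6 _] := leq_card_setU Y Z.
rewrite -/X in h1.
by card_lia.
Qed.

(** Delete from the graph the vertices that the chips of a nearly reduced D0
    hit, take a vertex v in a large component of what remains, and move a chip
    to v by a function g that vanishes on most of the vertices, hence somewhere
    in this component. Along an edge without chips slopes only grow, so next to a vertex
    with g >= 0 a positive slope would raise g by a full edge length. All slopes
    at this vertex are therefore 0, it receives no chip, and g >= 0 at its
    neighbours. This propagates to v, which contradicts the choice of g. *)
Lemma positive_rank_deg D : positive_rank D -> k%:Z < deg D.
Proof.
move=> rD; rewrite ltNge; apply/negP => Dk.
have [D1 [D1e _ D1D]] := positive_rank_move (Ordinal n0) rD.
have D1k : deg D1 <= k%:Z by rewrite (lin_equiv_deg D1D).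
have [D0 [De D01 small]] := nearly_reduced D1e D1k.
have D0k : deg D0 <= k%:Z by rewrite (lin_equiv_deg D01).
have D0D := lin_equiv_trans D01 D1D.
have := num_hit De D0k; set S := _ :|: _ => Sk.
have [v vS Cv] := well_linked_component wl n0 kn Sk.
have [Ev [Eve Evv /lin_equiv_trans/(_ (lin_equiv_sym D0D))[g0 Hg0 g0E]]] :=
  positive_rank_move v rD.
have Dg0 : dominates D0 g0.
  move=> x; rewrite -g0E coeffB intrD rmorphN /= lerDr ler0z.
  exact/effectiveP.
have [c Zc] := majority De D0k Hg0 Dg0.
pose g x := g0 x + (fun=> - c) x.
have Hg : rational_function g by apply: rational_add => //; exact: rational_cst.
have og x : ord_at g x = ord_at g0 x.
  by rewrite ord_at_add ?ord_at_cst ?addr0 //; exact: rational_cst.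
have Dg : dominates D0 g by move=> x; rewrite og.
have Zg : (3 * n < 4 * #|[set v | (g (vertex v) == 0)%R]|)%N.
  rewrite (_ : [set v | (g (vertex v) == 0)%R] = [set v | (g0 (vertex v) == c)%R]) //.
  by apply/setP => w; rewrite !inE /g subr_eq0.
have {}small := small g Hg Dg Zg.
pose rS := avoiding G S.
have subS w u : connect rS w u -> connect (adj G) w u.
  by apply: connect_sub => x y /and3P[xy _ _]; exact: connect1.
have inC w : connect rS v w -> in_large_component w.
  move=> vw; apply: (leq_trans Cv); rewrite leq_mul2l /=.
  apply: subset_leq_card; apply/fintype.subsetP => u vu.
  apply: subS; apply: connect_trans vu.
  by rewrite avoiding_sym.
have inW w e : connect rS v w -> e \in G ->
    (src e == w -> in_large_component (tgt e)) /\
    (tgt e == w -> in_large_component (src e)).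
  move=> vw em.
  have K u : adj G w u -> in_large_component u.
    move=> wu; apply: (leq_trans (inC w vw)); rewrite leq_mul2l /=.
    apply: subset_leq_card; apply/fintype.subsetP => x wx.
    apply: connect_trans wx; apply: connect1; by rewrite adj_sym.
  split=> /eqP E; apply: K; apply/existsP; exists e; rewrite em /joins E !eqxx //.
  by rewrite orbT.
have notS w : connect rS v w -> w \notin S.
  move=> /connectP[p vp ->].
  suff H q u : u \notin S -> path rS u q -> last u q \notin S by exact: H vp.
  elim: q u => [|x q IH] u //= _ /andP[/and3P[_ _ xS] xq]; exact: IH xq.
have unhit w : w \notin S -> coeff (vertex w) D0 = 0 /\
    (forall e, e \in G -> (src e == w) || (tgt e == w) -> edge_deg D0 e = 0).
  rewrite !finset.in_setU !negb_or finset.inE -leNgt => /and3P[w0 ws wt]; split.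
    by apply/eqP; rewrite eq_le w0; exact/effectiveP.
  move=> e em ew; apply/eqP; rewrite eq_le edge_deg_ge0 // andbT leNgt.
  apply/negP => e0; case/orP: ew => /eqP ew; [move/negP: ws|move/negP: wt];
    by apply; apply/imsetP; exists e; rewrite ?inE ?em.
(* Near an unhit vertex where g is not negative, g would have to climb by a
   full edge length along any edge of positive slope. *)
have slopes w : connect rS v w -> 0 <= g (vertex w) ->
    [/\ forall e, e \in G -> src e == w -> src_slope g e <= 0 /\
        g (vertex w) + src_slope g e * len e <= g (vertex (tgt e)) &
      forall e, e \in G -> tgt e == w -> tgt_slope g e <= 0 /\
        g (vertex w) + tgt_slope g e * len e <= g (vertex (src e))].
  move=> vw gw; have [_ we] := unhit w (notS w vw).
  split=> e em ew.
  - have [s0 [s1 [-> _ _ h2 _]]] := edge_slopes De Hg Dg em.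
    have /(_ (- s0)) := h2; rewrite we ?ew // rmorphN /= => h.
    have up : g (vertex w) + s0%:~R * len e <= g (vertex (tgt e)).
      rewrite leNgt; apply/negP => lt; suff : s0 - s0 + 1 <= 0 by clear; lia.
      by apply: h; rewrite (eqP ew); lra.
    split => //; have [/(_ ew) tW _] := inW w e vw em.
    have := small _ _ tW em => lt.
    have : s0%:~R * len e < 1 * len e by lra.
    by rewrite ltr_pM2r ?len_gt0 // (@ltr_int R s0 1) lerz0; clear; lia.
  - have [s0 [s1 [_ -> _ _ h2]]] := edge_slopes De Hg Dg em.
    have /(_ (- s1)) := h2; rewrite we ?ew ?orbT // rmorphN /= => h.
    have up : g (vertex w) + s1%:~R * len e <= g (vertex (src e)).
      rewrite leNgt; apply/negP => lt; suff : s1 - s1 + 1 <= 0 by clear; lia.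
      by apply: h; rewrite (eqP ew); lra.
    split => //; have [_ /(_ ew) tW] := inW w e vw em.
    have := small _ _ tW em => lt.
    have : s1%:~R * len e < 1 * len e by lra.
    by rewrite ltr_pM2r ?len_gt0 // (@ltr_int R s1 1) lerz0; clear; lia.
have flat w : connect rS v w -> 0 <= g (vertex w) ->
    coeff (vertex w) Ev = 0 /\ forall u, adj G w u -> 0 <= g (vertex u).
  move=> vw gw; have [h1 h2] := slopes w vw gw.
  have [w0 _] := unhit w (notS w vw).
  have ow : (coeff (vertex w) Ev)%:~R = ord_at g (vertex w).
    by rewrite og -g0E coeffB w0 subr0.
  have Ew0 : 0 <= (coeff (vertex w) Ev)%:~R :> R by rewrite ler0z; exact/effectiveP.
  pose a := \sum_(e in G | src e == w) src_slope g e.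
  pose b := \sum_(e in G | tgt e == w) tgt_slope g e.
  have a0 : a <= 0 by apply: sumr_le0 => e /andP[em ew]; exact: (proj1 (h1 e em ew)).
  have b0 : b <= 0 by apply: sumr_le0 => e /andP[em ew]; exact: (proj1 (h2 e em ew)).
  have ab : (coeff (vertex w) Ev)%:~R = a + b by rewrite ow ord_vertex.
  split; first by apply/eqP; rewrite -(@intr_eq0 R) eq_le Ew0 ab; lra.
  move=> u /existsP[e /andP[em /orP[]/andP[/eqP E1 /eqP E2]]].
  - have ew : src e == w by rewrite E1.
    have [s0 up] := h1 e em ew.
    have : a <= src_slope g e.
      rewrite /a (bigD1 e) /= ?em ?ew // gerDl; apply: sumr_le0 => e' /andP[/andP[em' ew'] _].
      exact: (proj1 (h1 e' em' ew')).
    rewrite E2 in up; have := len_gt0 em; nra.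
  - have ew : tgt e == w by rewrite E2.
    have [s0 up] := h2 e em ew.
    have : b <= tgt_slope g e.
      rewrite /b (bigD1 e) /= ?em ?ew // gerDl; apply: sumr_le0 => e' /andP[/andP[em' ew'] _].
      exact: (proj1 (h2 e' em' ew')).
    rewrite E1 in up; have := len_gt0 em; nra.
have [w0 vw0 gw0] : exists2 w, connect rS v w & g (vertex w) = 0.
  pose Z := [set z | (g (vertex z) == 0)%R]; pose K := [set z | connect rS v z].
  have [z] : exists z, z \in K :&: Z.
    apply/set0Pn; rewrite -card_gt0.
    have := finset.cardsUI K Z; have := card_setC_ord (K :|: Z).
    have : (n < 4 * #|K|)%N by rewrite cardsE.
    by move: Zg; rewrite -/Z; card_lia.
  by rewrite !inE => /andP[vz /eqP fz]; exists z.
have gv : 0 <= g (vertex v).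
  have : connect rS w0 v by rewrite avoiding_sym.
  move=> /connectP[p]; have : 0 <= g (vertex w0) by rewrite gw0.
  elim: p w0 vw0 {gw0} => [|x p IH] w vw gw /=; first by move=> _ ->.
  move=> /andP[wx xp]; have /and3P[awx _ _] := wx.
  apply: (IH x) => //; first exact: connect_trans vw (connect1 wx).
  by have [_] := flat w vw gw; apply.
by have [] := flat v (connect0 _ _) gv; move: Evv => /[swap] ->.
Qed.

End Fixed.
End LowerBound.

(** * The random graph G(n, p) *)

Section Pairs.
Context (n : nat).
Implicit Types (e : vpair n) (u v : 'I_n) (A B : {set 'I_n}) (G : graph n).

Lemma joins_ex u v : u != v -> exists e, joins e u v.
Proof.
move=> uv; have [lt|lt|eq] := ltngtP u v.
- by exists (exist _ (u, v) lt : vpair n); rewrite /joins /src /tgt /= !eqxx.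
- by exists (exist _ (v, u) lt : vpair n); rewrite /joins /src /tgt /= !eqxx orbT.
- by move: uv; rewrite (ord_inj eq) eqxx.
Qed.

Lemma crossing_card A B : A \subset ~: B ->
  (#|A| * #|B| <= #|[set e | crossing A B e]|)%N.
Proof.
move=> AB; rewrite -cardsX.
pose h e := if src e \in A then (src e, tgt e) else (tgt e, src e).
apply: leq_trans (leq_imset_card h _); apply: subset_leq_card.
apply/fintype.subsetP => -[u v]; rewrite finset.inE /= => /andP[uA vB].
have vA : v \notin A by apply: contraL vB => /(fintype.subsetP AB); rewrite finset.inE.
have [e] : exists e, joins e u v by apply: joins_ex; apply: contraNneq vA => <-.
case/orP => /andP[/eqP E1 /eqP E2]; apply/imsetP; exists e;
  by rewrite ?finset.inE /crossing /h E1 E2 ?uA ?vB ?orbT // (negbTE vA).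
Qed.

End Pairs.

Section Gnp.
Context (R : realType) (n : nat) (p : R) (p01 : 0 <= p <= 1).
Implicit Types (G : graph n) (X : {set vpair n}).

Definition weight G : R := \prod_(e : vpair n) (if e \in G then p else 1 - p).

Lemma weight_ge0 G : 0 <= weight G.
Proof.
by apply: prodr_ge0 => e _; case: ifP => _; case/andP: p01; rewrite ?subr_ge0.
Qed.

Lemma weight_sum : \sum_G weight G = 1.
Proof.
by rewrite /weight -bigA_distr big1 // => e _ /=; rewrite addrC subrK.
Qed.

(** Markov's inequality for the variable 2 ^ - #|G :&: X|, whose expectation is
    the product of the factors 1 - p / 2 over X. *)
Lemma weight_few X k : \sum_(G : graph n | (#|G :&: X| <= k)%N) weight G <=
  2 ^+ k * expR (- (p / 2 * #|X|%:R)).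
Proof.
have half0 : 0 <= (2^-1 : R) by rewrite invr_ge0.
apply: (@le_trans _ _ (\sum_(G : graph n) 2 ^+ k * (weight G * 2^-1 ^+ #|G :&: X|))).
  rewrite big_mkcond /=; apply: ler_sum => G _; case: ifP => [le|_]; last first.
    by rewrite !mulr_ge0 ?exprn_ge0 // weight_ge0.
  rewrite mulrCA -[leLHS]mulr1 ler_wpM2l ?weight_ge0 //.
  rewrite -(subnK le) exprD -mulrA -exprMn divff ?pnatr_eq0 // expr1n mulr1.
  by rewrite exprn_ege1 // ler1n.
rewrite -mulr_sumr ler_wpM2l ?exprn_ge0 //.
have E G : weight G * 2^-1 ^+ #|G :&: X| =
    \prod_e (if e \in G then p * (if e \in X then 2^-1 else 1) else 1 - p).
  rewrite -prodr_const /weight [X in _ * X]big_mkcond -big_split /=.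
  apply: eq_bigr => e _; rewrite finset.inE.
  by case: (e \in G) => /=; [case: ifP|]; rewrite ?mulr1.
under eq_bigr do rewrite E.
rewrite -bigA_distr.
have -> : - (p / 2 * #|X|%:R) = \sum_(e in X) (- (p / 2)).
  by rewrite sumr_const mulNrn mulr_natr.
rewrite expR_sum [leRHS]big_mkcond /=; apply: ler_prod => e _.
case: ifP => _; last by rewrite mulr1 addrC subrK lexx ler01.
apply/andP; split.
  by case/andP: p01 => p0 p1; rewrite addr_ge0 ?mulr_ge0 // subr_ge0.
by apply: le_trans (expR_ge1Dx _); lra.
Qed.

(** A union bound: there are at most 4 ^ n pairs of sets of n / 8 vertices, and
    n ^ 2 / 64 potential edges between two such sets. The 3 in the exponent
    stands for the logarithm of 4 * 2, as e ^ 3 >= 8. *)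
Lemma weight_not_linked k : (k <= n)%N ->
  \sum_(G : graph n | ~~ `[< well_linked G k >]) weight G <=
  expR (n%:R * (3 - n%:R * p / 128)).
Proof.
move=> kn.
pose bad (AB : {set 'I_n} * {set 'I_n}) := [&& AB.1 \subset ~: AB.2,
  (n <= 8 * #|AB.1|)%N & (n <= 8 * #|AB.2|)%N].
apply: (@le_trans _ _ (\sum_(AB | bad AB)
    \sum_(G : graph n | (cut_size G AB.1 AB.2 <= k)%N) weight G)).
  rewrite (exchange_big_dep predT) //= big_mkcond /=; apply: ler_sum => G _.
  case: ifPn => [/asboolP nl|_]; last by apply: sumr_ge0 => AB _; exact: weight_ge0.
  have [[A B] H] : exists AB, bad AB && (cut_size G AB.1 AB.2 <= k)%N.
    apply: contrapT => no; apply: nl => A B AB nA nB _.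
    rewrite ltnNge; apply/negP => le; apply: no; exists (A, B).
    by rewrite /bad /= AB nA nB le.
  rewrite (bigD1 (A, B)) //= lerDl; apply: sumr_ge0 => AB _; exact: weight_ge0.
have bound AB : bad AB ->
    \sum_(G : graph n | (cut_size G AB.1 AB.2 <= k)%N) weight G <=
    2 ^+ n * expR (- (n%:R * (n%:R * p / 128))).
  case: AB => A B /and3P[/= AB nA nB].
  have := weight_few [set e | crossing A B e] k.
  have -> : \sum_(G : graph n | (#|G :&: [set e | crossing A B e]| <= k)%N) weight G =
      \sum_(G : graph n | (cut_size G A B <= k)%N) weight G.
    apply: eq_bigl => G; rewrite /cut_size; congr (_ <= _)%N.
    by apply: eq_card => e; rewrite !finset.inE.
  move=> /le_trans; apply; apply: ler_pM; rewrite ?exprn_ge0 ?expR_ge0 //.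
    by rewrite ler_eXn2l // ltr1n.
  rewrite ler_expR lerN2.
  have := crossing_card AB; set x := #|[set e | _]| => xAB.
  have : (n * n <= 64 * x)%N.
    by apply: (leq_trans (leq_mul nA nB)); rewrite mulnACA leq_mul2l.
  rewrite -(ler_nat R) !natrM => nx.
  have [p0 _] := andP p01; nra.
apply: (le_trans (ler_sum _ bound)); rewrite sumr_const -[leLHS]mulr_natl.
have cardbad : (#|bad| <= 4 ^ n)%N.
  apply: leq_trans (max_card _) _.
  have cs : #|{set 'I_n}| = (2 ^ n)%N.
    by rewrite -cardsT -powersetT card_powerset cardsT card_ord.
  by rewrite card_prod cs -expnMn.
have e2 : 8 ^+ n <= expR (n%:R * 3) :> R.
  have -> : 8 ^+ n = ((2 : R) ^+ 3) ^+ n by congr (_ ^+ n); ring.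
  rewrite expRM_natl; apply: lerXn2r; rewrite ?nnegrE ?expR_ge0 ?exprn_ge0 //.
  rewrite -[X in expR X]mulr1 expRM_natl ler_pXn2r ?nnegrE ?expR_ge0 //.
  by apply: le_trans (expR_ge1Dx _); lra.
rewrite mulrBr expRD [leLHS]mulrA; apply: ler_pM; rewrite ?mulr_ge0 ?exprn_ge0 ?expR_ge0 //.
apply: le_trans e2; have -> : 8 ^+ n = 4 ^+ n * 2 ^+ n :> R.
  by rewrite -exprMn; congr (_ ^+ n); ring.
by rewrite ler_wpM2r ?exprn_ge0 // -natrX ler_nat.
Qed.

Lemma prob_Gnp_ge (A : set (graph n)) k : (k <= n)%N ->
  (forall G, well_linked G k -> A G) ->
  1 - expR (n%:R * (3 - n%:R * p / 128)) <= prob_Gnp p A <= 1.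
Proof.
move=> kn HA; rewrite (_ : prob_Gnp p A = \sum_(G | G \in A) weight G) //; apply/andP; split; last first.
  rewrite -[leRHS]weight_sum [leRHS](bigID (fun G => G \in A)) /= lerDl.
  by apply: sumr_ge0 => G _; exact: weight_ge0.
rewrite lerBlDr; apply: le_trans (lerD (lexx _) (weight_not_linked kn)).
rewrite -[leLHS]weight_sum.
rewrite big_mkcond [X in _ <= X + _]big_mkcond [X in _ <= _ + X]big_mkcond -big_split /=.
apply: ler_sum => G _; rewrite -/(weight G).
case: asboolP => [/HA GA|_] /=; last by case: ifP => _; rewrite ?add0r ?lerDl ?weight_ge0.
by rewrite mem_set // addr0.
Qed.

End Gnp.

Section Limits.
Local Open Scope classical_set_scope.
Context (R : realType).

Lemma expRN_le_harmonic (n : nat) : expR (- n%:R) <= harmonic n :> R.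
Proof.
rewrite expRN /harmonic /= lef_pV2 ?posrE ?expR_gt0 ?ltr0n //.
by apply: le_trans (expR_ge1Dx _); rewrite -natr1 addrC.
Qed.

Lemma cvg_to_1 (F : set_system nat) (u v : nat -> R) : Filter F -> v x @[x --> F] --> (0 : R) ->
  (\forall n \near F, 1 - v n <= u n <= 1) -> u x @[x --> F] --> (1 : R).
Proof.
move=> FF v0 H; apply: (squeeze_cvgr H); last exact: cvg_cst.
by rewrite -[X in _ --> X]subr0; apply: cvgB => //; exact: cvg_cst.
Qed.

Lemma prob_Gnp_cvg1 (p : nat -> R) (A : forall n, set (graph n)) (k : nat -> nat) :
  (forall n, 0 <= p n <= 1) -> n%:R * p n @[n --> \oo] --> +oo ->
  (forall n, (k n <= n)%N) ->
  (\forall n \near \oo, forall G : graph n, well_linked G (k n) -> A n G) ->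
  prob_Gnp (p n) (A n) @[n --> \oo] --> (1 : R).
Proof.
move=> p01 /cvgryPge/(_ 512) pn kn HA.
apply: (cvg_to_1 (v := harmonic)); first exact: cvg_harmonic.
apply: filterS2 pn HA => n pn HA.
have /andP[lo ->] := prob_Gnp_ge (p01 n) (kn n) HA; rewrite andbT.
apply: le_trans lo; rewrite lerB // ; apply: le_trans (expRN_le_harmonic n).
by rewrite ler_expR -mulrN1 ler_wpM2l //; lra.
Qed.

End Limits.

(** * Counting matchings across a cut *)

Section Binomials.
Local Open Scope nat_scope.

Lemma bin_Vandermonde_le p q u v : 'C(p, u) * 'C(q, v) <= 'C(p + q, u + v).
Proof.
rewrite -binomial.Vandermonde.
have uv : u < (u + v).+1 by rewrite ltnS leq_addr.
by rewrite (bigD1 (Ordinal uv)) //= addKn leq_addr.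
Qed.

Lemma exp2_le_bin w u v : w <= u -> w <= v -> 2 ^ w <= 'C(u + v, u).
Proof.
elim: w u v => [|w IH] [|u] [|v] //; try by rewrite bin_gt0 leq_addr.
move=> wu wv; rewrite addSn addnS binS expnS mul2n -addnn; apply: leq_add.
  by apply: leq_trans (IH u v wu wv) _; rewrite binS leq_addl.
by apply: leq_trans (IH u v wu wv) _; rewrite leq_bin2l.
Qed.

(** The number of ways to choose 2 s + j of 2 (s + t + j) points that are grouped
    in pairs, so that exactly j pairs are split. The number of perfect matchings
    of these points with j edges across a fixed cut of sizes 2 s + j and 2 t + j
    is proportional to it. *)
Definition split_count s t j := 2 ^ j * 'C(s + t + j, j) * 'C(s + t, s).

Lemma split_count_fact s t j :
  split_count s t j * (j`! * s`! * t`!) = 2 ^ j * (s + t + j)`!.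
Proof.
rewrite /split_count -(@bin_fact (s + t + j) j) ?leq_addl // addnK.
rewrite -(@bin_fact (s + t) s) ?leq_addr // addKn; ring.
Qed.

Lemma split_count_step s t j :
  split_count s.+1 t.+1 j * (s.+1.*2 * t.+1.*2) =
  split_count s t j.+2 * (j.+1 * j.+2).
Proof.
have F0 : 0 < j`! * s`! * t`! by rewrite !muln_gt0 !fact_gt0.
apply/eqP; rewrite -(eqn_pmul2r F0); apply/eqP.
have h1 := split_count_fact s.+1 t.+1 j; have h2 := split_count_fact s t j.+2.
transitivity (4 * (split_count s.+1 t.+1 j * (j`! * (s.+1)`! * (t.+1)`!))).
  rewrite !factS -!mul2n; ring.
rewrite h1; transitivity (split_count s t j.+2 * ((j.+2)`! * s`! * t`!)); last first.
  by rewrite !factS; ring.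
rewrite h2 !expnS (_ : s.+1 + t.+1 + j = s + t + j.+2); first by ring.
by rewrite !addSn !addnS.
Qed.

Lemma coef_1Xn (m e : nat) : (((1 + 'X : {poly int}) ^+ m)`_e = 'C(m, e)%:Z)%R.
Proof.
rewrite exprDn coef_sum.
under eq_bigr => i _ do rewrite expr1n mul1r coefMn coefXn.
have [em|me] := leqP e m.
  have em' : e < m.+1 by [].
  rewrite (bigD1 (Ordinal em')) //= eqxx big1 ?addr0 ?natz // => i ie.
  rewrite eq_sym (_ : _ == _ = false) ?mul0rn //; apply/negbTE.
  by apply: contra ie => /eqP E; apply/eqP/val_inj.
rewrite bin_small // big1 // => i _; rewrite (_ : _ == _ = false) ?mul0rn //.
by apply/negbTE; rewrite neq_ltn; apply/orP; right; apply: leq_ltn_trans me; rewrite -ltnS.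
Qed.

Lemma coef_1X2n (m e : nat) : (((1 + 'X^2 : {poly int}) ^+ m)`_e =
  if odd e then 0 else 'C(m, e./2)%:Z)%R.
Proof.
have -> : ((1 + 'X^2 : {poly int}) ^+ m = (1 + 'X) ^+ m \Po 'X^2)%R.
  by rewrite rmorphXn /= rmorphD rmorph1 /= comp_polyX.
rewrite coef_comp_poly_Xn // coef_1Xn dvdn2 divn2; by case: (odd e).
Qed.

(** The coefficient of X^a in (1 + X)^(2 m) = ((1 + X^2) + 2 X)^m is the sum of
    the counts of split pairs, over at most m + 1 values of j. *)
Lemma bin_double_le m a K : (forall s t j, s + t + j = m -> s.*2 + j = a ->
    split_count s t j <= K) -> 'C(m.*2, a) <= m.+1 * K.
Proof.
move=> H; rewrite -lez_nat -coef_1Xn.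
have -> : ((1 + 'X : {poly int}) ^+ m.*2 = ((1 + 'X^2) + 'X *+ 2) ^+ m)%R.
  by rewrite -mul2n exprM; congr (_ ^+ m)%R; ring.
rewrite exprDn coef_sum.
have -> : (m.+1 * K)%N%:Z%R = (\sum_(i < m.+1) K%:Z)%R.
  by rewrite sumr_const card_ord -mulr_natl natz -PoszM.
apply: ler_sum => -[i im] _ /=.
have im' : i <= m by [].
have -> : ((1 + 'X^2 : {poly int}) ^+ (m - i) * ('X *+ 2) ^+ i =
    (((1 + 'X^2) ^+ (m - i) *+ 2 ^ i) * 'X^i))%R.
  by rewrite exprMn_n mulrnAr mulrnAl.
rewrite -mulrnAl coefMXn; case: ltnP => [_|ia]; first by rewrite lez_nat.
rewrite !coefMn coef_1X2n; case: ifP => [_|ev]; first by rewrite !mul0rn lez_nat.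
set s := (a - i)./2.
have sE : s.*2 = a - i by rewrite -[RHS]odd_double_half ev.
have [sm|ms] := leqP s (m - i); last by rewrite bin_small // !mul0rn lez_nat.
have := H s (m - i - s) i _ _; rewrite /split_count.
have e1 : s + (m - i - s) = m - i by rewrite subnKC.
rewrite e1 subnK // sE subnK // => /(_ erefl erefl) le.
by rewrite -mulrnA -mulr_natr natz -PoszM lez_nat mulnC.
Qed.

(** A single term of the binomial expansion of (Z + 2)^m. For a large Z it
    bounds the left-hand side by a small exponential when j is a small fraction
    of m. *)
Lemma bin_exp2_le m j Z : 2 ^ j * 'C(m, j) * Z ^ m <= Z ^ j * (Z + 2) ^ m.
Proof.
have [jm|mj] := leqP j m; last by rewrite bin_small // muln0.
rewrite expnDn.
have jm' : j < m.+1 by [].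
rewrite (bigD1 (Ordinal jm')) //= mulnDr; apply: leq_trans (leq_addr _ _).
have -> : Z ^ m = Z ^ (m - j) * Z ^ j by rewrite -expnD subnK.
apply: eq_leq; ring.
Qed.

(** Why a union bound over cuts succeeds for d >= 3. In a random matching of the
    d n half-edges, the probability that j pairs are split by a cut with d x
    half-edges on one side is at most about split_count s t j over
    'C(d n, d x). By Vandermonde's inequality the latter binomial contains the
    number 'C(n, x) of cuts, the number 'C(s + t, s) of choices of the unsplit
    pairs, and an exponential factor from what is left of the half-edges. *)
Lemma split_count_gain d n x y s t j : 3 <= d -> x + y = n ->
  s.*2 + j = d * x -> t.*2 + j = d * y ->
  split_count s t j * 'C(n, x) * 2 ^ (minn x y)./2 <=
  2 ^ j * 'C(s + t + j, j) * 'C(d * n, d * x).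
Proof.
move=> d3 xy sj tj; rewrite /split_count -!mulnA leq_mul2l expn_eq0 /=.
rewrite leq_mul2l; apply/orP; right.
have [e ed] : exists e, d = e.+3 by exists (d - 3); rewrite -addn3 subnK.
have sx : s <= d.-1 * x.
  by move: sj; rewrite ed /=; nia.
have ty : t <= d.-1 * y.
  by move: tj; rewrite ed /=; nia.
have key : 2 ^ (minn x y)./2 <= 'C((d.-1 * x - s) + (d.-1 * y - t), d.-1 * x - s).
  have hx : x./2 <= d.-1 * x - s.
    by have := half_leq (leqnn x); rewrite ed /= in sj *; move: (odd_double_half x); nia.
  have hy : y./2 <= d.-1 * y - t.
    by rewrite ed /= in tj *; move: (odd_double_half y); nia.
  apply: exp2_le_bin; [apply: leq_trans hx|apply: leq_trans hy]; apply: half_leq.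
    exact: geq_minl.
  exact: geq_minr.
have dx : d * x = s + (x + (d.-1 * x - s)).
  by rewrite addnCA subnKC // ed /= mulSn.
have dn : d * n = (s + t) + (n + ((d.-1 * x - s) + (d.-1 * y - t))).
  rewrite -xy mulnDr dx (_ : d * y = t + (y + (d.-1 * y - t))); last first.
    by rewrite addnCA subnKC // ed /= mulSn.
  by ring.
rewrite dn dx; apply: leq_trans (bin_Vandermonde_le _ _ _ _).
rewrite leq_mul2l; apply/orP; right.
apply: leq_trans (bin_Vandermonde_le _ _ _ _).
by rewrite leq_mul2l key orbT.
Qed.

End Binomials.

(** * Switchings of regular graphs *)

Section Switching.
Local Open Scope nat_scope.
Context (n : nat).
Implicit Types (e : vpair n) (u v w : 'I_n) (A B : {set 'I_n}) (G : graph n).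

Lemma joins_irrefl e u : joins e u u = false.
Proof.
apply/negP => /orP[]/andP[/eqP E1 /eqP E2];
  by have := src_neq_tgt e; rewrite E1 E2 eqxx.
Qed.

Lemma joins_inj e f u v : joins e u v -> joins f u v -> e = f.
Proof.
have E e' u' v' : src e' == u' -> tgt e' == v' -> val e' = (u', v').
  by rewrite /src /tgt; case: (val e') => a b /= /eqP -> /eqP ->.
have lt e' u' v' : src e' == u' -> tgt e' == v' -> (u' < v')%N.
  by move=> /eqP <- /eqP <-; exact: (valP e').
case/orP => /andP[a1 a2]; case/orP => /andP[b1 b2].
- by apply: val_inj; rewrite (E _ _ _ a1 a2) (E _ _ _ b1 b2).
- by have := lt _ _ _ a1 a2; rewrite ltnNge ltnW // (lt _ _ _ b1 b2).
- by have := lt _ _ _ a1 a2; rewrite ltnNge ltnW // (lt _ _ _ b1 b2).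
- by apply: val_inj; rewrite (E _ _ _ a1 a2) (E _ _ _ b1 b2).
Qed.

Lemma adj_irrefl G u : adj G u u = false.
Proof. by apply/existsP => -[e]; rewrite joins_irrefl andbF. Qed.

Lemma adj_joins G e u v : joins e u v -> adj G u v = (e \in G).
Proof.
move=> euv; apply/idP/idP => [/existsP[f /andP[fG fuv]]|eG].
  by rewrite (joins_inj euv fuv).
by apply/existsP; exists e; rewrite eG.
Qed.

Lemma joins_or e u v a b : joins e u v ->
  joins e a b = ((u == a) && (v == b)) || ((u == b) && (v == a)).
Proof.
by case/orP => /andP[/eqP <- /eqP <-]; rewrite /joins // orbC [X in X || _]andbC [X in _ || X]andbC.
Qed.

Definition nbhd G v : {set 'I_n} := [set u | adj G v u].

Lemma vdegree_nbhd G v : vdegree G v = #|nbhd G v|.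
Proof.
rewrite /vdegree; pose h e := if src e == v then tgt e else src e.
have <- : h @: [set e in G | (src e == v) || (tgt e == v)] = nbhd G v.
  apply/setP => u; apply/imsetP/idP => [[e]|].
    rewrite !finset.inE => /andP[eG ev] ->; apply/existsP; exists e; rewrite eG.
    by rewrite /joins /h; case: (eqVneq (src e) v) ev => [->|_] /= ev;
      rewrite ?ev ?eqxx ?orbT.
  rewrite finset.inE => /existsP[e /andP[eG /orP[]/andP[/eqP E1 /eqP E2]]]; exists e;
    rewrite ?finset.inE ?eG /h E1 E2 ?eqxx ?orbT //.
  by case: eqP => // E; have := src_neq_tgt e; rewrite E1 E2 E eqxx.
rewrite card_in_imset; last first.
  move=> e f; rewrite !finset.inE => /andP[_ ev] /andP[_ fv] hef.
  have J e' : (src e' == v) || (tgt e' == v) -> joins e' v (h e').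
    by rewrite /joins /h; case: (eqVneq (src e') v) => [->|_] /= E;
      rewrite ?E ?eqxx ?orbT.
  by apply: (joins_inj (J e ev)); rewrite hef; exact: J.
by apply: eq_card => e; rewrite !finset.inE.
Qed.

Definition cut_arcs G A : {set 'I_n * 'I_n} :=
  [set p | [&& p.1 \in A, p.2 \notin A & adj G p.1 p.2]].

Lemma cut_size_arcs G A : cut_size G A (~: A) = #|cut_arcs G A|.
Proof.
rewrite /cut_size; pose h e := if src e \in A then (src e, tgt e) else (tgt e, src e).
have <- : h @: [set e in G | crossing A (~: A) e] = cut_arcs G A.
  apply/setP => -[u v]; rewrite finset.inE /=; apply/imsetP/idP => [[e]|].
    rewrite !finset.inE /crossing !finset.inE /h => /andP[eG].
    case: (boolP (src e \in A)) => sA /=.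
      rewrite orbF => tA [-> ->]; rewrite sA tA; apply/existsP; exists e.
      by rewrite eG /joins !eqxx.
    move=> tA [-> ->]; rewrite tA sA; apply/existsP; exists e.
    by rewrite eG /joins !eqxx orbT.
  move=> /and3P[uA vA /existsP[e /andP[eG /orP[]/andP[/eqP E1 /eqP E2]]]]; exists e;
    by rewrite ?finset.inE /crossing ?finset.inE ?eG /h E1 E2 ?uA ?vA ?(negbTE vA) ?orbT.
rewrite card_in_imset // => e f; rewrite !finset.inE /crossing !finset.inE.
move=> /andP[_ ce] /andP[_ cf] hef.
have J e' : joins e' (h e').1 (h e').2.
  by rewrite /joins /h; case: ifP => _ /=; rewrite !eqxx ?orbT.
by apply: (joins_inj (J e)); rewrite hef; exact: J.
Qed.

Lemma card_inner_arcs d G A : regular_graph d G ->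
  #|[set p : 'I_n * 'I_n | [&& p.1 \in A, p.2 \in A & adj G p.1 p.2]]| +
  #|cut_arcs G A| = d * #|A|.
Proof.
move=> /forallP reg.
have -> : d * #|A| = #|[set p : 'I_n * 'I_n | (p.1 \in A) && (p.2 \in nbhd G p.1)]|.
  rewrite -sum1dep_card -(pair_big_dep (mem A) (fun u v => v \in nbhd G u) (fun _ _ => 1)) /=.
  rewrite mulnC -sum_nat_const; apply: eq_bigr => u _.
  by rewrite sum1_card -vdegree_nbhd; apply/esym/eqP.
rewrite -[RHS](cardsID [set p : 'I_n * 'I_n | p.2 \in A]); congr (_ + _); apply: eq_card => -[u v];
  by rewrite !finset.inE /=; case: (u \in A); case: (v \in A); rewrite ?andbT ?andbF.
Qed.

(** A switching toggles the four edges of a set, so it is its own inverse. *)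
Definition sym_diff (X Y : graph n) : graph n := (X :\: Y) :|: (Y :\: X).

Lemma sym_diffK X Y : sym_diff (sym_diff X Y) Y = X.
Proof.
by apply/setP => e; rewrite !finset.inE; case: (e \in X); case: (e \in Y).
Qed.

(* A quadruple (a, c), (b, e) stands for the switching of the edges ab, ce
   and the non-edges ac, be. *)
Local Notation quad := (('I_n * 'I_n) * ('I_n * 'I_n))%type.
Implicit Types (q : quad).

Definition switched q : graph n := [set f |
  [|| joins f q.1.1 q.2.1, joins f q.1.2 q.2.2, joins f q.1.1 q.1.2
    | joins f q.2.1 q.2.2]].

Definition switchable A G q :=
  [&& [&& q.1.1 \in A, q.2.1 \in A, q.1.2 \notin A & q.2.2 \notin A],
      adj G q.1.1 q.2.1, adj G q.1.2 q.2.2, ~~ adj G q.1.1 q.1.2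
    & ~~ adj G q.2.1 q.2.2].

Definition switched_back A G q :=
  [&& q.1 \in cut_arcs G A, q.2 \in cut_arcs G A & q.1 != q.2].

Lemma nbhd_exchange (N N' : {set 'I_n}) b c : b \in N -> c \notin N ->
  (forall u, (u \in N') = (u \in N) (+) ((u == b) || (u == c))) -> #|N'| = #|N|.
Proof.
move=> bN cN H; have bc : b != c by apply: contraNneq cN => <-.
have -> : N' = c |: (N :\ b).
  apply/setP => u; rewrite H !finset.inE.
  case: (eqVneq u c) => [->|uc]; first by rewrite (negbTE cN) orbT.
  by rewrite orbF; case: (eqVneq u b) => [->|]; rewrite ?bN // addbF.
rewrite cardsU1 !finset.inE (negbTE cN) andbF /=.
by rewrite (cardsD1 b N) bN.
Qed.


Lemma adj_switch_pairs G q u v : u != v ->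
  adj (sym_diff G (switched q)) u v = adj G u v (+)
    [|| (u == q.1.1) && (v == q.2.1) || (u == q.2.1) && (v == q.1.1),
        (u == q.1.2) && (v == q.2.2) || (u == q.2.2) && (v == q.1.2),
        (u == q.1.1) && (v == q.1.2) || (u == q.1.2) && (v == q.1.1) |
        (u == q.2.1) && (v == q.2.2) || (u == q.2.2) && (v == q.2.1)].
Proof.
move=> uv; have [f fuv] := joins_ex uv.
rewrite !(adj_joins _ fuv) finset.in_setU !finset.in_setD.
rewrite (_ : (f \in switched q) = [|| joins f q.1.1 q.2.1, joins f q.1.2 q.2.2,
  joins f q.1.1 q.1.2 | joins f q.2.1 q.2.2]); last by rewrite finset.inE.
rewrite !(joins_or _ _ fuv).
by case: (f \in G); case: [|| _, _, _ | _].
Qed.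

Lemma switch_ok d A G q : regular_graph d G -> switchable A G q ->
  [/\ regular_graph d (sym_diff G (switched q)),
      #|cut_arcs (sym_diff G (switched q)) A| = #|cut_arcs G A|.+2 &
      switched_back A (sym_diff G (switched q)) q].
Proof.
case: q => [[a c] [b e]] reg /and5P[/= /and4P[aA bA cA eA] ab ce nac nbe].
set q := ((a, c), (b, e)); set G' := sym_diff _ _.
have ne u v : u \in A -> v \notin A -> (u == v = false) * (v == u = false).
  by move=> uA vA; split; apply: contraNF vA => /eqP; [move=> <-|move=> ->].
have anb : a == b = false by apply: contraTF ab => /eqP ->; rewrite adj_irrefl.
have cne : c == e = false by apply: contraTF ce => /eqP ->; rewrite adj_irrefl.
have [ac ca] := ne a c aA cA; have [ae ea] := ne a e aA eA.
have [bc cb] := ne b c bA cA; have [be eb] := ne b e bA eA.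
have bna : b == a = false by rewrite eq_sym. have enc : e == c = false by rewrite eq_sym.
pose EE := (anb, cne, ac, ca, ae, ea, bc, cb, be, eb, bna, enc).
have adjE u v : adj G' u v = adj G u v (+) ((u != v) &&
   [|| (u == a) && (v == b) || (u == b) && (v == a),
        (u == c) && (v == e) || (u == e) && (v == c),
        (u == a) && (v == c) || (u == c) && (v == a) |
        (u == b) && (v == e) || (u == e) && (v == b)]).
  have [<-|uv] := eqVneq u v; first by rewrite !adj_irrefl.
  by rewrite (adj_switch_pairs G q uv).
split.
- apply/forallP => v; have /forallP/(_ v)/eqP <- := reg; rewrite !vdegree_nbhd.
  apply/eqP.
  have [->|va] := eqVneq v a.
    apply: (@nbhd_exchange _ _ b c); rewrite ?finset.inE // => u.
    rewrite !finset.inE adjE.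
    have [->|_] := eqVneq u a; first by rewrite ?eqxx ?EE ?adj_irrefl /= ?addbF ?addFb.
    have [->|_] := eqVneq u b; first by rewrite ?eqxx ?EE ?adj_irrefl /= ?addbF ?addFb.
    have [->|_] := eqVneq u c; first by rewrite ?eqxx ?EE ?adj_irrefl /= ?addbF ?addFb.
    have [->|_] := eqVneq u e; first by rewrite ?eqxx ?EE ?adj_irrefl /= ?addbF ?addFb.
    by rewrite ?andbF /= ?addbF.
  have [->|vb] := eqVneq v b.
    apply: (@nbhd_exchange _ _ a e); rewrite ?finset.inE // 1?adj_sym // => u.
    rewrite !finset.inE adjE.
    have [->|_] := eqVneq u a; first by rewrite ?eqxx ?EE ?adj_irrefl /= ?addbF ?addFb.
    have [->|_] := eqVneq u b; first by rewrite ?eqxx ?EE ?adj_irrefl /= ?addbF ?addFb.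
    have [->|_] := eqVneq u c; first by rewrite ?eqxx ?EE ?adj_irrefl /= ?addbF ?addFb.
    have [->|_] := eqVneq u e; first by rewrite ?eqxx ?EE ?adj_irrefl /= ?addbF ?addFb.
    by rewrite ?andbF /= ?addbF.
  have [->|vc] := eqVneq v c.
    apply: (@nbhd_exchange _ _ e a); rewrite ?finset.inE // 1?adj_sym // => u.
    rewrite !finset.inE adjE.
    have [->|_] := eqVneq u a; first by rewrite ?eqxx ?EE ?adj_irrefl /= ?addbF ?addFb.
    have [->|_] := eqVneq u b; first by rewrite ?eqxx ?EE ?adj_irrefl /= ?addbF ?addFb.
    have [->|_] := eqVneq u c; first by rewrite ?eqxx ?EE ?adj_irrefl /= ?addbF ?addFb.
    have [->|_] := eqVneq u e; first by rewrite ?eqxx ?EE ?adj_irrefl /= ?addbF ?addFb.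
    by rewrite ?andbF /= ?addbF.
  have [->|ve] := eqVneq v e.
    apply: (@nbhd_exchange _ _ c b); rewrite ?finset.inE // 1?adj_sym // => u.
    rewrite !finset.inE adjE.
    have [->|_] := eqVneq u a; first by rewrite ?eqxx ?EE ?adj_irrefl /= ?addbF ?addFb.
    have [->|_] := eqVneq u b; first by rewrite ?eqxx ?EE ?adj_irrefl /= ?addbF ?addFb.
    have [->|_] := eqVneq u c; first by rewrite ?eqxx ?EE ?adj_irrefl /= ?addbF ?addFb.
    have [->|_] := eqVneq u e; first by rewrite ?eqxx ?EE ?adj_irrefl /= ?addbF ?addFb.
    by rewrite ?andbF /= ?addbF.
  apply: eq_card => u; rewrite !finset.inE adjE.
  by rewrite (negbTE va) (negbTE vb) (negbTE vc) (negbTE ve) /= andbF addbF.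
- have -> : cut_arcs G' A = (a, c) |: ((b, e) |: cut_arcs G A).
    apply/setP => -[u v]; rewrite !finset.inE /= !xpair_eqE adjE.
    have [uA|uA] /= := boolP (u \in A); last first.
      by rewrite (ne _ _ aA uA) (ne _ _ bA uA).
    have [vA|vA] /= := boolP (v \in A).
      by rewrite (ne _ _ vA cA) (ne _ _ vA eA) !andbF.
    have two x y : (u = x /\ v = y) \/ (u == x) && (v == y) = false.
      by case: (eqVneq u x) => ux; case: (eqVneq v y) => vy; rewrite ?andbF; auto.
    case: (two a c) => [[-> ->]|uv1].
      by rewrite !eqxx !EE (negbTE nac) /= ?orbT.
    case: (two b e) => [[-> ->]|uv2].
      by rewrite !eqxx !EE (negbTE nbe) /= ?orbT.
    rewrite uv1 uv2 (ne _ _ uA vA) (ne _ _ uA cA) (ne _ _ uA eA).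
    by rewrite (ne _ _ aA vA) (ne _ _ bA vA) !andbF /= addbF.
  rewrite !cardsU1 !finset.inE /= xpair_eqE EE /= (negbTE nac) (negbTE nbe) !andbF.
  by [].
- rewrite /switched_back !finset.inE /= aA bA cA eA !adjE xpair_eqE !EE !eqxx /=.
  by rewrite (negbTE nac) (negbTE nbe) ?orbT.
Qed.


Definition regular_cut d A j : {set graph n} :=
  [set G : graph n | regular_graph d G && (#|cut_arcs G A| == j)].

Lemma card_dep_pairs (T1 T2 : finType) (P : pred T1) (Q : T1 -> pred T2) :
  #|[set q : T1 * T2 | P q.1 && Q q.1 q.2]| = \sum_(x | P x) #|[set y | Q x y]|.
Proof.
rewrite -sum1dep_card -(pair_big_dep P Q (fun _ _ => 1)) /=.
by apply: eq_bigr => x _; rewrite sum1dep_card.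
Qed.

Lemma card_switched_back A G j : #|cut_arcs G A| = j ->
  #|[set q | switched_back A G q]| = j * j.-1.
Proof.
move=> <-; set S := cut_arcs G A.
rewrite (card_dep_pairs (fun x => x \in S) (fun x y => (y \in S) && (x != y))).
rewrite -sum_nat_const; apply: eq_bigr => x xS.
rewrite (cardsD1 x S) xS /=; apply: eq_card => y.
by rewrite [LHS]finset.inE [RHS]finset.inE finset.in_set1 andbC eq_sym.
Qed.

(** All pairs of an arc inside A and an arc outside A are switchable, except
    when one of the edges to be added is already present. Such an edge crosses
    the cut, and belongs to at most d ^ 2 of these pairs in each of its two
    roles. *)
Lemma card_switchable d A G j : regular_graph d G -> #|cut_arcs G A| = j ->
  (d * #|A| - j) * (d * #|~: A| - j) - 2 * (j * d ^ 2) <=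
  #|[set q | switchable A G q]|.
Proof.
move=> reg Sj.
pose inner (B : {set 'I_n}) := [set p : 'I_n * 'I_n | [&& p.1 \in B, p.2 \in B & adj G p.1 p.2]].
have cA : d * #|A| - j = #|inner A|.
  by rewrite -(card_inner_arcs A reg) Sj addnK.
have cB : d * #|~: A| - j = #|inner (~: A)|.
  rewrite -(card_inner_arcs (~: A) reg) -Sj -!cut_size_arcs.
  have -> : cut_size G (~: A) (~: ~: A) = cut_size G A (~: A).
    rewrite finset.setCK /cut_size; apply: eq_card => e.
    by rewrite !finset.inE /crossing orbC.
  by rewrite addnK.
rewrite cA cB -cardsX.
pose sh (q : quad) : quad := ((q.1.1, q.2.1), (q.1.2, q.2.2)).
pose bad1 := [set q : quad | (q.1 \in cut_arcs G A) &&
   ((q.2.1 \in nbhd G q.1.1) && (q.2.2 \in nbhd G q.1.2))].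
pose sw (q : quad) : quad := (q.2, q.1).
have b1 : #|bad1| = j * d ^ 2.
  rewrite (card_dep_pairs (fun x => x \in cut_arcs G A) (fun x y => (y.1 \in nbhd G x.1) && (y.2 \in nbhd G x.2))).
  rewrite -Sj -sum_nat_const; apply: eq_bigr => x _.
  have -> : [set y | (y.1 \in nbhd G x.1) && (y.2 \in nbhd G x.2)] =
      finset.setX (nbhd G x.1) (nbhd G x.2).
    by apply/setP => -[u v]; rewrite !finset.inE.
  have /forallP r := reg.
  by rewrite cardsX -!vdegree_nbhd (eqP (r _)) (eqP (r _)) mulnn.
have cov : finset.setX (inner A) (inner (~: A)) \subset
    sh @: [set q | switchable A G q] :|: (sh @: bad1 :|: (sh \o sw) @: bad1).
  apply/fintype.subsetP => -[[a b] [c e]]; rewrite !finset.inE /= => /andP[/and3P[aA bA ab] /and3P[cA' eA ce]].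
  have [ac|nac] := boolP (adj G a c).
    apply/orP; right; apply/orP; left; apply/imsetP; exists ((a, c), (b, e)) => //.
    by rewrite !finset.inE /= aA cA' ac ab ce.
  have [be|nbe] := boolP (adj G b e).
    apply/orP; right; apply/orP; right; apply/imsetP; exists ((b, e), (a, c)) => //.
    by rewrite !finset.inE /= bA eA be adj_sym ab adj_sym ce.
  apply/orP; left; apply/imsetP; exists ((a, c), (b, e)) => //.
  by rewrite finset.inE /switchable /= aA bA cA' eA ab ce nac nbe.
have := subset_leq_card cov.
have [u1 _] := leq_card_setU (sh @: [set q | switchable A G q]) (sh @: bad1 :|: (sh \o sw) @: bad1).
have [u2 _] := leq_card_setU (sh @: bad1) ((sh \o sw) @: bad1).
have i1 := leq_imset_card sh [set q | switchable A G q].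
have i2 : #|sh @: bad1| <= j * d ^ 2 by rewrite -b1; exact: leq_imset_card.
have i3 : #|(sh \o sw) @: bad1| <= j * d ^ 2 by rewrite -b1; exact: leq_imset_card.
move=> cov'; rewrite leq_subLR.
apply: (leq_trans cov'); apply: (leq_trans u1); rewrite addnC; apply: leq_add.
  by apply: (leq_trans u2); rewrite mul2n -addnn; exact: leq_add.
exact: i1.
Qed.

(** Double counting of the switchings. For perfect matchings of the half-edges
    the same relation is an equality without the error term 2 j d ^ 2. *)
Lemma switching d A j :
  #|regular_cut d A j| *
    ((d * #|A| - j) * (d * #|~: A| - j) - 2 * (j * d ^ 2)) <=
  #|regular_cut d A j.+2| * (j.+2 * j.+1).
Proof.
rewrite -!sum_nat_const.
apply: (@leq_trans (\sum_(G in regular_cut d A j) #|[set q | switchable A G q]|)).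
  apply: leq_sum => G; rewrite finset.inE => /andP[reg /eqP Sj].
  exact: card_switchable.
apply: (@leq_trans (\sum_(G in regular_cut d A j.+2) #|[set q | switched_back A G q]|)); last first.
  apply: leq_sum => G; rewrite finset.inE => /andP[reg /eqP Sj].
  by rewrite (card_switched_back Sj).
have E (X : {set graph n}) (P : graph n -> pred quad) :
    \sum_(G in X) #|[set q | P G q]| = \sum_q #|[set G in X | P G q]|.
  under eq_bigr do rewrite -sum1dep_card big_mkcond /=.
  rewrite exchange_big /=; apply: eq_bigr => q _.
  by rewrite -big_mkcondr /= sum1dep_card.
rewrite (E _ (fun G q => switchable A G q)) (E _ (fun G q => switched_back A G q)).
apply: leq_sum => q _.
have inj : injective (fun G => sym_diff G (switched q)).
  by apply: (can_inj (g := fun G => sym_diff G (switched q))) => G; exact: sym_diffK.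
apply: leq_trans (eq_leq (esym (card_imset _ inj))) _.
apply: subset_leq_card; apply/fintype.subsetP => H /imsetP[G HG ->].
have : (regular_graph d G && (#|cut_arcs G A| == j)) && switchable A G q.
  by move: HG; rewrite !finset.inE.
move=> /andP[/andP[reg /eqP Sj] sG].
have [reg' S' back] := switch_ok reg sG.
by rewrite finset.inE back andbT finset.inE reg' S' Sj eqxx.
Qed.

End Switching.

(** * Existence of regular graphs *)

Section Circulant.

Definition graph_of n (r : rel 'I_n) : graph n := [set e | r (src e) (tgt e)].

Lemma adj_graph_of n (r : rel 'I_n) : symmetric r -> forall u v, u != v ->
  adj (graph_of r) u v = r u v.
Proof.
move=> rs u v uv; have [e euv] := joins_ex uv.
rewrite (adj_joins _ euv) finset.inE.
by case/orP: euv => /andP[/eqP <- /eqP <-].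
Qed.

(** The circulant graph whose steps are the residues within d/2 of 0, together
    with n/2 when d is odd. *)
Lemma regular_graph_ex n d : (d < n)%N -> ~~ odd (n * d) ->
  exists G : graph n, regular_graph d G.
Proof.
case: n => [//|n] dn nd; pose h := d./2.
have dE : (d = odd d + h.*2)%N by rewrite odd_double_half.
have hn : (h.*2 < n.+1)%N by lia.
have half_n : odd d -> [/\ (n.+1./2.*2 = n.+1)%N, (h < n.+1./2)%N & (n.+1./2 < n.+1 - h)%N].
  move=> od; have en : ~~ odd n.+1 by move: nd; rewrite oddM od andbT.
  have E : (n.+1./2.*2 = n.+1)%N by rewrite -[RHS]odd_double_half (negbTE en).
  by rewrite od in dE; split => //; lia.
pose f (i : 'I_d) : 'I_n.+1 := inord
  (if (i < h)%N then i.+1 else if (i < h.*2)%N then n.+1 - (i - h).+1 else n.+1./2)%N.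
have fE (i : 'I_d) : nat_of_ord (f i) =
    (if (i < h)%N then i.+1 else if (i < h.*2)%N then n.+1 - (i - h).+1 else n.+1./2)%N.
  rewrite inordK //; have := ltn_ord i; case: (ltnP i h) => hi; first by lia.
  case: (ltnP i h.*2) => h2i; first by lia.
  move=> id; have od : odd d by lia.
  by have [? ? ?] := half_n od; lia.
have finj : injective f.
  move=> i j /(congr1 (@nat_of_ord _)); rewrite !fE => E; apply: ord_inj.
  have oi : (h.*2 <= i)%N -> odd d by move: (ltn_ord i); lia.
  have oj : (h.*2 <= j)%N -> odd d by move: (ltn_ord j); lia.
  have := ltn_ord i; have := ltn_ord j; move: E.
  case: (ltnP i h) => i1; case: (ltnP j h) => j1;
  case: (ltnP i h.*2) => i2; case: (ltnP j h.*2) => j2;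
  try (have [? ? ?] := half_n (oi i2)); try (have [? ? ?] := half_n (oj j2)); lia.
pose S := f @: [set: 'I_d].
have cS : #|S| = d by rewrite card_imset // cardsT card_ord.
have S0 : (0 : 'I_n.+1) \notin S.
  apply/imsetP => -[i _ /(congr1 (@nat_of_ord _))]; rewrite fE /=.
  have oi : (h.*2 <= i)%N -> odd d by move: (ltn_ord i); lia.
  have := ltn_ord i; case: (ltnP i h) => i1; case: (ltnP i h.*2) => i2;
  try (have [? ? ?] := half_n (oi i2)); lia.
have oppS (x : 'I_n.+1) : x \in S -> - x \in S.
  move=> /imsetP[i _ xi]; have xpos : (0 < x)%N.
    rewrite lt0n; apply: contraNneq S0 => x0; apply/imsetP; exists i => //.
    by rewrite -xi; apply: ord_inj.
  have oppE : nat_of_ord (- x) = (n.+1 - x)%N.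
    by rewrite /= modn_small //; have := ltn_ord x; lia.
  have xE := congr1 (@nat_of_ord _) xi; rewrite fE in xE.
  have oi : (h.*2 <= i)%N -> odd d by move: (ltn_ord i); lia.
  have [j jE] : exists j : 'I_d, nat_of_ord (f j) = (n.+1 - x)%N.
    case: (ltnP i h) xE => i1 xE.
      have jd : (i + h < d)%N by lia.
      exists (Ordinal jd); rewrite fE /=.
      by rewrite ifF ?ifT; lia.
    case: (ltnP i h.*2) xE => i2 xE.
      have jd : (i - h < d)%N by lia.
      exists (Ordinal jd); rewrite fE /=.
      by rewrite ifT; have := ltn_ord i; lia.
    by exists i; rewrite fE ifF ?ifF; lia.
  by apply/imsetP; exists j => //; apply: ord_inj; rewrite oppE jE.
pose r (u v : 'I_n.+1) := v - u \in S.
have rs : symmetric r.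
  have H u v : r u v -> r v u by rewrite /r => /oppS; rewrite opprB.
  by move=> u v; apply/idP/idP; exact: H.
exists (graph_of r); apply/forallP => v; rewrite vdegree_nbhd -[X in _ == X]cS.
rewrite -(card_imset S (addrI v)); apply/eqP/eq_card => u; rewrite finset.inE.
have [<-|vu] := eqVneq v u.
  rewrite adj_irrefl; apply/esym/imsetP => -[x xS /eqP].
  by rewrite -{1}[v]addr0 (inj_eq (addrI v)) => /eqP x0; move: S0; rewrite x0 xS.
rewrite adj_graph_of //; apply/idP/imsetP => [ru|[x xS ->]].
  by exists (u - v) => //; rewrite addrC subrK.
by rewrite /r addrC addKr.
Qed.

End Circulant.

(** * Expansion of random regular graphs *)

Section Expansion.
Local Open Scope nat_scope.
Context (n d : nat).
Implicit Types (G : graph n) (A B : {set 'I_n}).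

(** Leaving out at most 2 k vertices removes at most 2 k d edges from a cut. *)
Lemma expander_well_linked G K k : regular_graph d G -> k * (2 * d + 1) <= K ->
  (forall A, n <= 8 * #|A| -> n <= 8 * #|~: A| -> K < #|cut_arcs G A|) ->
  well_linked G k.
Proof.
move=> reg kK H A B AB nA nB nAB; rewrite ltnNge; apply/negP => le.
have BA : B \subset ~: A by rewrite -finset.setCS finset.setCK.
have := H A nA (leq_trans nB _); rewrite leq_mul2l subset_leq_card // => /(_ isT).
apply/negP; rewrite -leqNgt -cut_size_arcs.
pose S := ~: (A :|: B).
have cS : #|S| <= 2 * k.
  have := card_setC_ord (A :|: B); rewrite -/S.
  have AB0 : A :&: B = finset.set0.
    by apply/setP => x; rewrite !finset.inE; apply/negP => /andP[/(fintype.subsetP AB)]; rewrite finset.inE => /negP.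
  by have := finset.cardsUI A B; rewrite AB0 cards0; card_lia.
pose E3 := [set e in G | (src e \in S) || (tgt e \in S)].
have c3 : #|E3| <= d * #|S|.
  rewrite mulnC -sum_nat_const; apply: (@leq_trans (\sum_(v in S) vdegree G v)); last first.
    by apply: leq_sum => v _; have /forallP/(_ v)/eqP -> := reg.
  rewrite /E3 -sum1dep_card big_mkcondr /=.
  apply: (@leq_trans (\sum_(e in G) \sum_(v in S) ((src e == v) || (tgt e == v)))).
    apply: leq_sum => e _; case: ifP => // /orP[eS|eS].
      by rewrite (bigD1 (src e)) //= eqxx.
    by rewrite (bigD1 (tgt e)) //= eqxx orbT.
  rewrite exchange_big /=; apply: leq_sum => v _.
  rewrite /vdegree -sum1_card [leqRHS]big_mkcondr /=; apply: leq_sum => e _.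
  by case: (_ || _).
have sub : [set e in G | crossing A (~: A) e] \subset [set e in G | crossing A B e] :|: E3.
  apply/fintype.subsetP => e; rewrite !finset.inE /crossing !finset.inE => /andP[-> /=].
  by case: (src e \in A); case: (tgt e \in A); case: (src e \in B); case: (tgt e \in B).
apply: leq_trans (subset_leq_card sub) _.
have [u _] := leq_card_setU [set e in G | crossing A B e] E3.
apply: (leq_trans u); apply: leq_trans kK.
apply: (@leq_trans (k + d * (2 * k))); last by lia.
by apply: leq_add => //; apply: leq_trans c3 _; rewrite leq_mul2l cS orbT.
Qed.

(** Every edge inside A is counted in both directions. *)
Lemma even_inner_arcs G A :
  ~~ odd #|[set p : 'I_n * 'I_n | [&& p.1 \in A, p.2 \in A & adj G p.1 p.2]]|.
Proof.
set I := [set p | _]; pose sw (p : 'I_n * 'I_n) := (p.2, p.1).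
have swI : injective sw by move=> [a b] [c e] [-> ->].
pose I1 := I :&: [set p : 'I_n * 'I_n | p.1 < p.2].
have -> : I = I1 :|: sw @: I1.
  apply/setP => -[u v]; rewrite /I1 /I !finset.inE /=; apply/idP/idP.
    move=> /and3P[uA vA uv]; rewrite uA vA uv /=.
    case: (ltngtP u v) => //= [vu|/ord_inj E]; last by rewrite E adj_irrefl in uv.
    by apply/imsetP; exists (v, u) => //; rewrite !finset.inE /= vA uA adj_sym uv.
  case/orP => [/andP[]//|/imsetP[[a b]]].
  by rewrite !finset.inE /= => /andP[/and3P[aA bA ab] _] [-> ->]; rewrite bA aA adj_sym.
have -> : #|I1 :|: sw @: I1| = #|I1| + #|I1|.
  rewrite cardsU (card_imset _ swI) (_ : _ :&: _ = finset.set0) ?cards0 ?subn0 //.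
  apply/setP => -[u v]; rewrite !finset.inE /=; apply/negP => /andP[/andP[_ uv]].
  move=> /imsetP[[a b]]; rewrite !finset.inE /= => /andP[_ ab] [E1 E2].
  by move: uv; rewrite E1 E2 ltnNge ltnW.
by rewrite addnn odd_double.
Qed.

Lemma regular_cut_parity A j : regular_cut d A j != finset.set0 ->
  exists s t, s.*2 + j = d * #|A| /\ t.*2 + j = d * #|~: A|.
Proof.
move=> /set0Pn[G]; rewrite finset.inE => /andP[reg /eqP Sj].
have half m : ~~ odd m -> m./2.*2 = m by move=> om; rewrite -[RHS]odd_double_half (negbTE om).
pose inner (B : {set 'I_n}) :=
  #|[set p : 'I_n * 'I_n | [&& p.1 \in B, p.2 \in B & adj G p.1 p.2]]|.
have h1 : inner A + #|cut_arcs G A| = d * #|A| by exact: card_inner_arcs.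
have h2 : inner (~: A) + #|cut_arcs G (~: A)| = d * #|~: A|.
  exact: card_inner_arcs.
have cE : #|cut_arcs G (~: A)| = #|cut_arcs G A|.
  rewrite -!cut_size_arcs finset.setCK /cut_size; apply: eq_card => e.
  by rewrite !finset.inE /crossing orbC.
rewrite cE Sj in h2; rewrite Sj in h1.
exists (inner A)./2, (inner (~: A))./2.
by rewrite !half ?even_inner_arcs.
Qed.

Lemma regular_cut_le A j :
  #|regular_cut d A j| <= #|[set G : graph n | regular_graph d G]|.
Proof.
by apply: subset_leq_card; apply/fintype.subsetP => G; rewrite !finset.inE => /andP[].
Qed.

Lemma split_count_gt0 s t j : 0 < split_count s t j.
Proof. by rewrite /split_count !muln_gt0 expn_gt0 !bin_gt0 leq_addl leq_addr. Qed.

(** Let i maximise the count of split pairs, and let j = j0 + 2 i. The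
    last increase, from i - 1 to i, shows that the numerator of the ratio of
    consecutive counts is there at least (j - 1) j, with j > n / 16, and it is
    larger at smaller indices. Hence the error term of a switching, which is
    linear in j, is a small part of it. *)
Lemma split_count_peak s0 t0 j0 c : 8 < n -> j0 <= 1 ->
  3 * n <= 8 * (s0.*2 + j0) -> 3 * n <= 8 * (t0.*2 + j0) -> 16 * c.+1 <= n ->
  exists i, [/\ i <= minn s0 t0, n < 16 * (j0 + i.*2),
    forall i', i' <= minn s0 t0 ->
      split_count (s0 - i') (t0 - i') (j0 + i'.*2) <=
      split_count (s0 - i) (t0 - i) (j0 + i.*2) &
    forall i', i' < i -> c * (j0 + i'.*2) <=
      (s0 - i').*2 * (t0 - i').*2 ].
Proof.
move=> n8 j01 s0n t0n cn; set M := minn s0 t0.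
pose T i := split_count (s0 - i) (t0 - i) (j0 + i.*2).
case: (@arg_maxnP 'I_M.+1 ord0 predT (fun i => T i) isT) => -[i iM] _ imax.
have max i' : i' <= M -> T i' <= T i by move=> i'M; exact: (imax (Ordinal (i'M : i' < M.+1))).
have step i' : i' < M -> T i' * ((s0 - i').*2 * (t0 - i').*2) =
    T i'.+1 * ((j0 + i'.*2).+1 * (j0 + i'.*2).+2).
  rewrite /M leq_min => /andP[is0 it0]; rewrite /T.
  rewrite (_ : s0 - i' = (s0 - i'.+1).+1); last lia.
  rewrite (_ : t0 - i' = (t0 - i'.+1).+1); last lia.
  by rewrite split_count_step doubleS !addnS.
have peak : n < 16 * (j0 + i.*2).
  rewrite ltnNge; apply/negP => le.
  have [iltM|] := ltnP i M; last by rewrite /M /minn; case: ifP; lia.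
  have : (s0 - i).*2 * (t0 - i).*2 <= (j0 + i.*2).+1 * (j0 + i.*2).+2.
    rewrite -(leq_pmul2l (split_count_gt0 (s0 - i) (t0 - i) (j0 + i.*2))).
    by rewrite -/(T i) step // leq_mul2r max ?orbT.
  by apply/negP; rewrite -ltnNge; apply: ltn_mul; lia.
exists i; split => //.
case: i iM imax max peak => [|i] iM imax max peak i'; first by [].
rewrite ltnS => i'i.
have iltM : i < M by [].
have : (j0 + i.*2).+1 * (j0 + i.*2).+2 <= (s0 - i).*2 * (t0 - i).*2.
  rewrite -(leq_pmul2l (split_count_gt0 (s0 - i) (t0 - i) (j0 + i.*2))).
  by rewrite -/(T i) step // leq_mul2r max ?orbT // ltnW.
move=> le; apply: (@leq_trans ((s0 - i).*2 * (t0 - i).*2)); last first.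
  by apply: leq_mul; rewrite leq_double leq_sub2l.
by apply: leq_trans le; apply: leq_mul; lia.
Qed.

End Expansion.

Section RegularBound.
Context (R : realType).

(** Each step multiplies T by q / p, and N by at least (1 - eps) q / p. *)
Lemma ratio_chain (N T p q : nat -> R) (eps : R) i k :
  0 <= eps <= 1 -> (forall i, 0 <= T i) -> (forall i, 0 < p i) -> (forall i, 0 <= q i) ->
  (forall i', (i <= i' < i + k)%N -> N i' * (q i' * (1 - eps)) <= N i'.+1 * p i') ->
  (forall i', (i <= i' < i + k)%N -> T i' * q i' = T i'.+1 * p i') ->
  N i * T (i + k)%N * (1 - eps) ^+ k <= N (i + k)%N * T i.
Proof.
move=> /andP[e0 e1] T0 p0 q0; elim: k => [|k IH] HN HT.
  by rewrite addn0 expr0 mulr1.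
have lt : (i <= i + k < i + k.+1)%N by lia.
rewrite -(ler_pM2r (p0 (i + k)%N)) addnS.
have -> : N i * T (i + k).+1 * (1 - eps) ^+ k.+1 * p (i + k)%N =
    N i * T (i + k)%N * (1 - eps) ^+ k * (q (i + k)%N * (1 - eps)).
  transitivity (N i * (T (i + k).+1 * p (i + k)%N) * ((1 - eps) * (1 - eps) ^+ k)).
    by rewrite exprS; ring.
  by rewrite -HT //; ring.
apply: (@le_trans _ _ (N (i + k)%N * T i * (q (i + k)%N * (1 - eps)))).
  apply: ler_wpM2r; first by rewrite mulr_ge0 // subr_ge0.
  by apply: IH => i' ii'; [apply: HN|apply: HT]; lia.
by rewrite mulrAC [leRHS]mulrAC; apply: ler_wpM2r => //; exact: HN.
Qed.

Lemma natr_subn_ge (a b : nat) : a%:R - b%:R <= (a - b)%N%:R :> R.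
Proof.
have [ab|/ltnW ba] := leqP b a; first by rewrite natrB.
by rewrite (eqP ba) subr_le0 ler_nat.
Qed.

(** The switchings are chained from j up to the value that maximises the count
    of split pairs; the latter count is at least the average of all of them,
    and at most all regular graphs have this value. *)
Lemma regular_cut_chain n d (A : {set 'I_n}) j : (3 <= d)%N -> (8 < n)%N ->
  (16 * (400 * d ^ 3).+1 <= n)%N -> (n <= 8 * #|A|)%N -> (n <= 8 * #|~: A|)%N ->
  (16 * j <= n)%N -> regular_cut d A j != finset.set0 ->
  exists s t, [/\ (s.*2 + j = d * #|A|)%N, (t.*2 + j = d * #|~: A|)%N &
    #|regular_cut d A j|%:R * 'C(d * n, d * #|A|)%:R * (1 - (200 * d)%:R^-1) ^+ (s + t + j)
    <= (s + t + j).+1%:R * #|[set G : graph n | regular_graph d G]|%:R *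
       (split_count s t j)%:R :> R].
Proof.
move=> d3 n8 nbig nA nB jn /regular_cut_parity[s [t [sj tj]]].
exists s, t; split => //.
pose j0 : nat := odd j; pose i1 := j./2.
have jE : j = (j0 + i1.*2)%N by rewrite odd_double_half.
pose s0 := (s + i1)%N; pose t0 := (t + i1)%N.
have s0E : (s0.*2 + j0 = d * #|A|)%N by rewrite -sj jE /s0; lia.
have t0E : (t0.*2 + j0 = d * #|~: A|)%N by rewrite -tj jE /t0; lia.
have j01 : (j0 <= 1)%N by rewrite /j0; case: odd.
have h1 : (3 * n <= 8 * (s0.*2 + j0))%N by rewrite s0E; nia.
have h2 : (3 * n <= 8 * (t0.*2 + j0))%N by rewrite t0E; nia.
have [I [IM nI Imax Ic]] := split_count_peak n8 j01 h1 h2 nbig.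
have i1I : (i1 < I)%N by lia.
have /andP[Is It] : (I <= s0)%N && (I <= t0)%N by rewrite -leq_min.
pose N i : R := #|regular_cut d A (j0 + i.*2)%N|%:R.
pose T i : R := (split_count (s0 - i) (t0 - i) (j0 + i.*2))%:R.
pose p i : R := ((j0 + i.*2).+2 * (j0 + i.*2).+1)%N%:R.
pose q i : R := ((s0 - i).*2 * (t0 - i).*2)%N%:R.
pose eps : R := (200 * d)%:R^-1.
have d200 : 1 <= (200 * d)%:R :> R by rewrite ler1n; lia.
have e01 : 0 <= eps <= 1.
  by rewrite invr_ge0 ler0n /= invf_le1 // (lt_le_trans ltr01).
have HN i' : (i1 <= i' < i1 + (I - i1))%N -> N i' * (q i' * (1 - eps)) <= N i'.+1 * p i'.
  rewrite subnKC; last exact: ltnW.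
  move=> /andP[_ i'I].
  have := switching d A (j0 + i'.*2); rewrite -(ler_nat R) !natrM.
  rewrite -s0E -t0E (_ : s0.*2 + j0 - (j0 + i'.*2) = (s0 - i').*2)%N; last lia.
  rewrite (_ : t0.*2 + j0 - (j0 + i'.*2) = (t0 - i').*2)%N; last lia.
  rewrite /N /p doubleS !addnS natrM => H; apply: le_trans H.
  rewrite ler_wpM2l //; apply: le_trans (natr_subn_ge _ _).
  rewrite mulrBr mulr1 lerB // /eps ler_pdivlMr; last exact: lt_le_trans ltr01 d200.
  rewrite -natrM ler_nat; apply: leq_trans (Ic _ i'I); apply: eq_leq.
  by rewrite !expnS expn0; ring.
have HT i' : (i1 <= i' < i1 + (I - i1))%N -> T i' * q i' = T i'.+1 * p i'.
  rewrite subnKC; last exact: ltnW.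
  move=> /andP[_ i'I]; rewrite /T /q /p -!natrM; congr (_%:R).
  rewrite (_ : s0 - i' = (s0 - i'.+1).+1)%N; last lia.
  rewrite (_ : t0 - i' = (t0 - i'.+1).+1)%N; last lia.
  by rewrite split_count_step doubleS !addnS [(_.+1 * _.+2)%N]mulnC.
have := @ratio_chain N T p q eps i1 (I - i1) e01.
have T0 i : 0 <= T i by rewrite /T ler0n.
have p0 i : 0 < p i by rewrite /p ltr0n.
have q0 i : 0 <= q i by rewrite /q ler0n.
move=> /(_ T0 p0 q0 HN HT); rewrite subnKC; last exact: ltnW.
have Ti1 : T i1 = (split_count s t j)%:R.
  by rewrite /T -jE /s0 /t0 !addnK.
rewrite Ti1 {1}/N -jE => chain.
have bin : ('C(d * n, d * #|A|) <= (s + t + j).+1 * split_count (s0 - I) (t0 - I) (j0 + I.*2))%N.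
  have -> : (d * n = (s + t + j).*2)%N.
    by have := card_setC_ord A => cA; rewrite -[n in LHS]cA mulnDr -sj -tj; lia.
  apply: bin_double_le => s' t' j' e1 e2.
  have j'0 : (odd j' = odd j).
    have : odd (s'.*2 + j') = odd (s.*2 + j) by rewrite e2 sj.
    by rewrite !oddD !odd_double.
  have j'E : j' = (j0 + j'./2.*2)%N by rewrite /j0 -j'0 odd_double_half.
  have := Imax j'./2; rewrite -j'E.
  rewrite (_ : s0 - j'./2 = s')%N; last by rewrite /s0; lia.
  rewrite (_ : t0 - j'./2 = t')%N; last by rewrite /t0; lia.
  apply; rewrite leq_min; apply/andP; split; rewrite /s0 /t0; lia.
set NN := #|regular_cut d A j|%:R in chain *.
have N0 : 0 <= NN by rewrite ler0n.
have e1 : 0 <= 1 - eps by rewrite subr_ge0; case/andP: e01.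
have e2 : 1 - eps <= 1 by rewrite gerBl; case/andP: e01.
apply: (@le_trans _ _ (NN * ((s + t + j).+1%:R * T I) * (1 - eps) ^+ (I - i1))).
  apply: ler_pM; rewrite ?mulr_ge0 ?exprn_ge0 ?ler0n //.
    by rewrite ler_wpM2l // -natrM ler_nat.
  by rewrite ler_wiXn2l //; lia.
rewrite (_ : NN * (_ * T I) * _ = (s + t + j).+1%:R * (NN * T I * (1 - eps) ^+ (I - i1))); last ring.
rewrite -[leRHS]mulrA ler_wpM2l ?ler0n //; apply: (le_trans chain).
by rewrite ler_wpM2r ?ler0n // ler_nat regular_cut_le.
Qed.

End RegularBound.

Section RegularLimit.
Context (R : realType).

Lemma expR_half_le2 : expR (2^-1) <= 2 :> R.
Proof.
have := expR_ge1Dx (- 2^-1 : R); rewrite expRN => h.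
have e0 := expR_gt0 (2^-1 : R).
rewrite -(ler_pV2 (x := 2)) ?inE ?unitfE ?gt_eqF ?ltr0n ?expR_gt0 //; first lra.
Qed.

Lemma exp2_ge_expR w : expR (w%:R / 2) <= 2 ^+ w :> R.
Proof.
rewrite expRM_natl; apply: lerXn2r; rewrite ?nnegrE ?expR_ge0 //.
exact: expR_half_le2.
Qed.

Lemma onem_ge_expR (x : R) : 0 <= x <= 2^-1 -> expR (- (2 * x)) <= 1 - x.
Proof.
move=> /andP[x0 x1]; have := expR_ge1Dx (2 * x); rewrite expRN => h.
have e0 : 0 < 1 + 2 * x by lra.
apply: (@le_trans _ _ (1 + 2 * x)^-1).
  by rewrite lef_pV2 ?posrE ?expR_gt0.
by rewrite -[leLHS]mul1r ler_pdivrMr //; nra.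
Qed.

Lemma nat_le_expR m : m%:R <= expR m%:R :> R.
Proof. by apply: le_trans (expR_ge1Dx _); rewrite lerDr. Qed.

Lemma half_bound (n k : nat) : (n <= 8 * k)%N -> (n <= 16 * k./2 + 8)%N.
Proof. by have := odd_double_half k; case: (odd k) => /=; lia. Qed.

(** The constants: 200 d makes each of the three error factors, from the
    switchings, from Z ^ j and from (1 + 2 / Z) ^ m with Z = 200 d, at most
    e ^ (n / 200), against a gain 2 ^ (n / 16 - 1 / 2) >= e ^ (n / 32 - 1 / 4). *)
Lemma regular_cut_bound n d (A : {set 'I_n}) j : (3 <= d)%N -> (8 < n)%N ->
  (16 * (400 * d ^ 3).+1 <= n)%N -> (n <= 8 * #|A|)%N -> (n <= 8 * #|~: A|)%N ->
  (200 * (200 * d) * j <= n)%N ->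
  #|regular_cut d A j|%:R * 'C(n, #|A|)%:R <=
  #|[set G : graph n | regular_graph d G]|%:R * (d * n).+1%:R *
    expR (1 - n%:R / 64) :> R.
Proof.
move=> d3 n8 nbig nA nB jn.
have d0 : d%:R != 0 :> R by rewrite pnatr_eq0 -lt0n (leq_trans _ d3).
set Ntot := #|[set G : graph n | _]|%:R.
have Ntot0 : 0 <= Ntot by rewrite ler0n.
have [->|ne] := eqVneq (regular_cut d A j) finset.set0.
  by rewrite cards0 mul0r !mulr_ge0 ?ler0n ?expR_ge0.
have jn' : (16 * j <= n)%N by apply: leq_trans jn; rewrite leq_mul2r; nia.
have [s [t [sj tj chain]]] := regular_cut_chain R d3 n8 nbig nA nB jn' ne.
move: chain; rewrite -/Ntot; set m := (s + t + j)%N; set NN := #|_|%:R.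
set eps := (200 * d)%:R^-1 => chain.
have cA := card_setC_ord A.
have m2 : (m.*2 = d * n)%N by rewrite -[n in RHS]cA mulnDr -sj -tj /m; lia.
set w := (minn #|A| #|~: A|)./2.
set T : R := (split_count s t j)%:R in chain.
set CC : R := 'C(d * n, d * #|A|)%:R in chain.
set C1 : R := 'C(n, #|A|)%:R; set Z : R := (200 * d)%:R.
set M : R := m.+1%:R in chain; set Cm : R := 'C(m, j)%:R.
have gain : T * C1 * 2 ^+ w <= 2 ^+ j * Cm * CC.
  rewrite -!natrX -!natrM ler_nat.
  exact: split_count_gain d3 cA sj tj.
have zbound : 2 ^+ j * Cm * Z ^+ m <= Z ^+ j * (Z + 2) ^+ m.
  rewrite -natrD -!natrX -!natrM ler_nat; exact: bin_exp2_le.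
have CC0 : 0 < CC.
  by rewrite ltr0n bin_gt0 leq_mul2l -[n in (_ <= n)%N]cA leq_addr orbT.
have Z1 : 600 <= Z by rewrite ler_nat; lia.
have Z0 : 0 < Z by lra.
have epsE : eps = Z^-1 by [].
have T0 : 0 <= T by rewrite ler0n.
have NN0 : 0 <= NN by rewrite ler0n.
have M0 : 0 <= M by rewrite ler0n.
have C10 : 0 <= C1 by rewrite ler0n.
have Cm0 : 0 <= Cm by rewrite ler0n.
have eps0 : 0 <= eps <= 2^-1.
  by rewrite epsE invr_ge0 (ltW Z0) /= lef_pV2 ?posrE //; lra.
have key : NN * C1 * ((1 - eps) ^+ m * 2 ^+ w * Z ^+ m) <=
    M * Ntot * (Z ^+ j * (Z + 2) ^+ m).
  rewrite -(ler_pM2r CC0).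
  have h1 : NN * CC * (1 - eps) ^+ m * (C1 * 2 ^+ w * Z ^+ m) <=
      M * Ntot * T * (C1 * 2 ^+ w * Z ^+ m).
    by apply: ler_wpM2r => //; rewrite !mulr_ge0 ?exprn_ge0 // ltW.
  have h2 : M * Ntot * Z ^+ m * (T * C1 * 2 ^+ w) <=
      M * Ntot * Z ^+ m * (2 ^+ j * Cm * CC).
    by apply: ler_wpM2l => //; rewrite !mulr_ge0 ?exprn_ge0 // ltW.
  have h3 : M * Ntot * CC * (2 ^+ j * Cm * Z ^+ m) <=
      M * Ntot * CC * (Z ^+ j * (Z + 2) ^+ m).
    by apply: ler_wpM2l => //; rewrite !mulr_ge0 ?exprn_ge0 // ltW.
  have -> : NN * C1 * ((1 - eps) ^+ m * 2 ^+ w * Z ^+ m) * CC =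
    NN * CC * (1 - eps) ^+ m * (C1 * 2 ^+ w * Z ^+ m) by ring.
  apply: (le_trans h1).
  have -> : M * Ntot * T * (C1 * 2 ^+ w * Z ^+ m) =
    M * Ntot * Z ^+ m * (T * C1 * 2 ^+ w) by ring.
  apply: (le_trans h2).
  have -> : M * Ntot * Z ^+ m * (2 ^+ j * Cm * CC) =
    M * Ntot * CC * (2 ^+ j * Cm * Z ^+ m) by ring.
  by apply: (le_trans h3); rewrite mulrAC.
have lowE : expR (- (m%:R * (2 * eps))) * expR (w%:R / 2) * Z ^+ m <=
    (1 - eps) ^+ m * 2 ^+ w * Z ^+ m.
  rewrite ler_wpM2r ?exprn_ge0 ?(ltW Z0) //; apply: ler_pM; rewrite ?expR_ge0 //.
    rewrite -mulrN expRM_natl; apply: lerXn2r; rewrite ?nnegrE ?expR_ge0 //.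
      by rewrite subr_ge0; lra.
    exact: onem_ge_expR.
  exact: exp2_ge_expR.
have upE : Z ^+ j * (Z + 2) ^+ m <= expR (j%:R * Z) * expR (m%:R * (2 * eps)) * Z ^+ m.
  rewrite -mulrA; apply: ler_pM; rewrite ?exprn_ge0 ?(ltW Z0) //; first lra.
    rewrite expRM_natl; apply: lerXn2r; rewrite ?nnegrE ?expR_ge0 ?(ltW Z0) //.
    exact: nat_le_expR.
  have -> : Z + 2 = (1 + 2 * eps) * Z by rewrite epsE; field; lra.
  rewrite exprMn ler_wpM2r ?exprn_ge0 ?(ltW Z0) //.
  rewrite expRM_natl; apply: lerXn2r; rewrite ?nnegrE ?expR_ge0 //; first lra.
  exact: expR_ge1Dx.
have all : NN * C1 * (expR (- (m%:R * (2 * eps))) * expR (w%:R / 2)) <=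
    M * Ntot * (expR (j%:R * Z) * expR (m%:R * (2 * eps))).
  have Zm : 0 < Z ^+ m by rewrite exprn_gt0.
  rewrite -(ler_pM2r Zm) -[leLHS]mulrA -[leRHS]mulrA.
  apply: le_trans (_ : _ <= M * Ntot * (Z ^+ j * (Z + 2) ^+ m)) _.
    by apply: le_trans key; apply: ler_wpM2l => //; rewrite mulr_ge0.
  by apply: ler_wpM2l => //; rewrite mulr_ge0.
rewrite -!expRD in all.
set x := - _ + _ in all; set y := _ + _ in all.
have : NN * C1 <= M * Ntot * expR (y - x).
  rewrite expRD expRN mulrA ler_pdivlMr ?expR_gt0 //.
move=> /le_trans; apply; rewrite [M * Ntot]mulrC; apply: ler_pM;
  rewrite ?mulr_ge0 ?expR_ge0 //.
  by rewrite ler_wpM2l // ler_nat ltnS -m2 -addnn leq_addr.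
rewrite ler_expR /x /y.
have b1 : j%:R * Z <= n%:R / 200.
  by rewrite ler_pdivlMr // -!natrM ler_nat; apply: leq_trans jn; apply: eq_leq; ring.
have b2 : m%:R * (2 * eps) = n%:R / 200.
  have : m%:R * 2 = d%:R * n%:R :> R by rewrite -!natrM -m2 -mul2n mulnC.
  move=> E; rewrite mulrA E epsE /Z natrM; field.
  exact: d0.
have b3 : n%:R / 16 - 2^-1 <= w%:R :> R.
  have : (n <= 16 * w + 8)%N.
    by apply: half_bound; rewrite /minn; case: ifP.
  by rewrite -(ler_nat R) natrD natrM; lra.
have nR0 : 0 <= n%:R :> R by [].
by rewrite b2; clear - b1 b3 nR0; lra.
Qed.

End RegularLimit.

Section RegularProbability.
Context (R : realType).

(** Sets of each of the n + 1 possible sizes contribute 1 in total. *)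
Lemma sum_inv_bin n : \sum_(A : {set 'I_n}) ('C(n, #|A|)%:R)^-1 = n.+1%:R :> R.
Proof.
have lt (A : {set 'I_n}) : (#|A| < n.+1)%N by have := card_setC_ord A; card_lia.
rewrite (partition_big (fun A : {set 'I_n} => Ordinal (lt A)) predT) //=.
rewrite (eq_bigr (fun=> 1)) => [|x _]; last first.
  rewrite (eq_bigr (fun=> 'C(n, x)%:R^-1)) => [|A /eqP <- //].
  have := card_draws 'I_n x; rewrite card_ord => cd.
  rewrite sumr_const; have -> : #|[pred A : {set 'I_n} | Ordinal (lt A) == x]| = 'C(n, x).
    rewrite -cd -cardsE; apply: eq_card => A; rewrite !finset.inE.
    by rewrite -val_eqE.
  rewrite -[LHS]mulr_natl mulfV // pnatr_eq0 -lt0n bin_gt0 -ltnS.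
  exact: ltn_ord.
by rewrite sumr_const card_ord.
Qed.

Lemma few_nonexpanders n d J : (3 <= d)%N -> (8 < n)%N ->
  (16 * (400 * d ^ 3).+1 <= n)%N -> (200 * (200 * d) * J <= n)%N ->
  #|[set G : graph n | regular_graph d G &&
     [exists A : {set 'I_n}, [&& n <= 8 * #|A|, n <= 8 * #|~: A| &
        #|cut_arcs G A| <= J]]]|%N%:R <=
  #|[set G : graph n | regular_graph d G]|%:R * (d * n).+1%:R *
    expR (1 - n%:R / 64) * J.+1%:R * n.+1%:R :> R.
Proof.
move=> d3 n8 nbig nJ; set Bad := [set G | _ & _]; set B : R := _ * _ * expR _.
have B0 : 0 <= B by rewrite !mulr_ge0 ?expR_ge0.
pose large (A : {set 'I_n}) := (n <= 8 * #|A|)%N && (n <= 8 * #|~: A|)%N.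
apply: (@le_trans _ _ (\sum_(A : {set 'I_n} | large A) \sum_(j < J.+1) #|regular_cut d A j|%:R)).
  have : (#|Bad| <= \sum_(A : {set 'I_n} | large A) \sum_(j < J.+1) #|regular_cut d A j|)%N.
    pose U : {set graph n} := \bigcup_(A | large A) \bigcup_(j < J.+1) regular_cut d A j.
    apply: (@leq_trans #|U|).
      apply: subset_leq_card; apply/fintype.subsetP => G; rewrite finset.inE.
      move=> /andP[reg /existsP[A /and3P[nA nB cJ]]].
      apply/finset.bigcupP; exists A; first by rewrite /large nA nB.
      apply/finset.bigcupP; exists (Ordinal (cJ : #|cut_arcs G A| < J.+1)%N) => //.
      by rewrite finset.inE reg /=.
    have lecup (I : finType) (P : pred I) (F : I -> {set graph n}) :
        (#|\bigcup_(i | P i) F i| <= \sum_(i | P i) #|F i|)%N.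
      elim/big_rec2: _ => [|i m X _ le]; first by rewrite cards0.
      by apply: leq_trans (leq_card_setU _ _) _; rewrite leq_add2l.
    by apply: leq_trans (lecup _ _ _) _; apply: leq_sum => A _; exact: lecup.
  by rewrite -(ler_nat R) natr_sum; under eq_bigr do rewrite natr_sum.
apply: (@le_trans _ _ (\sum_(A : {set 'I_n} | large A) B * J.+1%:R * ('C(n, #|A|)%:R)^-1)).
  apply: ler_sum => A /andP[nA nB].
  have C0 : 0 < 'C(n, #|A|)%:R :> R.
    by rewrite ltr0n bin_gt0; have := card_setC_ord A; card_lia.
  rewrite ler_pdivlMr // mulr_suml.
  have -> : B * J.+1%:R = \sum_(j < J.+1) B by rewrite sumr_const card_ord mulr_natr.
  apply: ler_sum => j _; apply: regular_cut_bound => //.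
  by apply: leq_trans nJ; rewrite leq_mul2l -ltnS ltn_ord orbT.
rewrite -mulr_sumr; apply: ler_wpM2l; first by rewrite mulr_ge0.
rewrite -sum_inv_bin [leRHS](bigID large) /= lerDl.
by apply: sumr_ge0 => A _; rewrite invr_ge0.
Qed.

Lemma cube_exp_bound n : n.+1%:R ^+ 3 * expR (- (n%:R / 64)) <= 256 ^+ 4 * harmonic n :> R.
Proof.
have e0 := expR_gt0 (n%:R / 256 : R).
set c : R := 256.
have h : n.+1%:R <= c * expR (n%:R / 256).
  by have := expR_ge1Dx (n%:R / 256 : R); rewrite -(natr1 n) /c; lra.
have c0 : 0 < c by rewrite /c ltr0n.
move: c c0 h => c c0 h.
rewrite expRN /harmonic /= ler_pdivrMr ?expR_gt0 // mulrAC ler_pdivlMr ?ltr0n //.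
have -> : n%:R / 64 = 4%:R * (n%:R / 256) :> R by field.
rewrite expRM_natl -exprSr -exprMn; by apply: lerXn2r; rewrite ?nnegrE // mulr_ge0 ?ltW.
Qed.

Lemma prob_regular_ge n d (A : set (graph n)) k : (3 <= d)%N -> (8 < n)%N ->
  (16 * (400 * d ^ 3).+1 <= n)%N -> (d < n)%N -> ~~ odd (n * d) ->
  (k * (2 * d + 1) <= n %/ (200 * (200 * d)))%N ->
  (forall G : graph n, well_linked G k -> A G) ->
  1 - d.+1%:R * expR 1 * 256 ^+ 4 * harmonic n <= prob_regular R d A <= 1.
Proof.
move=> d3 n8 nbig dn nd kJ HAn; set J := (n %/ _)%N in kJ.
set v := d.+1%:R * _ * _ * _.
set Ntot := #|[set G : graph n | regular_graph d G]|.
have Ntot0 : (0 < Ntot)%N.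
  have [G regG] := regular_graph_ex dn nd.
  by apply/card_gt0P; exists G; rewrite finset.inE.
have NtotR : 0 < Ntot%:R :> R by rewrite ltr0n.
have few : #|[set G : graph n | regular_graph d G && (G \notin A)]|%N%:R <= v * Ntot%:R.
  pose Bad := [set G : graph n | regular_graph d G &&
     [exists B : {set 'I_n}, [&& n <= 8 * #|B|, n <= 8 * #|~: B| &
        #|cut_arcs G B| <= J]]]%N.
  apply: (@le_trans _ _ #|Bad|%:R).
    rewrite ler_nat; apply: subset_leq_card; apply/fintype.subsetP => G.
    rewrite !finset.inE => /andP[reg GA]; rewrite reg /=.
    apply: contraR GA => nex; apply/mem_set/HAn.
    apply: (expander_well_linked reg kJ) => B nB nB'.
    rewrite ltnNge; apply: contra nex => cJ; apply/existsP; exists B.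
    by rewrite nB nB' cJ.
  have nJ : (200 * (200 * d) * J <= n)%N by rewrite mulnC leq_trunc_div.
  apply: (le_trans (few_nonexpanders d3 n8 nbig nJ)); rewrite -/Ntot.
  have Jn : J.+1%:R <= n.+1%:R :> R by rewrite ler_nat ltnS leq_div.
  have dn1 : (d * n).+1%:R <= d.+1%:R * n.+1%:R :> R by rewrite -natrM ler_nat; nia.
  apply: (@le_trans _ _ ((Ntot%:R * d.+1%:R * expR 1 * (n.+1%:R ^+ 3 * expR (- (n%:R / 64)))) : R)).
    have -> : Ntot%:R * d.+1%:R * expR 1 * (n.+1%:R ^+ 3 * expR (- (n%:R / 64))) =
      Ntot%:R * (d.+1%:R * n.+1%:R) * (expR 1 * expR (- (n%:R / 64))) * n.+1%:R * n.+1%:R :> R by ring.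
    rewrite -expRD; apply: ler_wpM2r => //; apply: ler_pM => //.
    by apply: ler_wpM2r; rewrite ?expR_ge0 // ler_wpM2l.
  have -> : v * Ntot%:R = Ntot%:R * d.+1%:R * expR 1 * (256 ^+ 4 * harmonic n) :> R by rewrite /v; ring.
  by rewrite ler_wpM2l ?cube_exp_bound // !mulr_ge0 ?expR_ge0.
have total : (#|[pred G : graph n | regular_graph d G && (G \in A)]| +
    #|[set G : graph n | regular_graph d G && (G \notin A)]| = Ntot)%N.
  rewrite /Ntot -[RHS](cardsID [set G : graph n | G \in A]); congr (_ + _)%N;
    by apply: eq_card => G; rewrite !finset.inE // andbC.
rewrite /prob_regular (_ : #|[pred G : graph n | regular_graph d G]| = Ntot); last first.
  by apply: eq_card => G; rewrite !finset.inE.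
have good_le := leq_addr #|[set G : graph n | regular_graph d G && (G \notin A)]|
  #|[pred G : graph n | regular_graph d G && (G \in A)]|.
rewrite total in good_le.
rewrite ler_pdivlMr // ler_pdivrMr // mul1r ler_nat good_le andbT.
rewrite mulrBl mul1r lerBlDr; apply: le_trans (lerD (lexx _) few).
by rewrite -natrD total.
Qed.

Local Open Scope classical_set_scope.

Lemma prob_regular_cvg1 d (A : forall n, set (graph n)) (k : nat -> nat) : (3 <= d)%N ->
  (forall n, k n * (2 * d + 1) <= n %/ (200 * (200 * d)))%N ->
  (\forall n \near \oo, forall G : graph n, well_linked G (k n) -> A n G) ->
  prob_regular R d (A n) @[n --> within [set n | ~~ odd (n * d)] \oo] --> (1 : R).
Proof.
move=> d3 kJ HA.
pose v n : R := (d.+1%:R * expR 1 * 256 ^+ 4) * harmonic n.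
apply: (cvg_to_1 (v := v)).
  rewrite -[X in _ --> X](mulr0 (d.+1%:R * expR 1 * 256 ^+ 4)).
  apply: cvgM; first exact: cvg_cst.
  by apply: cvg_within_filter; exact: cvg_harmonic.
rewrite near_withinE; near=> n => nd.
apply: (prob_regular_ge (k := k n)) => //.
- by near: n; exact: nbhs_infty_gt.
- by near: n; exact: nbhs_infty_ge.
- by near: n; exact: nbhs_infty_gt.
- by near: n.
Unshelve. all: by end_near. Qed.

End RegularProbability.

Local Open Scope classical_set_scope.
Local Open Scope ring_scope.

(** * Linear gonality *)

Lemma well_linked_gonality (R : realType) n (Gam : metric_graph R n) k (c : R) :
  well_linked (model Gam) k -> (0 < n)%N -> (4 * k <= n)%N ->
  c * n%:R <= k.+1%:R -> div_gonality_between (c * n%:R) (1 * n%:R) Gam.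
Proof.
move=> wl n0 kn ck; apply: gonality_betweenP => //.
  move=> D /(positive_rank_deg wl n0 kn) kD; apply: (le_trans ck).
  by rewrite -[k.+1%:R]/(k.+1%:Z%:~R) ler_int; lia.
exists (all_vertices Gam); first exact: all_vertices_positive_rank.
by rewrite deg_all_vertices mul1r.
Qed.

Lemma natr_le_divn_succ (R : realType) (n K : nat) : (0 < K)%N ->
  K%:R^-1 * n%:R <= (n %/ K).+1%:R :> R.
Proof.
move=> K0; rewrite mulrC ler_pdivrMr ?ltr0n // -natrM ler_nat.
by apply: ltnW; exact: ltn_ceil.
Qed.

Theorem theorem1p2 (R : realType) :
  (forall p : nat -> R,
     (forall n, 0 <= p n <= 1) ->
     (n%:R * p n @[n --> \oo] --> +oo) ->
     (exists c1 c2 : R, [/\ 0 < c1, 0 < c2 &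
        prob_Gnp (p n)
          [set G : graph n |
             div_gonality_between (c1 * n%:R) (c2 * n%:R)
               (unit_metric_graph R G)] @[n --> \oo] --> (1 : R)])
     /\
     (exists c1 c2 : R, [/\ 0 < c1, 0 < c2 &
        prob_Gnp (p n)
          [set G : graph n |
             forall Gam : metric_graph R n, model Gam = G ->
               div_gonality_between (c1 * n%:R) (c2 * n%:R) Gam]
          @[n --> \oo] --> (1 : R)]))
  /\
  (forall d : nat, (3 <= d)%N ->
     exists c1 c2 : R, [/\ 0 < c1, 0 < c2 &
       prob_regular R d
         [set G : graph n |
            div_gonality_between (c1 * n%:R) (c2 * n%:R)
              (unit_metric_graph R G)]
         @[n --> within [set n | ~~ odd (n * d)] \oo] --> (1 : R)]).

Proof.
split=> [p p01 pn|d d3].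
- have k8 n : (n %/ 8 <= n)%N by exact: leq_div.
  have main n (Gam : metric_graph R n) : (0 < n)%N ->
      well_linked (model Gam) (n %/ 8) ->
      div_gonality_between (8^-1 * n%:R) (1 * n%:R) Gam.
    move=> n0 wl; apply: (well_linked_gonality wl n0).
      by have := leq_trunc_div n 8; lia.
    exact: natr_le_divn_succ.
  split; exists 8^-1, 1; split=> //; apply: (prob_Gnp_cvg1 p01 pn k8); near=> n;
    (have n0 : (0 < n)%N by near: n; exact: nbhs_infty_gt).
  + by move=> G wl; exact: (main _ (unit_metric_graph R G)).
  + by move=> G wl Gam E; apply: main => //; rewrite E.
(* With k = n / K, a cut of a random regular graph has more than k (2 d + 1)
   edges: at most 2 k d meet the vertices left out, and k are to remain. *)
- pose K := (200 * (200 * d) * (2 * d + 1))%N.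
  have K0 : (0 < K)%N by rewrite /K; nia.
  exists K%:R^-1, 1; split; rewrite ?invr_gt0 ?ltr0n //.
  apply: (prob_regular_cvg1 (k := fun n => (n %/ K)%N)) => //.
    move=> n; rewrite leq_divRL; last by nia.
    by apply: leq_trans (leq_trunc_div n K); apply: eq_leq; rewrite /K; ring.
  near=> n => G wl.
  have n0 : (0 < n)%N by near: n; exact: nbhs_infty_gt.
  apply: (well_linked_gonality (Gam := unit_metric_graph R G) wl n0).
    have := leq_trunc_div n K; have : (4 <= K)%N by rewrite /K; nia.
    by nia.
  exact: natr_le_divn_succ.
Unshelve. all: by end_near. Qed.
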